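(* For any $v_0=(q_0,G_0,\xi_0,\rho_0)\in C(\Omega;\mathbb R^{2d+2})$ with $\rho_0>0$, $\xi_0\equiv\rho_0^{\nu}$, $G_0\equiv\nabla\xi_0$, there exists a maximizer $$(E,B)\in\mathcal M([0,T]\times\Omega;\mathbb R^{2d+2})\times\mathcal M([0,T]\times\Omega;\mathbb R^{(2d+2)\times(2d+2)}_s)$$ of the dual problem $$\tilde{\mathcal J}(v_0,T)=\sup\{-\langle v_0,E\rangle+\mathcal K(E,B)\}$$ associated (as described in the context) with the augmented Euler–Korteweg system; the supremum is over such pairs of measures satisfying (LC) and $\mathfrak hI\mathcal L+2B\ge0$. Moreover there is no duality gap: $0\le\tilde{\mathcal I}(v_0,T)=\tilde{\mathcal J}(v_0,T)<+\infty$.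
   Context: Notation. $\Omega=\mathbb T^d$ is the periodic box with Lebesgue measure $dx$; $T>0$; $\mathcal L=dx\,dt$ on $[0,T]\times\Omega$. $\mathbb R^{N\times N}_s$ are the symmetric matrices with the Löwner order ($A\ge B$ iff $A-B$ is positive semidefinite) and Frobenius scalar product; $I$ is the identity matrix; $e_i$ is the standard basis. $\mathcal M(Q;V)$ denotes finite $V$-valued Radon measures on $Q$; a symmetric-matrix-valued measure is $\ge0$ if its values are positive semidefinite. $\langle f,\mu\rangle=\int_{[0,T]\times\Omega}f\cdot d\mu$. Functions of $x$ only are also regarded as time-independent functions of $(t,x)$. Original system. The Euler–Korteweg system is $\partial_tq+\operatorname{div}(\frac{q\otimes q}\rho)+\nabla(\tilde P(\rho))-\rho\nabla\big(k(\rho)\Delta\rho+\frac12k'(\rho)|\nabla\rho|^2\big)=0$, $\partial_t\rho+\operatorname{div}q=0$, $q(0)=q_0$, $\rho(0)=\rho_0$, with $k(\rho)=\frac{(s+3)^2}4\rho^s$, $s>-1$, $\nu:=\frac{s+3}2$, and $\tilde P(\rho)=(\nu-1)\rho^{2\nu-1}+P(\rho)$. Assumptions on $P$. $P:[0,\infty)\to\mathbb R$ is continuous and convex, $P(0)=0$, and $P(y)=U'(y)y-U(y)+U(0)$ for $y>0$, where $U:[0,\infty)\to\mathbb R$ is continuous and convex, smooth with $U''>0$ on $(0,\infty)$. The function $2U(y)-dP(y)$ is convex. By adding an affine function to $U$ (this does not change $P$), $U$ is normalized so that $2U(y)-dP(y)-y\ge0$ for $y\ge0$. Augmented system. With $\xi=\rho^\nu$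 and $G=\nabla\xi$ the system is rewritten as $\partial_tq+\operatorname{div}(\frac{q\otimes q}\rho)+\nabla\big((\nu-1)\frac{\xi^2}\rho+P(\rho)\big)=\nu\nabla\operatorname{div}(\frac{\xi G}\rho)-\operatorname{div}(\frac{G\otimes G}\rho)+(1-\nu)\nabla(\frac{|G|^2}\rho)$, $\partial_t\xi+\nu\operatorname{div}(\frac{q\xi}\rho)+(1-\nu)\frac{q\cdot G}\rho=0$, $\partial_tG+\nu\nabla\operatorname{div}(\frac{q\xi}\rho)+(1-\nu)\nabla(\frac{q\cdot G}\rho)=0$, $\partial_t\rho+\operatorname{div}q=0$, with initial data $(q_0,G_0,\xi_0,\rho_0)$ and the linear constraint $\nabla\xi-G=0$. Abstract form. $n=N=2d+2$, $v=(q,G,\xi,\rho)\in\mathbb R^d\times\mathbb R^d\times\mathbb R\times\mathbb R$, $\mathcal Av=\nabla\xi-G$, $\operatorname{dom}\mathbf F=\{\rho>0\}\cup\{0\}$, $$\mathbf F(v)=\frac{v\otimes v}\rho+\sum_{i=1}^dP(\rho)e_i\otimes e_i+[2U(\rho)-dP(\rho)-\rho]e_N\otimes e_N\ (\rho>0),\qquad\mathbf F(0)=2U(0)e_N\otimes e_N,$$ $$L\begin{pmatrix}\Xi&\Gamma&a&g\\ \Gamma^\top&\Upsilon&b&r\\ a^\top&b^\top&\alpha&\beta\\ g^\top&r^\top&\beta&\kappa\end{pmatrix}=\begin{pmatrix}-\operatorname{div}\Xi-\operatorname{div}\Upsilon-(\nu-1)\nabla\alpha+\nu\nabla\operatorname{div}b+(1-\nu)\nabla(\operatorname{Tr}\Upsilon)\\-\nu\nabla\operatorname{div}a+(\nu-1)\nabla(\operatorname{Tr}\Gamma)\\-\nu\operatorname{div}a+(\nu-1)\operatorname{Tr}\Gamma\\-\operatorname{div}g\end{pmatrix},$$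 where $\Xi,\Gamma,\Upsilon$ are $d\times d$ blocks ($\Xi,\Upsilon$ symmetric), $a,b,g,r\in\mathbb R^d$, $\alpha,\beta,\kappa\in\mathbb R$. The augmented system is $\partial_tv=L(\mathbf F(v))$, $\mathcal Av=0$. Weight. $\mathfrak h:[0,T]\to\mathbb R_+$ is a fixed smooth function bounded away from $0$ and $\infty$. Constraint (LC) on pairs of measures $(E,B)$: $\langle\partial_t\Psi,B\rangle+\langle L\Psi,E\rangle=0$ for all smooth $\Psi:[0,T]\times\Omega\to\mathbb R^{N\times N}_s$ with $\mathcal AL\Psi=0$ and $\Psi(0)=0$. Problems. With $(E,B)\in\mathcal M([0,T]\times\Omega;\mathbb R^n)\times\mathcal M([0,T]\times\Omega;\mathbb R^{N\times N}_s)$ satisfying (LC), and $(v,M)\in C([0,T]\times\Omega;\mathbb R^n)\times C([0,T]\times\Omega;\mathbb R^{N\times N}_s)$ with $v\in\operatorname{dom}\mathbf F$ and $\mathbf F(v)\le M$ pointwise: $\tilde{\mathcal I}(v_0,T)=\inf_{v,M}\sup_{E,B}[\langle v-v_0,E\rangle+\frac12\langle M,\mathfrak hI\mathcal L+2B\rangle]$, $\tilde{\mathcal J}(v_0,T)=\sup_{E,B}\inf_{v,M}[\text{same}]$. $\mathcal K(E,B)=\inf_{\mathbf F(z)\le M}\langle z,E\rangle+\frac12\langle M,\mathfrak hI\mathcal L+2B\rangle$ over the same class of pairs $(z,M)$, with value $-\infty$ allowed. The problem $\tilde{\mathcal J}$ is equivalently $\sup\{-\langle v_0,E\rangle+\mathcal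 K(E,B)\}$ over $(E,B)$ satisfying (LC) and $\mathfrak hI\mathcal L+2B\ge0$. *)

(* Defs.v *)
From HB Require Import structures.
From mathcomp Require Import all_boot all_order all_algebra.
From mathcomp Require Import all_classical all_reals all_analysis.

Set Implicit Arguments.
Unset Strict Implicit.
Unset Printing Implicit Defensive.

Import Order.TTheory GRing.Theory Num.Theory.
Import numFieldNormedType.Exports.

Local Open Scope classical_set_scope.
Local Open Scope ring_scope.

Section lebesgue_on_the_torus.
Context {R : realType}.

Definition unit_interval : set (measurableTypeR R) := [set x : R | 0 <= x < 1].

Lemma measurable_unit_interval : measurable unit_interval.
Proof.
rewrite (_ : unit_interval = `[0, 1[%classic); first exact: measurable_itv.
by apply/seteqP; split => x /=; rewrite in_itv.
Qed.

Definition circle_measure := mrestr (@lebesgue_measure R) measurable_unit_interval.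

HB.instance Definition _ := Measure.on circle_measure.

Let circle_fin : fin_num_fun circle_measure.
Proof.
move=> A mA; rewrite ge0_fin_numE//.
apply: (@le_lt_trans _ _ (lebesgue_measure (`[0, 1[%classic : set R))).
  rewrite /circle_measure /mrestr; apply: le_measure; rewrite ?inE.
  - by apply: measurableI => //; exact: measurable_unit_interval.
  - exact: measurable_itv.
  - by move=> x [_]; rewrite /unit_interval/= in_itv.
by rewrite lebesgue_measure_itv/=; case: ifP => //; rewrite -EFinD ltry.
Qed.

HB.instance Definition _ :=
  @Measure_isFinite.Build _ _ _ circle_measure circle_fin.

Definition tuple_cons n (p : measurableTypeR R * n.-tuple (measurableTypeR R)) :
  n.+1.-tuple (measurableTypeR R) := [tuple of p.1 :: p.2].

Lemma measurable_tuple_cons n : measurable_fun setT (@tuple_cons n).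
Proof. by apply: measurable_cons => //; exact: measurable_snd. Qed.

Section step.
Variables (n : nat).
Variable mu : {finite_measure set (n.-tuple (measurableTypeR R)) -> \bar R}.

Definition torus_step := pushforward (circle_measure \x mu)%E (@tuple_cons n).

Let measurable_step A : measurable A -> measurable (@tuple_cons n @^-1` A).
Proof. by move=> mA; rewrite -[X in measurable X]setTI; exact: measurable_tuple_cons. Qed.

Let step0 : torus_step set0 = 0%E.
Proof. by rewrite /torus_step /pushforward preimage_set0 measure0. Qed.

Let step_ge0 A : (0 <= torus_step A)%E.
Proof. by rewrite /torus_step /pushforward; exact: measure_ge0. Qed.

Let step_sigma : semi_sigma_additive torus_step.
Proof.
move=> F mF tF mUF; rewrite /torus_step /pushforward preimage_bigcup.
apply: measure_semi_sigma_additive.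
- by move=> k; exact: measurable_step.
- apply/trivIsetP => /= i j _ _ ij; rewrite -preimage_setI.
  by move/trivIsetP : tF => /(_ _ _ _ _ ij) ->//; rewrite preimage_set0.
- by rewrite -preimage_bigcup; exact: measurable_step.
Qed.

HB.instance Definition _ := isMeasure.Build _ _ _ torus_step
  step0 step_ge0 step_sigma.

Let step_fin : fin_num_fun torus_step.
Proof.
move=> A mA; rewrite ge0_fin_numE ?measure_ge0//.
apply: (@le_lt_trans _ _ (torus_step setT)).
  by apply: le_measure; rewrite ?inE.
rewrite /torus_step /pushforward preimage_setT -setXTT product_measure1E//.
by rewrite lte_mul_pinfty// ?fin_num_measure// ltey_eq fin_num_measure.
Qed.

HB.instance Definition _ := @Measure_isFinite.Build _ _ _ torus_step step_fin.

End step.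

(* dx on T^n, carried by the fundamental domain [0, 1)^n *)
Fixpoint torus_measure n :
    {finite_measure set (n.-tuple (measurableTypeR R)) -> \bar R} :=
  match n with
  | 0%N => \d_([tuple] : 0.-tuple (measurableTypeR R))
  | n'.+1 => torus_step (torus_measure n')
  end.

End lebesgue_on_the_torus.

(* R^N with N = 2 d + 2 is split as R^d x R^d x R x R, v = (q, G, xi, rho). *)

Definition dimN (d : nat) : nat := (d + (d + (1 + 1)))%N.

Section indices.
Variable d : nat.
Definition iq (j : 'I_d) : 'I_(dimN d) := lshift _ j.
Definition iG (j : 'I_d) : 'I_(dimN d) := rshift d (lshift _ j).
Definition ixi : 'I_(dimN d) := rshift d (rshift d (lshift 1 ord0)).
Definition irho : 'I_(dimN d) := rshift d (rshift d (rshift 1 ord0)).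
End indices.
Arguments ixi {d}.
Arguments irho {d}.

Section euler_korteweg.
Context {R : realType} {d : nat}.
Local Notation N := (dimN d).
Local Notation spacetime := (R * 'rV[R]_d)%type.
Local Notation vec := 'rV[R]_N.
Local Notation mat := 'M[R]_N.

Definition mkvec (q G : 'rV[R]_d) (xi rho : R) : vec :=
  row_mx q (row_mx G (row_mx xi%:M rho%:M)).

(* Functions on [0,T] x T^d are functions on R x R^d that are 1-periodic in
   each space coordinate; only their values on the slab 0 <= t <= T matter. *)

Definition slab (T : R) : set spacetime := [set p | 0 <= p.1 <= T].

Definition unit_vec (j : 'I_d) : 'rV[R]_d := delta_mx 0 j.

Definition periodic (V : Type) (f : spacetime -> V) :=
  forall t x j, f (t, x + unit_vec j) = f (t, x).

(* C^infty on an open set D: all iterated directional derivatives exist and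
   are continuous on D. *)
Definition iterD (V : normedModType R) (s : seq V) (f : V -> R) : V -> R :=
  foldr (fun v g => 'D_v g) f s.

Definition smooth_on (V : normedModType R) (D : set V) (f : V -> R) :=
  forall (s : seq V) (x : V), D x ->
    (forall v, derivable (iterD s f) x v) /\ {for x, continuous (iterD s f)}.

Definition smooth (V : normedModType R) (f : V -> R) := smooth_on setT f.

Definition dt (f : spacetime -> R) : spacetime -> R := 'D_(1, 0) f.
Definition dx (j : 'I_d) (f : spacetime -> R) : spacetime -> R :=
  'D_(0, unit_vec j) f.

Definition gradx (f : spacetime -> R) (p : spacetime) : 'rV[R]_d :=
  \row_i dx i f p.
Definition divx (f : 'I_d -> spacetime -> R) (p : spacetime) : R :=
  \sum_i dx i (f i) p.

Definition psd n (A : 'M[R]_n) :=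
  A^T = A /\ forall z : 'cV[R]_n, 0 <= (z^T *m A *m z) 0 0.

Definition loewner n (A B : 'M[R]_n) := psd (B - A).

Definition domF (v : vec) := 0 < v 0 irho \/ v = 0.

(* On [domF] the second branch is taken only at v = 0. *)
Definition F (P U : R -> R) (v : vec) : mat :=
  let rho := v 0 irho in
  if 0 < rho then
    rho^-1 *: (v^T *m v)
    + \sum_(i < d) P rho *: delta_mx (iq i) (iq i)
    + (2 * U rho - d%:R * P rho - rho) *: delta_mx irho irho
  else (2 * U 0) *: delta_mx irho irho.

Definition Aop (w : spacetime -> vec) (p : spacetime) : 'rV[R]_d :=
  \row_i (dx i (fun p' => w p' 0 ixi) p - w p 0 (iG i)).

Definition Lop (nu : R) (Psi : spacetime -> mat) (p : spacetime) : vec :=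
  let Xi i j : spacetime -> R := fun p' => Psi p' (iq i) (iq j) in
  let Ups i j : spacetime -> R := fun p' => Psi p' (iG i) (iG j) in
  let a i : spacetime -> R := fun p' => Psi p' (iq i) ixi in
  let b i : spacetime -> R := fun p' => Psi p' (iG i) ixi in
  let g i : spacetime -> R := fun p' => Psi p' (iq i) irho in
  let alpha : spacetime -> R := fun p' => Psi p' ixi ixi in
  let trGam : spacetime -> R := fun p' => \sum_i Psi p' (iq i) (iG i) in
  let trUps : spacetime -> R := fun p' => \sum_i Psi p' (iG i) (iG i) in
  mkvec
    (- (\row_i divx (Xi i) p) - (\row_i divx (Ups i) p)
     - (nu - 1) *: gradx alpha p + nu *: gradx (divx b) p
     + (1 - nu) *: gradx trUps p)
    (- (nu *: gradx (divx a) p) + (nu - 1) *: gradx trGam p)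
    (- (nu * divx a p) + (nu - 1) * trGam p)
    (- divx g p).

(* On the compact metric space [0,T] x T^d, finite Radon measures are the finite
   signed Borel measures; they are represented by the charges on R x R^d carried
   by the fundamental domain [0,T] x [0,1)^d. *)

Definition Xd := (measurableTypeR R * d.-tuple (measurableTypeR R))%type.

Definition domain (T : R) : set Xd :=
  [set p : Xd | 0 <= (p.1 : R) <= T /\ forall j, 0 <= (tnth p.2 j : R) < 1].

Definition point (p : Xd) : spacetime := (p.1 : R, \row_j (tnth p.2 j : R)).

Definition dxdt : set Xd -> \bar R :=
  product_measure1 (@lebesgue_measure R) (torus_measure d).
HB.instance Definition _ := Measure.on dxdt.

Definition carried_by (T : R) (mu : {charge set Xd -> \bar R}) :=
  forall A, measurable A -> A `&` domain T = set0 -> mu A = 0%E.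

Definition charge_integral (mu : {charge set Xd -> \bar R}) (D : set Xd)
    (f : Xd -> R) : R :=
  let P := cid (Hahn_decomposition mu) in
  let muPN := projT2 (cid (projT2 P)) in
  Rintegral (jordan_pos muPN) D f - Rintegral (jordan_neg muPN) D f.

Definition vmeasure := 'I_N -> {charge set Xd -> \bar R}.
Definition mmeasure := 'I_N -> 'I_N -> {charge set Xd -> \bar R}.

Definition is_vmeasure (T : R) (E : vmeasure) := forall i, carried_by T (E i).

Definition is_sym_mmeasure (T : R) (B : mmeasure) :=
  (forall i j, carried_by T (B i j)) /\
  (forall i j A, measurable A -> B i j A = B j i A).

Definition vpairing (T : R) (w : spacetime -> vec) (E : vmeasure) : R :=
  \sum_i charge_integral (E i) (domain T) (fun p => w (point p) 0 i).

Definition mpairing (T : R) (M : spacetime -> mat) (B : mmeasure) : R :=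
  \sum_i \sum_j charge_integral (B i j) (domain T) (fun p => M (point p) i j).

(* < M, h I dxdt + 2 B > *)
Definition weighted_pairing (T : R) (h : R -> R) (M : spacetime -> mat)
    (B : mmeasure) : R :=
  Rintegral dxdt (domain T) (fun p => h p.1 * \tr (M (point p)))
  + 2 * mpairing T M B.

(* h I dxdt + 2 B >= 0 *)
Definition weighted_psd (T : R) (h : R -> R) (B : mmeasure) :=
  forall A, measurable A -> A `<=` domain T ->
    psd ((Rintegral dxdt A (fun p => h p.1))%:M
         + 2 *: \matrix_(i < N, j < N) fine (B i j A)).

(* A function is smooth on the closed slab when it is the restriction of a
   smooth function on R x T^d. *)
Definition test_field (Psi : spacetime -> mat) :=
  [/\ forall i j, smooth (fun p => Psi p i j),
      periodic Psi
    & forall p, (Psi p)^T = Psi p].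

Definition LC (T nu : R) (E : vmeasure) (B : mmeasure) :=
  forall Psi, test_field Psi ->
    (forall p, slab T p -> Aop (Lop nu Psi) p = 0) ->
    (forall x, Psi (0, x) = 0) ->
    mpairing T (fun p => \matrix_(i, j) dt (fun p' => Psi p' i j) p) B
    + vpairing T (Lop nu Psi) E = 0.

Definition primal_pair (T : R) (P U : R -> R)
    (v : spacetime -> vec) (M : spacetime -> mat) :=
  [/\ {within slab T, continuous v} /\ periodic v,
      {within slab T, continuous M} /\ periodic M,
      forall p, slab T p -> (M p)^T = M p
    & forall p, slab T p -> domF (v p) /\ loewner (F P U (v p)) (M p)].

Definition lagrangian (T : R) (h : R -> R) (v0 : 'rV[R]_d -> vec)
    (v : spacetime -> vec) (M : spacetime -> mat)
    (E : vmeasure) (B : mmeasure) : R :=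
  vpairing T (fun p => v p - v0 p.2) E + 2^-1 * weighted_pairing T h M B.

Definition constrained_pair (T nu : R) (E : vmeasure) (B : mmeasure) :=
  [/\ is_vmeasure T E, is_sym_mmeasure T B & LC T nu E B].

Definition I_tilde (T nu : R) (h P U : R -> R) (v0 : 'rV[R]_d -> vec) : \bar R :=
  ereal_inf [set s | exists v M, primal_pair T P U v M /\
    s = ereal_sup [set r | exists E B, constrained_pair T nu E B /\
          r = (lagrangian T h v0 v M E B)%:E]].

Definition J_tilde (T nu : R) (h P U : R -> R) (v0 : 'rV[R]_d -> vec) : \bar R :=
  ereal_sup [set s | exists E B, constrained_pair T nu E B /\
    s = ereal_inf [set r | exists v M, primal_pair T P U v M /\
          r = (lagrangian T h v0 v M E B)%:E]].

Definition K (T : R) (h P U : R -> R) (E : vmeasure) (B : mmeasure) : \bar R :=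
  ereal_inf [set r | exists z M, primal_pair T P U z M /\
    r = (vpairing T z E + 2^-1 * weighted_pairing T h M B)%:E].

Definition dual_feasible (T nu : R) (h : R -> R) (E : vmeasure) (B : mmeasure) :=
  constrained_pair T nu E B /\ weighted_psd T h B.

Definition dual_value (T : R) (h P U : R -> R) (v0 : 'rV[R]_d -> vec)
    (E : vmeasure) (B : mmeasure) : \bar R :=
  (- (vpairing T (fun p => v0 p.2) E)%:E + K T h P U E B)%E.

Definition J_dual (T nu : R) (h P U : R -> R) (v0 : 'rV[R]_d -> vec) : \bar R :=
  ereal_sup [set s | exists E B, dual_feasible T nu h E B /\
    s = dual_value T h P U v0 E B].

Definition pressure_law (P U : R -> R) :=
  [/\ [/\ {within `[0, +oo[, continuous P},
          convex_function (`[0, +oo[%classic : set R^o) P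
        & P 0 = 0],
      [/\ {within `[0, +oo[, continuous U},
          convex_function (`[0, +oo[%classic : set R^o) U,
          smooth_on (`]0, +oo[%classic : set R^o) U
        & forall y, 0 < y -> 0 < derive1n 2 U y],
      forall y, 0 < y -> P y = derive1 U y * y - U y + U 0,
      convex_function (`[0, +oo[%classic : set R^o)
        (fun y => 2 * U y - d%:R * P y)
    & forall y, 0 <= y -> 0 <= 2 * U y - d%:R * P y - y].

Definition weight (T : R) (h : R -> R) :=
  smooth (h : R^o -> R) /\
  exists m M, 0 < m /\ forall t, 0 <= t <= T -> m <= h t <= M.

Definition initial_datum (nu : R) (v0 : 'rV[R]_d -> vec) :=
  [/\ continuous v0 /\ (forall x j, v0 (x + unit_vec j) = v0 x),
      forall x, 0 < v0 x 0 irho,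
      forall x, v0 x 0 ixi = (v0 x 0 irho) `^ nu
    & forall x j, is_derive x (unit_vec j) (fun y => v0 y 0 ixi)
        (v0 x 0 (iG j))].

End euler_korteweg.
Arguments pressure_law {R} d P U.

(* Main.v *)
(* Each dual pair gives the lower bound inf_(v, M) of the Lagrangian, so that
   J_dual <= J~ <= I~, and it suffices to find an admissible (E, B) of value at
   least I0, the infimum of the cost (1/2) <M, h I dxdt> over the (v, M) with
   (v - v_0, M) = (L Psi, d_t Psi) for a test field Psi; clearly I~ <= I0.
   The pair (v_0, C I), with C large, comes from Psi = C t I, and every continuous
   pair uniformly close to it is primal feasible, since rho_0 is bounded away
   from 0. By convexity, violations of the constraint (v - v_0, M) in
   {(L Psi, d_t Psi)} can therefore be penalized exactly by a multiple of their
   uniform norm, and Hahn-Banach turns the penalized problem into a linear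
   functional l, bounded for the uniform norm on bounded functions, that vanishes
   on the (L Psi, d_t Psi) and satisfies I0 <= cost - l(v - v_0, M).
   The Riesz representation of - l is (E, B). The positivity of h I + 2 B follows by
   moving from (v_0, C I) along g z z^T with g >= 0 continuous, and by approximating
   indicators of Borel sets by such g in L^1. *)
Require Import Defs.
From HB Require Import structures.
From mathcomp Require Import all_boot all_order all_algebra.
From mathcomp Require Import all_classical all_reals all_analysis.
From mathcomp Require Import measurable_realfun.
From mathcomp Require Import ring lra.
Import Defs.
Import Order.TTheory GRing.Theory Num.Theory.
Import numFieldNormedType.Exports.
Set Implicit Arguments.
Unset Strict Implicit.
Unset Printing Implicit Defensive.
Local Open Scope classical_set_scope.
Local Open Scope ring_scope.

(** * The Hahn-Banach theorem *)

(** The penalty constant bounds the separating functional in the uniform norm, so Hahn-Banach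
    delivers a maximizer itself and not merely a maximizing sequence. The datum v_0 may be merely
    continuous because only the difference v - v_0 has to be the image of a test field. The obstacle
    is the Riesz representation. The functional has to act on all bounded functions, since it is
    evaluated on indicators of cylinder sets; as a set function it is then only finitely additive.
    Points of the box are therefore coded by binary sequences. The cylinders of a given length form
    a finite partition on which a continuous function is nearly constant, so its integral sees only
    their masses, and the quantile map of these masses carries Lebesgue measure on an interval to a
    countably additive measure with the same integrals of continuous functions. Boundedness and
    uniform continuity of continuous periodic functions come from the compactness of Cantor space.
    The L^1 density is a sigma-algebra argument starting from time and from trigonometric functions
    of the space coordinates. *)

Section hahn_banach.
Context {R : realType} {V : lmodType R}.
Variable S : V -> Prop.
Hypothesis S0 : S 0.
Hypothesis SD : forall x y, S x -> S y -> S (x + y).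
Hypothesis SZ : forall c x, S x -> S (c *: x).

(** Equality for [c > 0] follows by scaling back with [c^-1], and [c = 0] gives [q 0 <= 0]. *)
Definition sublinear (q : V -> R) :=
  (forall x y, S x -> S y -> q (x + y) <= q x + q y) /\
  (forall c x, 0 <= c -> S x -> q (c *: x) <= c * q x).

Let SN x : S x -> S (- x).
Proof. by move=> Sx; rewrite -scaleN1r; exact: SZ. Qed.

Lemma sublinear0 q : sublinear q -> q 0 = 0.
Proof.
move=> [qD qZ]; have := qZ 0 0 (lexx _) S0; rewrite scaler0 mul0r => q0.
by have := qD 0 0 S0 S0; rewrite addr0 => q1; apply/eqP; rewrite eq_le q0/=; lra.
Qed.

Lemma sublinear_geN q x : sublinear q -> S x -> - q (- x) <= q x.
Proof.
move=> sq Sx; have := sq.1 x (- x) Sx (SN Sx).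
by rewrite subrr sublinear0//; lra.
Qed.

(** The common source of the lower bounds of chains, of the one-step improvement in [hahn_banach]
    and of the penalized functional in [separation]. The bound [b] keeps the infimum finite, and the
    two closure conditions on [Q] let it inherit subadditivity and homogeneity. The value 0 off [S]
    makes functionals that agree on [S] equal, as antisymmetry in Zorn's lemma requires. *)
Lemma sublinear_inf (Q : set (V -> R)) (b : V -> R) : Q !=set0 ->
  (forall f x, Q f -> S x -> b x <= f x) ->
  (forall f g x y, Q f -> Q g -> S x -> S y ->
    exists2 h, Q h & h (x + y) <= f x + g y) ->
  (forall f c x, Q f -> 0 <= c -> S x -> exists2 h, Q h & h (c *: x) <= c * f x) ->
  exists q, [/\ sublinear q, forall f x, Q f -> S x -> q x <= f x &
    forall x, ~ S x -> q x = 0].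
Proof.
move=> [f0 Qf0] Qb QD QZ.
pose E x := [set f x | f in Q].
have E0 x : E x !=set0 by exists (f0 x), f0.
have Elb x : S x -> has_lbound (E x) by move=> Sx; exists (b x) => _ [f Qf <-]; exact: Qb.
pose q x := if pselect (S x) then inf (E x) else 0.
have qS x : S x -> q x = inf (E x) by rewrite /q; case: pselect.
have qle f x : Q f -> S x -> q x <= f x.
  by move=> Qf Sx; rewrite qS//; apply: ge_inf; [exact: Elb|exists f].
have leq x a : S x -> (forall f, Q f -> a <= f x) -> a <= q x.
  move=> Sx h; rewrite qS//; apply: lb_le_inf => // _ [f Qf <-]; exact: h.
exists q; split=> //; last by move=> x nS; rewrite /q; case: pselect.
split=> [x y Sx Sy|c x c0 Sx].
  rewrite -lerBlDr; apply: (leq x) => // f Qf; rewrite lerBlDr [leRHS]addrC -lerBlDr.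
  apply: (leq y) => // g Qg; rewrite lerBlDr [leRHS]addrC.
  by have [h Qh] := QD _ _ _ _ Qf Qg Sx Sy; apply: le_trans; apply: qle => //; exact: SD.
move: c0; rewrite le_eqVlt => /orP[/eqP<-|c0].
  have [h Qh] := QZ _ 0 _ Qf0 (lexx _) Sx; rewrite !mul0r; apply: le_trans.
  by apply: qle => //; exact: SZ.
rewrite -ler_pdivrMl//; apply: (leq x) => // f Qf; rewrite ler_pdivrMl//.
have [h Qh] := QZ _ _ _ Qf (ltW c0) Sx; apply: le_trans.
by apply: qle => //; exact: SZ.
Qed.

(* A minimal sublinear functional below p is linear: for each z it coincides
   with y |-> inf_(t >= 0) (q (y + t z) - t q z). *)
Theorem hahn_banach (p : V -> R) : sublinear p ->
  exists l : V -> R,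
    [/\ forall x y, S x -> S y -> l (x + y) = l x + l y,
        forall c x, S x -> l (c *: x) = c * l x
      & forall x, S x -> l x <= p x].
Proof.
move=> sp.
pose T := {q : V -> R | [/\ sublinear q, forall x, S x -> q x <= p x &
                            forall x, ~ S x -> q x = 0]}.
(* The order is reversed: Zorn's lemma yields maximal elements, and a minimal functional is
   wanted. *)
pose Rel (a b : T) : bool := `[< forall x, S x -> sval b x <= sval a x >].
have [||||q0 q0min] := @Zorn T Rel.
- by move=> t; apply/asboolP.
- move=> r s t /asboolP rs /asboolP st; apply/asboolP => x Sx; apply: le_trans (rs _ Sx); exact: st.
- move=> [s [s1 s2 s3]] [t [t1 t2 t3]] /asboolP st /asboolP ts; apply: eq_exist => /=.
  apply: funext => x; have [Sx|nSx] := pselect (S x); last by rewrite s3// t3.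
  by apply/eqP; rewrite eq_le; apply/andP; split; [exact: ts|exact: st].
- move=> A totA; have [[a0 Aa0]|A0] := pselect (A !=set0); last first.
    (* The empty chain is bounded by [p] itself, cut to 0 off [S]. *)
    have [||||q [sq qp q0]] := @sublinear_inf [set p] p.
    + by exists p.
    + by move=> _ x ->.
    + by move=> _ _ x y -> -> Sx Sy; exists p => //; exact: sp.1.
    + by move=> _ c x -> c0 Sx; exists p => //; exact: sp.2.
    unshelve eexists; first by exists q; split=> // x Sx; exact: qp.
    by move=> s As; exfalso; apply: A0; exists s.
  have [||||q [sq qp q0]] := @sublinear_inf [set sval a | a in A] (fun x => - p (- x)).
  + by exists (sval a0), a0.
  + move=> _ x [[a [sa ap a3]] Aa <-] Sx /=.
    apply: le_trans (sublinear_geN sa Sx); rewrite lerN2; exact (ap _ (SN Sx)).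
  + move=> _ _ x y [a Aa <-] [b Ab <-] Sx Sy.
    have [/asboolP ab|/asboolP ba] := totA _ _ Aa Ab.
      exists (sval b); first by exists b.
      apply: le_trans (lerD (ab _ Sx) (lexx _)).
      by case: b {Ab ab} => b [sb ? ?]; exact: sb.1.
    exists (sval a); first by exists a.
    apply: le_trans (lerD (lexx _) (ba _ Sy)).
    by case: a {Aa ba} => a [sa ? ?]; exact: sa.1.
  + move=> _ c x [a Aa <-] c0 Sx; exists (sval a); first by exists a.
    by case: a {Aa} => a [sa ? ?]; exact: sa.2.
  unshelve eexists.
    exists q; split => // x Sx; apply: (@le_trans _ _ (sval a0 x)).
      by apply: qp => //; exists a0.
    by case: a0 {Aa0} => a [? ap ?]; exact: ap.
  by move=> s As; apply/asboolP => x Sx; apply: qp => //; exists s.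
case: q0 q0min => q [sq qp qn] qmin.
have key y z : S y -> S z -> q y + q z <= q (y + z).
  move=> Sy Sz.
  pose g t x := q (x + t *: z) - t * q z.
  have tz t : S (t *: z) by exact: SZ.
  have qt t : 0 <= t -> q (t *: z) <= t * q z by move=> t0; exact: sq.2.
  have qt' t : 0 <= t -> t * q z <= q (t *: z).
    rewrite le_eqVlt => /orP[/eqP<-|t0].
      by rewrite mul0r scale0r sublinear0.
    rewrite -ler_pdivlMl//.
    have ti : 0 <= t^-1 by rewrite invr_ge0 ltW.
    by have := sq.2 t^-1 _ ti (tz t); rewrite scalerA mulVf ?scale1r// gt_eqF.
  have [||||r [sr rg rn]] := @sublinear_inf [set g t | t in [set t | 0 <= t]]
    (fun x => - q (- x)).
  + by exists (g 0), 0 => //=.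
  + move=> _ x [t t0 <-] Sx; rewrite /g.
    have := sq.1 (x + t *: z) (- x) (SD Sx (tz t)) (SN Sx).
    by rewrite addrAC subrr add0r; have := qt' t t0; lra.
  + move=> _ _ x x' [t t0 <-] [t' t'0 <-] Sx Sx'; exists (g (t + t')).
      by exists (t + t') => //=; exact: addr_ge0.
    rewrite /g scalerDl addrACA.
    by have := sq.1 _ _ (SD Sx (tz t)) (SD Sx' (tz t')); lra.
  + move=> _ c x [t t0 <-] c0 Sx; exists (g (c * t)).
      by exists (c * t) => //=; exact: mulr_ge0.
    rewrite /g -scalerA -scalerDr mulrBr mulrA lerD2r.
    by apply: sq.2 => //; exact: SD.
  have rq x : S x -> r x <= q x.
    move=> Sx; have := rg (g 0) x; rewrite /g scale0r addr0 mul0r subr0.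
    by apply => //; exists 0 => //=; apply/funext => v; rewrite scale0r addr0 mul0r subr0.
  have rP : [/\ sublinear r, forall x, S x -> r x <= p x & forall x, ~ S x -> r x = 0].
    by split => // x Sx; apply: le_trans (rq _ Sx) _; exact (qp _ Sx).
  have /(congr1 sval) /= rqE : exist _ r rP = exist _ q (And3 sq qp qn) :> T.
    by apply: qmin; apply/asboolP.
  have g1 : [set g t | t in [set t | 0 <= t]] (g 1) by exists 1 => //=.
  have := rg (g 1) y g1 Sy; rewrite rqE /g scale1r mul1r.
  by rewrite lerBrDr.
have qD x y : S x -> S y -> q (x + y) = q x + q y.
  by move=> Sx Sy; apply/eqP; rewrite eq_le sq.1//= key.
have qN x : S x -> q (- x) = - q x.
  move=> Sx; have := qD x (- x) Sx (SN Sx).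
  by rewrite subrr sublinear0//; lra.
have qZ c x : 0 <= c -> S x -> q (c *: x) = c * q x.
  move=> c0 Sx; apply/eqP; rewrite eq_le sq.2//=.
  by have := sq.2 c (- x) c0 (SN Sx); rewrite scalerN (qN _ (SZ c Sx)) (qN _ Sx) mulrN lerN2.
exists q; split => // c x Sx; have [c0|c0] := leP 0 c; first exact: qZ.
have c0' : 0 <= - c by rewrite oppr_ge0 ltW.
by rewrite -[X in X *: x]opprK scaleNr (qN _ (SZ _ Sx)) (qZ _ _ c0' Sx) mulNr opprK.
Qed.

End hahn_banach.

(** * Integrals of bounded measurable functions *)

Section finite_integrals.
Context d0 {X : measurableType d0} {R : realType}.
Variables (mu : {measure set X -> \bar R}) (D : set X).
Hypotheses (mD : measurable D) (muD : (mu D < +oo)%E).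

Definition bounded_measurable (f : X -> R) :=
  measurable_fun D f /\ exists C, forall x, D x -> `|f x| <= C.

Lemma bounded_measurable_integrable f : bounded_measurable f ->
  mu.-integrable D (EFin \o f).
Proof.
move=> [mf [C fC]]; apply: measurable_bounded_integrable => //.
exists C; split; first exact: num_real.
by move=> M CM x Dx; apply: le_trans (fC _ Dx) (ltW CM).
Qed.

Lemma bounded_measurableD f g : bounded_measurable f -> bounded_measurable g ->
  bounded_measurable (fun x => f x + g x).
Proof.
move=> [mf [C fC]] [mg [C' gC]]; split; first exact: measurable_funD.
exists (C + C') => x Dx; apply: le_trans (ler_normD _ _) _.
by apply: lerD; [exact: fC|exact: gC].
Qed.

Lemma bounded_measurableZ c f : bounded_measurable f ->
  bounded_measurable (fun x => c * f x).
Proof.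
move=> [mf [C fC]]; split; first by apply: measurable_funM => //; exact: measurable_cst.
by exists (`|c| * C) => x Dx; rewrite normrM ler_wpM2l//; exact: fC.
Qed.

Lemma bounded_measurableB f g : bounded_measurable f -> bounded_measurable g ->
  bounded_measurable (fun x => f x - g x).
Proof.
move=> bf bg; have := bounded_measurableD bf (bounded_measurableZ (- 1) bg).
by congr bounded_measurable; apply/funext => x; rewrite mulN1r.
Qed.

Lemma bounded_measurable_norm f : bounded_measurable f ->
  bounded_measurable (fun x => `|f x|).
Proof.
move=> [mf [C fC]]; split; last by exists C => x Dx; rewrite normr_id; exact: fC.
exact: measurableT_comp.
Qed.

Lemma bounded_measurable_cst c : bounded_measurable (fun=> c).
Proof. by split; [exact: measurable_cst|exists `|c|]. Qed.

Lemma bounded_measurable_indic A : measurable A -> bounded_measurable (\1_A : X -> R).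
Proof.
move=> mA; split; first exact: measurable_indic.
by exists 1 => x _; rewrite indicE; case: (_ \in _); rewrite ?normr1// normr0.
Qed.

Lemma bounded_measurable_sum (I : Type) (r : seq I) (f : I -> X -> R) :
  (forall i, bounded_measurable (f i)) ->
  bounded_measurable (fun x => \sum_(i <- r) f i x).
Proof.
move=> bf; elim: r => [|i r IH].
  have := bounded_measurable_cst 0; congr bounded_measurable.
  by apply/funext => x; rewrite big_nil.
have := bounded_measurableD (bf i) IH; congr bounded_measurable.
by apply/funext => x; rewrite big_cons.
Qed.

Lemma Rintegral_sum (I : Type) (r : seq I) (f : I -> X -> R) :
  (forall i, bounded_measurable (f i)) ->
  Rintegral mu D (fun x => \sum_(i <- r) f i x) =
  \sum_(i <- r) Rintegral mu D (f i).
Proof.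
move=> bf; elim: r => [|i r IH].
  rewrite big_nil; under eq_Rintegral do rewrite big_nil.
  by rewrite Rintegral_cst// mul0r.
rewrite big_cons -IH -RintegralD//; last 2 first.
- exact: bounded_measurable_integrable.
- by apply: bounded_measurable_integrable; exact: bounded_measurable_sum.
by apply: eq_Rintegral => x _; rewrite big_cons.
Qed.

Lemma Rintegral_indic A : measurable A ->
  Rintegral mu D (\1_A) = fine (mu (A `&` D)).
Proof. by move=> mA; rewrite /Rintegral integral_indic. Qed.

Lemma Rintegral_dist_le f g : bounded_measurable f -> bounded_measurable g ->
  `|Rintegral mu D f - Rintegral mu D g| <= Rintegral mu D (fun x => `|f x - g x|).
Proof.
move=> bf bg; rewrite -RintegralB//; [|exact: bounded_measurable_integrable..].
by apply: le_normr_Rintegral => //; apply: bounded_measurable_integrable; exact: bounded_measurableB.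
Qed.

Lemma Rintegral_dist f g e : bounded_measurable f -> bounded_measurable g ->
  (forall x, D x -> `|f x - g x| <= e) ->
  `|Rintegral mu D f - Rintegral mu D g| <= e * fine (mu D).
Proof.
move=> bf bg fg; apply: le_trans (Rintegral_dist_le bf bg) _.
rewrite -Rintegral_cst//; apply: le_Rintegral => //.
  by apply/bounded_measurable_integrable/bounded_measurable_norm/bounded_measurableB.
exact/bounded_measurable_integrable/bounded_measurable_cst.
Qed.

End finite_integrals.

(** * Binary codes and quantiles *)

(** Latest bit first: refining a cylinder is then a cons, and masses and endpoints are defined by
    recursion on the list. *)
Fixpoint prefix (b : nat -> bool) n : seq bool :=
  if n is k.+1 then b k :: prefix b k else [::].

Lemma size_prefix b n : size (prefix b n) = n.
Proof. by elim: n => //= n ->. Qed.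

Lemma prefix_eq b b' n : prefix b n = prefix b' n <-> (forall k, (k < n)%N -> b k = b' k).
Proof.
elim: n => [|n IH] //=; split=> [[bn /IH bk] k|h].
  by rewrite ltnS leq_eqVlt => /orP[/eqP-> //|]; exact: bk.
by rewrite h// (IH.2 _)// => k kn; apply: h; exact: ltnW.
Qed.

Lemma prefix_le b b' n k : (k <= n)%N -> prefix b n = prefix b' n -> prefix b k = prefix b' k.
Proof. by move=> kn /prefix_eq h; apply/prefix_eq => i ik; apply: h; exact: leq_trans kn. Qed.

(** The default [false] pads [s] to a full sequence, a sample point of its cylinder. *)
Definition extend (s : seq bool) (k : nat) : bool := nth false (rev s) k.

Lemma prefix_extend s : prefix (extend s) (size s) = s.
Proof.
have H t s' : prefix (fun k => nth false (rev s' ++ t) k) (size s') = s'.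
  elim: s' t => //= b s' IH t; congr cons; last by rewrite rev_cons cat_rcons IH.
  by rewrite rev_cons cat_rcons nth_cat size_rev ltnn subnn.
by have := H [::] s; under eq_fun do rewrite cats0.
Qed.

Lemma prefix_extend_prefix b n : prefix (extend (prefix b n)) n = prefix b n.
Proof. by have := prefix_extend (prefix b n); rewrite size_prefix. Qed.

Definition cantor_uniform {R : realType} (f : (nat -> bool) -> R) :=
  forall e, 0 < e -> exists n, forall b b', prefix b n = prefix b' n -> `|f b - f b'| <= e.

(** Compactness in the manner of König's lemma: a prefix below which no modulus works for [e] has a
    one-bit extension with the same defect, and continuity at the limit of these extensions is
    contradicted. *)
Lemma cantor_heine {R : realType} (f : (nat -> bool) -> R) :
  (forall b e, 0 < e -> exists n, forall b', prefix b' n = prefix b n -> `|f b' - f b| <= e) ->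
  cantor_uniform f.
Proof.
move=> cf e e0; apply: contrapT => nuf.
(* Only [b] is required to start with [s]; [b'] agrees with it on as many bits as desired. *)
pose bad s := forall n, exists b b',
  [/\ prefix b (size s) = s, prefix b n = prefix b' n & e < `|f b - f b'|].
have bad0 : bad [::].
  move=> n; apply: contrapT => h; apply: nuf; exists n => b b' bb'.
  by rewrite leNgt; apply/negP => lt; apply: h; exists b, b'.
have step s : exists c, bad s -> bad (c :: s).
  apply: contrapT => h; have {}h c : bad s /\ ~ bad (c :: s).
    apply: contrapT => hc; apply: h; exists c => bs.
    by apply: contrapT => nb; apply: hc.
  have [bs] := h false; rewrite {1}/bad => /existsNP[n0 h0].
  have [_] := h true; rewrite {1}/bad => /existsNP[n1 h1].
  have [b [b' [bs1 bb' lt]]] := bs (maxn (size s).+1 (maxn n0 n1)).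
  have hb n : (n <= maxn (size s).+1 (maxn n0 n1))%N -> prefix b n = prefix b' n.
    by move=> nn; exact: prefix_le bb'.
  case bE : (b (size s)).
    apply: h1; exists b, b'; split => //; first by rewrite /= bE bs1.
    by apply: hb; rewrite !leq_max leqnn !orbT.
  apply: h0; exists b, b'; split => //; first by rewrite /= bE bs1.
  by apply: hb; rewrite !leq_max leqnn !orbT.
have [c cP] := choice step.
pose s := fix s n := if n is k.+1 then c (s k) :: s k else [::].
have bs n : bad (s n) by elim: n => [|n IH] //=; exact: cP.
pose b n := c (s n).
have sE n : prefix b n = s n by elim: n => //= n ->.
have [n nP] := cf b _ (divr_gt0 e0 (ltr0Sn R 1)).
have [b1 [b2 [h1 h2 lt]]] := bs n n.
move: h1; rewrite -sE size_prefix => h1.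
have h3 : prefix b2 n = prefix b n by rewrite -h2.
have := ler_normB (f b1 - f b) (f b2 - f b).
rewrite opprB addrA subrK => le; move: lt; rewrite ltNge => /negP; apply.
apply: le_trans le _; have := nP _ h1; have := nP _ h3; lra.
Qed.

Lemma cantor_uniform_bounded {R : realType} (f : (nat -> bool) -> R) :
  cantor_uniform f -> exists C, forall b, `|f b| <= C.
Proof.
move=> /(_ 1 ltr01)[n nP].
exists (1 + \sum_(s : n.-tuple bool) `|f (extend s)|) => b.
have sz : size (prefix b n) == n by rewrite size_prefix.
rewrite (bigD1 (Tuple sz))//= -[f b](subrK (f (extend (prefix b n)))).
apply: le_trans (ler_normD _ _) _; rewrite addrA; apply: ler_wpDr.
  by apply: sumr_ge0 => *; exact: normr_ge0.
by rewrite lerD2r; apply: nP; rewrite prefix_extend_prefix.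
Qed.

Section measurable_bits.
Context d0 {Y : measurableType d0} {R : realType}.
Variable b : Y -> nat -> bool.

(** Measurability is asked of the first [k] bits only, because each quantile bit depends on the
    earlier ones and is treated by induction. *)
Lemma measurable_prefix (g : seq bool -> R) k :
  (forall n, (n < k)%N -> measurable_fun setT (b^~ n)) ->
  measurable_fun setT (fun y => g (prefix (b y) k)).
Proof.
elim: k g => [|k IH] g mb /=; first exact: measurable_cst.
rewrite (_ : (fun y => _) = fun y => if b y k then g (true :: prefix (b y) k)
    else g (false :: prefix (b y) k)); last by apply/funext => y; case: (b y k).
have mb' n : (n < k)%N -> measurable_fun setT (b^~ n) by move=> nk; apply: mb; exact: ltnW.
by apply: measurable_fun_ifT; [exact: mb|exact: (IH (fun s => g (true :: s)))|
  exact: (IH (fun s => g (false :: s)))].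
Qed.

(** Uniform continuity makes [f] a limit of functions of finitely many bits. *)
Lemma bounded_measurable_bits (f : (nat -> bool) -> R) D :
  (forall n, measurable_fun setT (b^~ n)) -> measurable D -> cantor_uniform f ->
  bounded_measurable D (fun y => f (b y)).
Proof.
move=> mb mD uf; split; last first.
  by have [C fC] := cantor_uniform_bounded uf; exists C => y _; exact: fC.
apply: (@measurable_funS _ _ _ _ setT) => //.
apply: (@measurable_fun_cvg _ _ _ _ (fun n y => f (extend (prefix (b y) n)))).
  by move=> n; apply: (@measurable_prefix (fun s => f (extend s))).
move=> y _; apply/cvgrPdist_le => e e0; have [n ne] := uf _ e0.
exists n => // k /= nk; apply: ne; apply: (@prefix_le _ _ k) => //.
by rewrite prefix_extend_prefix.
Qed.

End measurable_bits.

(** * Quantile transform of a finitely additive set function *)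

Section quantile.
Context {R : realType} {X : Type}.
Variables (beta : nat -> X -> bool) (D : set X) (m : set X -> R).
Hypothesis m_ge0 : forall A, 0 <= m A.
Hypothesis m_add : forall A B, A `&` B = set0 -> m (A `|` B) = m A + m B.

Fixpoint cyl (s : seq bool) : set X :=
  if s is b :: s' then cyl s' `&` [set p | beta (size s') p = b] else D.

Lemma cylE s p : cyl s p <-> D p /\ prefix (beta^~ p) (size s) = s.
Proof.
elim: s => [|b s IH] /=; first by split=> [|[]].
split=> [[/IH[Dp ps] <-]|[Dp [bp ps]]]; first by rewrite ps.
by split => //; apply/IH.
Qed.

Lemma m_cyl s : m (cyl s) = m (cyl (false :: s)) + m (cyl (true :: s)).
Proof.
rewrite -m_add.
  congr m; apply/seteqP; split => p /=; last by case=> -[].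
  by move=> sp; case: (beta _ p); [right|left].
by apply/seteqP; split => p //= [[_ ->]] [].
Qed.

(** Left endpoint of the interval allotted to the cylinder of [s]: appending 0 keeps it, appending 1
    skips the mass of the 0-half. *)
Fixpoint lo (s : seq bool) : R :=
  if s is b :: s' then lo s' + (if b then m (cyl (false :: s')) else 0) else 0.

(* [pre n u] lists the first n bits, latest first, of the bit sequence of the
   m-quantile u: cylinders are laid out as consecutive intervals of length
   their m-mass, in lexicographic order. *)
Fixpoint pre n (u : R) : seq bool :=
  if n is k.+1 then
    (lo (pre k u) + m (cyl (false :: pre k u)) <= u) :: pre k u
  else [::].

Definition qbits u n := lo (pre n u) + m (cyl (false :: pre n u)) <= u.

Lemma prefix_qbits u n : prefix (qbits u) n = pre n u.
Proof. by elim: n => //= n ->. Qed.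

(** By [m_cyl] the interval of [s] splits at [lo s + m (cyl (false :: s))] into those of its two
    extensions. Half-open intervals also cover the case of a zero mass, where one of them is
    empty. *)
Lemma preP s u : (0 <= u < m D /\ pre (size s) u = s) <-> lo s <= u < lo s + m (cyl s).
Proof.
elim: s => [|b s IH]; first by rewrite /= add0r; split=> [[]|].
have mc := m_cyl s; have m0 := m_ge0 (cyl (false :: s)); have m1 := m_ge0 (cyl (true :: s)).
have -> : (0 <= u < m D /\ pre (size (b :: s)) u = b :: s) <->
  (lo s <= u < lo s + m (cyl s)) /\ (lo s + m (cyl (false :: s)) <= u) = b.
  split; first by move=> [uD /= [+ ps]]; rewrite ps => ->; split => //; apply/IH.
  by move=> [/IH[uD ps] bE]; split => //; rewrite /= ps bE.
rewrite [lo (b :: s)]/=; set c := m (cyl (false :: s)) in mc m0 *.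
case: b => /=; last first.
  rewrite -/(cyl (false :: s)) -/c addr0; split=> [[/andP[l1 l2] /negbT]|/andP[l1 l2]].
    by rewrite -ltNge l1.
  rewrite l1/=; split; first by rewrite mc; lra.
  by apply/negbTE; rewrite -ltNge.
rewrite -/(cyl (true :: s)) -/(cyl (false :: s)) -/c; set c' := m (cyl (true :: s)) in mc m1 *.
split=> [[/andP[l1 l2] ->]|/andP[l1 l2]] /=; first by move: l2; rewrite mc addrA.
by split => //; apply/andP; split; rewrite ?mc; lra.
Qed.

Let leb := @lebesgue_measure R.
Let D0 : set (measurableTypeR R) := `[0, m D[%classic.

Let mD0 : measurable D0.
Proof. exact: measurable_itv. Qed.

Let lebD0 : leb D0 = (m D)%:E.
Proof.
rewrite /leb /D0 lebesgue_measure_itv/=; case: ltP.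
  by rewrite -EFinD subr0.
by rewrite lee_fin => h; congr EFin; apply/eqP; rewrite eq_le h m_ge0.
Qed.

Let lebD0y : (leb D0 < +oo)%E. Proof. by rewrite lebD0 ltry. Qed.

Let qint s : set (measurableTypeR R) := `[lo s, lo s + m (cyl s)[%classic.

Let mqint s : measurable (qint s). Proof. exact: measurable_itv. Qed.

Let step n (f : (nat -> bool) -> R) (u : measurableTypeR R) : R :=
  \sum_(s <- enum {: n.-tuple bool}) f (extend s) * \1_(qint s) u.

Let bm_step n f : bounded_measurable D0 (step n f).
Proof.
apply: bounded_measurable_sum => s; apply: bounded_measurableZ.
exact: bounded_measurable_indic.
Qed.

Let stepE n f u : D0 u -> step n f u = f (extend (pre n u)).
Proof.
rewrite /D0/= in_itv/= => uD.
have sz : size (pre n u) == n by rewrite -prefix_qbits size_prefix.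
rewrite /step (bigD1_seq (Tuple sz)) ?enum_uniq ?mem_enum//= big1.
  rewrite addr0 indicE mem_set ?mulr1//= /qint/= in_itv/=; apply/preP; split => //.
  by rewrite (eqP sz).
move=> s /eqP ns; rewrite indicE memNset ?mulr0// /qint/= in_itv/= => /preP[_ us].
by apply: ns; apply: val_inj => /=; rewrite -us size_tuple.
Qed.

Lemma Rintegral_step n f : Rintegral leb D0 (step n f) =
  \sum_(s <- enum {: n.-tuple bool}) f (extend s) * m (cyl s).
Proof.
rewrite Rintegral_sum//; last first.
  by move=> s; apply: bounded_measurableZ; exact: bounded_measurable_indic.
apply: eq_bigr => s _; rewrite RintegralZl//; last first.
  by apply: bounded_measurable_integrable => //; exact: bounded_measurable_indic.
congr (_ * _).
have -> : Rintegral leb D0 \1_(qint s) = fine (leb (qint s)).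
  rewrite Rintegral_indic//; congr (fine (leb _)).
  by apply/setIidPl => u; rewrite /qint /D0/= !in_itv/= => /preP[].
rewrite /leb /qint lebesgue_measure_itv/=; case: ltP => [_|].
  by rewrite -EFinD/=; ring.
by rewrite lee_fin => h; apply/eqP; rewrite eq_le m_ge0/=; lra.
Qed.

Lemma measurable_qbits n : measurable_fun setT (qbits^~ n : measurableTypeR R -> bool).
Proof.
elim/ltn_ind: n => n IH; apply: measurable_fun_ler; last exact: measurable_id.
under eq_fun do rewrite -prefix_qbits.
exact: (@measurable_prefix _ (measurableTypeR R) _ qbits
  (fun s => lo s + m (cyl (false :: s)))).
Qed.

(** Up to [e * m D] the integral is a Riemann sum, which sees only the masses of the cylinders of
    length [n]. *)
Lemma Rintegral_qbits f n e : cantor_uniform f ->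
  (forall b b', prefix b n = prefix b' n -> `|f b - f b'| <= e) ->
  `|Rintegral leb D0 (f \o qbits) -
     \sum_(s <- enum {: n.-tuple bool}) f (extend s) * m (cyl s)| <= e * m D.
Proof.
move=> uf ne; rewrite -Rintegral_step.
apply: le_trans (_ : e * fine (leb D0) <= _); last by rewrite lebD0.
apply: Rintegral_dist => //.
  exact: (@bounded_measurable_bits _ (measurableTypeR R) _ _ _ _ measurable_qbits).
move=> u Du; rewrite stepE//; apply: ne.
by rewrite -prefix_qbits prefix_extend_prefix.
Qed.

End quantile.

(** * Binary digits on the torus *)

Section greedy_digits.
Context {R : realType}.
Variable L : R.
Hypothesis L0 : 0 <= L.

(** Greedy binary expansion on the closed interval [[0, L]]. Ties take the digit 1, so that [L]
    itself, which occurs as the final time, is coded by 111... *)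
Fixpoint remainder (x : R) n : R :=
  if n is k.+1 then
    let r := remainder x k in if L / 2 ^+ n <= r then r - L / 2 ^+ n else r
  else x.

Definition digit x n := L / 2 ^+ n.+1 <= remainder x n.

Definition partial_value (b : nat -> bool) n : R :=
  \sum_(i < n) (if b i then L / 2 ^+ i.+1 else 0).

Let half n : L / 2 ^+ n = L / 2 ^+ n.+1 + L / 2 ^+ n.+1.
Proof.
rewrite exprS; field; rewrite ?expf_neq0//.
Qed.

Let half_ge0 n : 0 <= L / 2 ^+ n.
Proof. by rewrite divr_ge0// exprn_ge0. Qed.

Lemma remainder_bound x n : 0 <= x <= L -> 0 <= remainder x n <= L / 2 ^+ n.
Proof.
move=> xL; elim: n => [|n /andP[IH1 IH2]]; first by rewrite /= expr0 divr1.
rewrite [remainder _ _]/=; have := half n; case: ifPn => [h1|]; first by lra.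
by rewrite -ltNge => h1 h2; lra.
Qed.

Lemma partial_value_digit x n : partial_value (digit x) n + remainder x n = x.
Proof.
rewrite /partial_value; elim: n => [|n IH]; first by rewrite big_ord0 add0r.
rewrite big_ord_recr -[RHS]IH [remainder _ n.+1]/= [digit x (Ordinal _)]/digit/=.
by case: ifP => h; ring.
Qed.

(** The term [- L / 2 ^+ k] carries the induction: the digits from [n] to [k] add at most the
    geometric sum [L / 2 ^+ n - L / 2 ^+ k]. *)
Lemma partial_value_nd b n k : (n <= k)%N ->
  partial_value b n <= partial_value b k <= partial_value b n + L / 2 ^+ n - L / 2 ^+ k.
Proof.
move=> /subnK <-; elim: (k - n)%N => [|j IH]; first by rewrite add0n; lra.
rewrite addSn /partial_value big_ord_recr/= -!/(partial_value _ _).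
have := half_ge0 (j + n).+1; have := half (j + n); case: ifP => _; lra.
Qed.

Definition digit_value (b : nat -> bool) : R := sup (range (partial_value b)).

Lemma digit_value_bound b n :
  partial_value b n <= digit_value b <= partial_value b n + L / 2 ^+ n.
Proof.
have ub : ubound (range (partial_value b)) (partial_value b n + L / 2 ^+ n).
  move=> _ [k _ <-]; have [nk|/ltnW kn] := leqP n k.
    by have := partial_value_nd b nk; have := half_ge0 k; lra.
  by have := partial_value_nd b kn; have := half_ge0 n; lra.
apply/andP; split; last by apply: ge_sup => //; exists (partial_value b n), n.
apply: ub_le_sup; last by exists n.
by exists (partial_value b n + L / 2 ^+ n).
Qed.

Lemma digit_value_itv b : 0 <= digit_value b <= L.
Proof.
by have := digit_value_bound b 0; rewrite /partial_value big_ord0 expr0 divr1 add0r.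
Qed.

Lemma partial_value_eq b b' n : (forall k, (k < n)%N -> b k = b' k) ->
  partial_value b n = partial_value b' n.
Proof. by move=> bb'; apply: eq_bigr => i _; rewrite bb'. Qed.

Lemma digit_value_close b b' n : (forall k, (k < n)%N -> b k = b' k) ->
  `|digit_value b - digit_value b'| <= L / 2 ^+ n.
Proof.
move=> /partial_value_eq pE.
have := digit_value_bound b n; have := digit_value_bound b' n; rewrite pE ler_norml.
lra.
Qed.

Lemma cvg_half : L / 2 ^+ n @[n --> \oo] --> 0.
Proof.
rewrite (_ : (fun n => _) = geometric L (2^-1)); last first.
  by apply/funext => n; rewrite /geometric/= exprVn.
by apply: cvg_geometric; rewrite ger0_norm ?invr_ge0// invf_lt1// ltr1n.
Qed.

Lemma cvg_partial_value b : partial_value b n @[n --> \oo] --> digit_value b.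
Proof.
apply/cvgrPdist_le => e e0; have /cvgrPdist_le/(_ _ e0)[N _ hN] := cvg_half.
exists N => // n /= /hN; rewrite sub0r normrN ger0_norm// => he.
by have := digit_value_bound b n; rewrite ler_norml; lra.
Qed.

Lemma digit_valueK x : 0 <= x <= L -> digit_value (digit x) = x.
Proof.
move=> xL; apply/eqP; rewrite -subr_eq0 -normr_le0; apply/ler_addgt0Pr => e e0.
have /cvgrPdist_le/(_ _ e0)[N _ hN] := cvg_half.
have := hN N (leqnn N); rewrite sub0r normrN ger0_norm// add0r => he.
have := digit_value_bound (digit x) N; have := remainder_bound N xL.
by have := partial_value_digit x N; rewrite ler_norml; lra.
Qed.

End greedy_digits.

Section measurable_digits.
Context d0 {X : measurableType d0} {R : realType}.
Variable L : R.

Lemma measurable_digit_value (b : X -> nat -> bool) : 0 <= L ->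
  (forall n, measurable_fun setT (b^~ n)) ->
  measurable_fun setT (fun x => digit_value L (b x)).
Proof.
move=> L0 mb; apply: (@measurable_fun_cvg _ _ _ _ (fun n x => partial_value L (b x) n)).
  move=> n; apply: measurable_sum => i; apply: measurable_fun_ifT => //=.
by move=> x _; exact: cvg_partial_value.
Qed.

Lemma measurable_digit (g : X -> R) n : measurable_fun setT g ->
  measurable_fun setT (fun x => digit L (g x) n).
Proof.
move=> mg; suff mr : measurable_fun setT (fun x => remainder L (g x) n).
  by apply: measurable_fun_ler => //; exact: measurable_cst.
elim: n => //= n IH; apply: measurable_fun_ifT => //.
- by apply: measurable_fun_ler => //; exact: measurable_cst.
- by apply: measurable_funB => //; exact: measurable_cst.
Qed.

End measurable_digits.

(** * Coding of space-time points by interleaved digits *)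

Section torus_coding.
Context {R : realType} {d : nat}.
Local Notation spacetime := (R * 'rV[R]_d)%type.
Variable T : R.
Hypothesis T0 : 0 < T.

Definition Xlen (c : nat) : R := if c is 0%N then T else 1.

Definition Xcoord (p : Xd (R := R) (d := d)) (c : nat) : R :=
  if c is j.+1 then nth 0 (p.2 : seq R) j else p.1.

(* Coordinates (time first) are coded by their binary digits, the digits of
   coordinate c occupying the places congruent to c modulo d + 1. *)
Definition subbits (b : nat -> bool) c k := b (k * d.+1 + c)%N.

Definition bit n (p : Xd (R := R) (d := d)) : bool :=
  digit (Xlen (n %% d.+1)%N) (Xcoord p (n %% d.+1)%N) (n %/ d.+1)%N.

(** A sequence may code the value 1 of a space coordinate. [decode] keeps it and depends
    continuously on the bits; [decodeX] moves it to 0, hence stays in the fundamental domain at the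
    price of a jump. Periodic functions do not see the difference. *)
Definition decode (b : nat -> bool) : spacetime :=
  (digit_value T (subbits b 0), \row_j digit_value 1 (subbits b j.+1)).

(* The digits 111... code 1, which is 0 on the circle. *)
Definition wrap (x : R) : R := if x == 1 then 0 else x.

Definition decodeX (b : nat -> bool) : Xd (R := R) (d := d) :=
  (digit_value T (subbits b 0), [tuple wrap (digit_value 1 (subbits b j.+1)) | j < d]).

Lemma decodeX_domain b : domain T (decodeX b).
Proof.
split; first exact: digit_value_itv (ltW T0) _.
move=> j; rewrite /= tnth_mktuple /wrap.
have /andP[h0 h1] := digit_value_itv (@ler01 R) (subbits b j.+1).
by case: eqP => [_|/eqP ne]; rewrite ?lexx ?ltr01// h0 lt_neqAle ne.
Qed.

Lemma subbits_bit p c : (c < d.+1)%N ->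
  subbits (bit^~ p) c = digit (Xlen c) (Xcoord p c).
Proof.
move=> cd; apply/funext => k; rewrite /subbits /bit.
by rewrite modnMDl modn_small// divnMDl// divn_small// addn0.
Qed.

Lemma decode_bit p : domain T p -> decode (bit^~ p) = point p.
Proof.
move=> [pT px]; rewrite /decode /point; congr pair.
  by rewrite subbits_bit//= (digit_valueK (ltW T0) pT).
apply/rowP => j; rewrite !mxE subbits_bit ?ltnS//=.
have /andP[h0 /ltW h1] := px j.
by rewrite -tnth_nth digit_valueK ?h0 ?h1.
Qed.

Lemma decode_slab b : slab T (decode b).
Proof. exact: digit_value_itv (ltW T0) _. Qed.

Lemma decode_close e : 0 < e -> exists n, forall b b', prefix b n = prefix b' n ->
  `|(decode b).1 - (decode b').1| <= e /\
  forall j, `|(decode b).2 0 j - (decode b').2 0 j| <= e.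
Proof.
move=> e0; have /cvgrPdist_le/(_ _ e0)[N1 _ h1] := cvg_half T.
have /cvgrPdist_le/(_ _ e0)[N2 _ h2] := cvg_half (1 : R).
have {}h1 := h1 _ (leq_maxl N1 N2); have {}h2 := h2 _ (leq_maxr N1 N2).
(* The first [N * d.+1] places contain [N] digits of each of the [d.+1] coordinates. *)
set N := maxn N1 N2 in h1 h2; exists (N * d.+1)%N => b b' /prefix_eq bb'.
have sub c : (c < d.+1)%N -> forall k, (k < N)%N -> subbits b c k = subbits b' c k.
  move=> cd k kN; apply: bb'; apply: (@leq_trans (k.+1 * d.+1)).
    by rewrite mulSn addnC ltn_add2r.
  by rewrite leq_mul2r kN orbT.
move: h1 h2; rewrite !sub0r !normrN => h1 h2; split=> [|j] /=; rewrite ?mxE.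
  by apply: le_trans (digit_value_close (ltW T0) (sub 0%N _)) _ => //; apply: le_trans h1; exact: ler_norm.
apply: le_trans (digit_value_close ler01 (sub j.+1 _)) _; first by rewrite ltnS.
by apply: le_trans h2; exact: ler_norm.
Qed.

Lemma measurable_Xcoord c : measurable_fun setT (Xcoord^~ c).
Proof.
case: c => [|j] /=; first exact: measurable_fst.
have [jd|jd] := ltnP j d; last first.
  rewrite (_ : (fun p => _) = cst 0); first exact: measurable_cst.
  by apply/funext => p; rewrite nth_default// size_tuple.
rewrite (_ : (fun p => _) = (fun t => tnth t (Ordinal jd)) \o snd); last first.
  by apply/funext => p /=; rewrite (tnth_nth 0).
by apply: measurableT_comp; [exact: measurable_tnth|exact: measurable_snd].
Qed.

Lemma measurable_bit n : measurable_fun setT (bit n).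
Proof. by apply: measurable_digit; exact: measurable_Xcoord. Qed.

Lemma measurable_wrap : measurable_fun setT wrap.
Proof.
apply: measurable_fun_ifT; [|exact: measurable_cst|exact: measurable_id].
apply: (measurable_fun_bool true); rewrite setTI.
rewrite (_ : _ @^-1` _ = [set 1]); first exact: measurable_set1.
by apply/seteqP; split => x /=; [move=> /eqP|move=> ->; rewrite eqxx].
Qed.

Lemma measurable_decodeX d0 (Y : measurableType d0) (b : Y -> nat -> bool) :
  (forall n, measurable_fun setT (b^~ n)) ->
  measurable_fun setT (decodeX \o b).
Proof.
move=> mb; apply/measurable_fun_pairP; split.
  exact: (measurable_digit_value (ltW T0) (fun k => mb (k * d.+1 + 0)%N)).
apply/measurable_fun_tnthP => j.
rewrite (_ : _ \o _ = wrap \o (fun y => digit_value 1 (subbits (b y) j.+1))).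
  apply: measurableT_comp; first exact: measurable_wrap.
  exact: (measurable_digit_value ler01 (fun k => mb (k * d.+1 + j.+1)%N)).
by apply/funext => y /=; rewrite tnth_mktuple.
Qed.

End torus_coding.

(** * Riesz representation by charges on the torus *)

Lemma caddNE d0 (X : measurableType d0) (R : realType)
    (n1 n2 : {charge set X -> \bar R}) A : cadd n1 (cscale (-1) n2) A = (n1 A - n2 A)%E.
Proof.
change (n1 A + (-1)%:E * n2 A = n1 A - n2 A)%E.
by rewrite mulN1e.
Qed.

Section jordan_integrals.
Context d0 {X : measurableType d0} {R : realType}.

(** Sums on both sides avoid differences of measures, which need not be measures; this is how two
    decompositions of one charge are compared. *)
Lemma Rintegral_measure_add (a b c e : {finite_measure set X -> \bar R}) D f :
  measurable D -> bounded_measurable D f ->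
  (forall A, measurable A -> (a A + b A = c A + e A)%E) ->
  Rintegral a D f + Rintegral b D f = Rintegral c D f + Rintegral e D f.
Proof.
move=> mD bf abce.
have fin (m : {finite_measure set X -> \bar R}) : (m D < +oo)%E.
  by rewrite ltey_eq fin_num_measure.
have itg (m : {finite_measure set X -> \bar R}) := bounded_measurable_integrable mD (fin m) bf.
have fn (m : {finite_measure set X -> \bar R}) := integrable_fin_num mD (itg m).
rewrite /Rintegral -!fineD ?fn//; congr fine.
rewrite -!integral_measure_add//; [|exact: itg..].
apply: eq_measure_integral => A mA _; rewrite /measure_add/= /msum !big_ord_recl !big_ord0/=.
by rewrite !adde0; exact: abce.
Qed.

End jordan_integrals.

Section charges_on_the_torus.
Context {R : realType} {d : nat}.
Local Notation X := (Xd (R := R) (d := d)).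
Local Notation spacetime := (R * 'rV[R]_d)%type.

(** [charge_integral] goes through a Hahn decomposition obtained by choice. This frees it from that
    choice: every representation of the charge as a difference of finite measures computes the
    integral. *)
Lemma jordan_integralE (nu : {charge set X -> \bar R}) P N (PN : hahn_decomposition nu P N)
    (m1 m2 : {finite_measure set X -> \bar R}) D f :
  measurable D -> bounded_measurable D f ->
  (forall A, measurable A -> nu A = m1 A - m2 A)%E ->
  Rintegral (jordan_pos PN) D f - Rintegral (jordan_neg PN) D f =
  Rintegral m1 D f - Rintegral m2 D f.
Proof.
move=> mD bf nuE.
apply/eqP; rewrite subr_eq addrAC eq_sym subr_eq; apply/eqP.
apply: Rintegral_measure_add => // A mA.
have h : (nu A = jordan_pos PN A - jordan_neg PN A)%E.
  by rewrite (jordan_decomp PN mA) caddNE.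
rewrite nuE// in h.
change (m1 A + jordan_neg PN A = jordan_pos PN A + m2 A)%E.
have fin (m : {finite_measure set X -> \bar R}) : exists r, m A = r%:E.
  by exists (fine (m A)); rewrite fineK// fin_num_measure.
move: h; have [r1 ->] := fin m1; have [r2 ->] := fin m2.
have [r3 ->] := fin (jordan_pos PN); have [r4 ->] := fin (jordan_neg PN).
rewrite -!EFinN -!EFinD => hr; by apply: (congr1 EFin); have := EFin_inj hr; lra.
Qed.

Lemma charge_integralE (nu : {charge set X -> \bar R})
    (m1 m2 : {finite_measure set X -> \bar R}) D f :
  measurable D -> bounded_measurable D f ->
  (forall A, measurable A -> nu A = m1 A - m2 A)%E ->
  charge_integral nu D f = Rintegral m1 D f - Rintegral m2 D f.
Proof. by move=> mD bf nuE; rewrite /charge_integral; exact: jordan_integralE. Qed.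

Lemma measurable_domain (T : R) : measurable (domain T : set X).
Proof.
have -> : domain T = (fst @^-1` `[0, T]%classic) `&`
    \bigcap_(j in [set: 'I_d]) ((fun p : X => tnth p.2 j) @^-1` `[0, 1[%classic).
  apply/seteqP; split => p /=.
    by move=> [h1 h2]; split; [rewrite in_itv|move=> j _ /=; rewrite in_itv/=; exact: h2].
  by move=> [h1 h2]; split; [move: h1; rewrite in_itv|move=> j; have := h2 j I; rewrite /= in_itv].
apply: measurableI.
  rewrite -[X in measurable X]setTI; apply: measurable_fst => //; exact: measurable_itv.
apply: fin_bigcap_measurable => // j _; rewrite -[X in measurable X]setTI.
have : measurable_fun setT ((fun t => tnth t j) \o (snd : X -> _)).
  by apply: measurableT_comp; [exact: measurable_tnth|exact: measurable_snd].
by apply => //; exact: measurable_itv.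
Qed.

Lemma periodic_int (V : Type) (f : spacetime -> V) (t : R) (x : 'rV[R]_d) (k : 'I_d -> int) :
  periodic f -> f (t, x + \row_j (k j)%:~R) = f (t, x).
Proof.
move=> pf.
have onen (n : nat) y j : f (t, y + n%:R *: unit_vec j) = f (t, y).
  elim: n y => [|n IH] y; first by rewrite scale0r addr0.
  by rewrite -natr1 scalerDl scale1r addrA pf IH.
have onez (z : int) y j : f (t, y + z%:~R *: unit_vec j) = f (t, y).
  case: z => n; first exact: onen.
  by rewrite NegzE mulrNz scaleNr -(onen n.+1 _ j) subrK.
have -> : \row_j (k j)%:~R = \sum_j (k j)%:~R *: unit_vec j :> 'rV[R]_d.
  apply/rowP => j; rewrite mxE summxE (bigD1 j)//= big1 => [|i ij].
    by rewrite !mxE !eqxx mulr1 addr0.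
  by rewrite !mxE eqxx/= eq_sym (negbTE ij) mulr0.
elim/big_rec: _ x => [|i y _ IH] x; first by rewrite addr0.
by rewrite addrCA addrC onez IH.
Qed.

Definition fundamental (p : spacetime) : X :=
  (p.1, [tuple p.2 0 j - (Num.floor (p.2 0 j))%:~R | j < d]).

Lemma fundamental_domain (T : R) p : slab T p -> domain T (fundamental p).
Proof.
move=> pT; split=> // j; rewrite /= tnth_mktuple.
by have := floor_itv (p.2 0 j); rewrite intrD; lra.
Qed.

Lemma periodic_fundamental (V : Type) (f : spacetime -> V) p : periodic f ->
  f (point (fundamental p)) = f p.
Proof.
move=> pf; rewrite /point /fundamental/=.
rewrite -(periodic_int _ _ (fun j => Num.floor (p.2 0 j)) pf); case: p => t x /=.
by congr (f (_, _)); apply/rowP => j; rewrite !mxE tnth_mktuple subrK.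
Qed.

Lemma periodic_decodeX (V : Type) (f : spacetime -> V) (T : R) b : periodic f ->
  f (point (decodeX T b)) = f (decode T b).
Proof.
move=> pf; rewrite /point /decodeX /decode/=.
pose k (j : 'I_d) : int := if digit_value (1 : R) (@subbits d b j.+1) == 1 then 1 else 0.
rewrite -(periodic_int _ _ k pf).
congr (f (_, _)); apply/rowP => j; rewrite !mxE tnth_mktuple /wrap /k.
by case: eqP => [->|_]; rewrite ?add0r// addr0.
Qed.

Definition continuous_periodic (T : R) (V : topologicalType) (f : spacetime -> V) :=
  {within slab T, continuous f} /\ periodic f.

Lemma within_slab_dist (T : R) (f : spacetime -> R) : {within slab T, continuous f} ->
  forall x e, slab T x -> 0 < e -> exists2 r, 0 < r & forall y, slab T y ->
    `|y.1 - x.1| < r -> (forall j, `|y.2 0 j - x.2 0 j| < r) -> `|f y - f x| <= e.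
Proof.
move=> /subspace_continuousP cf x e xT e0.
have /cvgrPdist_le/(_ _ e0) := cf x xT.
move=> /nbhs_ballP[r /= r0 hr]; exists r => // y yT y1 y2.
rewrite distrC; apply: hr => //; split => /=; first by rewrite /ball/= distrC.
by split => // i j; rewrite ord1 /ball/= distrC; exact: y2.
Qed.

(** [decode] is continuous with values in the slab, so the composite is continuous on a compact
    space. *)
Lemma cantor_uniform_decode (T : R) (f : spacetime -> R) : 0 < T ->
  continuous_periodic T f -> cantor_uniform (f \o decode T).
Proof.
move=> T0 [cf pf]; apply: cantor_heine => b e e0 /=.
have [r r0 hr] := within_slab_dist cf (decode_slab T0 b) e0.
have r20 : 0 < r / 2 by rewrite divr_gt0.
have rr : r / 2 < r by rewrite ltr_pdivrMr// ltr_pMr// ltr1n.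
have [n hn] := @decode_close _ d _ T0 _ r20; exists n => b' /hn[h1 h2].
apply: hr; first exact: decode_slab.
  exact: le_lt_trans h1 rr.
by move=> j; apply: le_lt_trans (h2 j) rr.
Qed.

Lemma continuous_periodic_bounded (T : R) (f : spacetime -> R) : 0 < T ->
  continuous_periodic T f -> exists C, forall p, slab T p -> `|f p| <= C.
Proof.
move=> T0 cf; have [C hC] := cantor_uniform_bounded (cantor_uniform_decode T0 cf).
exists C => p pT; rewrite -(periodic_fundamental p cf.2).
by rewrite -(decode_bit T0 (fundamental_domain pT)); exact: hC.
Qed.

(** Borel measurability is read off from the digits: on the fundamental domain [f] is a uniformly
    continuous function of measurable bits. *)
Lemma bounded_measurable_point (T : R) (f : spacetime -> R) : 0 < T ->
  continuous_periodic T f -> bounded_measurable (domain T) (fun p : X => f (point p)).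
Proof.
move=> T0 cf.
have [mf [C hC]] := bounded_measurable_bits (@measurable_bit R d T) (measurable_domain T)
  (cantor_uniform_decode T0 cf).
have E p : domain T p -> f (point p) = (f \o decode T) (bit T ^~ p).
  by move=> pT /=; rewrite decode_bit.
split; last by exists C => p pT; rewrite E//; exact: hC.
by apply: eq_measurable_fun mf => p; rewrite inE => pT; rewrite E.
Qed.

End charges_on_the_torus.

(** * The countably additive measure carried by the quantile code *)

Section quantile_measure.
Context {R : realType} {d : nat}.
Local Notation X := (Xd (R := R) (d := d)).
Variables (T : R) (T0 : 0 < T) (m : set X -> R).

Definition quantile_code : measurableTypeR R -> X :=
  decodeX T \o qbits (bit T) (domain T) m.

Lemma measurable_quantile_code : measurable_fun setT quantile_code.
Proof.
apply: (measurable_decodeX T0) => n.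
exact: (measurable_qbits (bit T) (domain T) m n).
Qed.

Definition quantile_itv : set (measurableTypeR R) := `[0, m (domain T)[%classic.

Lemma measurable_quantile_itv : measurable quantile_itv.
Proof. exact: measurable_itv. Qed.

(* The unused argument makes the measure structure, whose construction needs
   [0 < T], inferable from the term. *)
Definition quantile_measure of 0 < T :=
  pushforward (mrestr (@lebesgue_measure R) measurable_quantile_itv) quantile_code.

Let mpre A : measurable A -> measurable (quantile_code @^-1` A).
Proof. by move=> mA; rewrite -[X in measurable X]setTI; exact: measurable_quantile_code. Qed.

Let qm0 : quantile_measure T0 set0 = 0%E.
Proof. by rewrite /quantile_measure /pushforward preimage_set0 measure0. Qed.

Let qm_ge0 A : (0 <= quantile_measure T0 A)%E.
Proof. by rewrite /quantile_measure /pushforward; exact: measure_ge0. Qed.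

Let qm_sigma : semi_sigma_additive (quantile_measure T0).
Proof.
move=> F mF tF mUF; rewrite /quantile_measure /pushforward preimage_bigcup.
apply: measure_semi_sigma_additive.
- by move=> k; exact: mpre.
- apply/trivIsetP => /= i j _ _ ij; rewrite -preimage_setI.
  by move/trivIsetP : tF => /(_ _ _ _ _ ij) ->//; rewrite preimage_set0.
- by rewrite -preimage_bigcup; exact: mpre.
Qed.

HB.instance Definition _ := isMeasure.Build _ _ _ (quantile_measure T0) qm0 qm_ge0 qm_sigma.

Let qm_fin : fin_num_fun (quantile_measure T0).
Proof.
move=> A mA; rewrite ge0_fin_numE ?measure_ge0//.
apply: (@le_lt_trans _ _ (lebesgue_measure quantile_itv)).
  rewrite /quantile_measure /pushforward /mrestr; apply: le_measure; rewrite ?inE.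
  - by apply: measurableI; [exact: mpre|exact: measurable_quantile_itv].
  - exact: measurable_quantile_itv.
  - by move=> x [].
by rewrite lebesgue_measure_itv/=; case: ifP => //; rewrite -EFinD ltry.
Qed.

HB.instance Definition _ := @Measure_isFinite.Build _ _ _ (quantile_measure T0) qm_fin.

Lemma quantile_code_domain u : domain T (quantile_code u).
Proof. exact: decodeX_domain. Qed.

Lemma quantile_measure_carried A : A `&` domain T = set0 -> quantile_measure T0 A = 0%E.
Proof.
move=> A0; rewrite /quantile_measure /pushforward (_ : _ @^-1` A = set0) ?measure0//.
apply/seteqP; split => // u Au.
have : (A `&` domain T) (quantile_code u) by split => //; exact: quantile_code_domain.
by rewrite A0.
Qed.

Lemma Rintegral_quantile_measure (f : R * 'rV[R]_d -> R) : continuous_periodic T f ->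
  Rintegral (quantile_measure T0) (domain T) (fun p => f (point p)) =
  Rintegral (@lebesgue_measure R) quantile_itv
    ((f \o decode T) \o qbits (bit T) (domain T) m).
Proof.
move=> cf; have uf := cantor_uniform_decode T0 cf.
have mD := measurable_domain (R := R) (d := d) T.
have [_ [C hC]] := bounded_measurable_point T0 cf.
(* Cut off outside the domain, [f] becomes bounded and measurable on the whole space, ready for the
   change of variables. *)
pose g := (fun p : X => f (point p)) \_ (domain T).
have bg : bounded_measurable setT g.
  split; last first.
    exists `|C| => p _; rewrite /g patchE; case: ifPn => [|_]; last by rewrite normr0.
    by rewrite inE => /hC; move/le_trans; apply; exact: ler_norm.
  apply/(measurable_restrictT _ mD); exact: (bounded_measurable_point T0 cf).1.
rewrite /Rintegral; congr fine.
transitivity (\int[quantile_measure T0]_(p in domain T) (g p)%:E)%E.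
  by apply: eq_integral => p pT; rewrite /g patchE pT.
have muy : (quantile_measure T0 (domain T) < +oo)%E by rewrite ltey_eq fin_num_measure.
have msetT : measurable (@setT (measurableTypeR R)) by exact: measurableT.
pose nu := mrestr (@lebesgue_measure R) measurable_quantile_itv.
have nuT : (nu setT < +oo)%E.
  have : (quantile_measure T0 setT < +oo)%E by rewrite ltey_eq fin_num_measure.
  by rewrite /quantile_measure /pushforward preimage_setT.
have bgq : bounded_measurable setT (g \o quantile_code).
  split; first by apply: measurableT_comp; [exact: bg.1|exact: measurable_quantile_code].
  by have [_ [M hM]] := bg; exists M => u _; exact: hM.
have preD : quantile_code @^-1` domain T = setT.
  by apply/seteqP; split => // u _; exact: quantile_code_domain.
rewrite integral_pushforward//; last 3 first.
- exact: measurable_quantile_code.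
- by apply/measurable_EFinP; exact: bg.1.
- by rewrite preD; exact: (bounded_measurable_integrable (mu := nu) msetT nuT bgq).
rewrite preD (negligible_integral (N := ~` quantile_itv))//; last 3 first.
- by apply: measurableC; exact: measurable_quantile_itv.
- exact: (bounded_measurable_integrable (mu := nu) msetT nuT bgq).
- change (lebesgue_measure (~` quantile_itv `&` quantile_itv) = 0%E).
  by rewrite setICl measure0.
rewrite setTD setCK; transitivity (\int[@lebesgue_measure R]_(u in quantile_itv) (g (quantile_code u))%:E)%E.
  apply: eq_measure_integral => A mA sA; rewrite /mrestr.
  by congr (lebesgue_measure _); apply/setIidPl.
apply: eq_integral => u uD; rewrite /g patchE mem_set/=; last exact: quantile_code_domain.
by rewrite /quantile_code/= periodic_decodeX//; exact: cf.2.
Qed.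

End quantile_measure.

Section riesz_representation.
Context {R : realType} {d : nat}.
Local Notation X := (Xd (R := R) (d := d)).
Variables (T : R) (T0 : 0 < T) (l : (X -> R) -> R) (C : R).

Definition bounded_on_domain (g : X -> R) := exists M, forall p, domain T p -> `|g p| <= M.

Hypothesis lD : forall f g, bounded_on_domain f -> bounded_on_domain g ->
  l (fun p => f p + g p) = l f + l g.
Hypothesis lZ : forall c f, bounded_on_domain f -> l (fun p => c * f p) = c * l f.
Hypothesis lC : forall f M, (forall p, domain T p -> `|f p| <= M) -> `|l f| <= C * M.

Let indic01 (A : set X) p : 0 <= (\1_A p : R) <= 1.
Proof. by rewrite indicE; case: (_ \in _); rewrite lexx ler01. Qed.

Let bdd_indic A : bounded_on_domain (\1_A).
Proof. by exists 1 => p _; have := indic01 A p; rewrite ler_norml; lra. Qed.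

Let bdd01 (f : X -> R) A : (forall p, domain T p -> 0 <= f p <= \1_A p) -> forall p, domain T p -> `|f p| <= 1.
Proof. by move=> fA p /fA; have := indic01 A p; rewrite ler_norml; lra. Qed.

(* The set functions below are only finitely additive. Pushing a Lebesgue measure
   through the quantile code yields measures with the same masses on cylinders in
   the limit, hence the same integrals of continuous functions. *)
Definition below (A : set X) : set R :=
  [set l f | f in [set f | forall p, domain T p -> 0 <= f p <= \1_A p]].

Definition positive_part A := sup (below A).

(** Defined as a difference, so that the two parts differ by [l (\1_A)] at once; nonnegativity is
    then the competitor [\1_A] in the supremum. *)
Definition negative_part A := positive_part A - l (\1_A).

Let below_ub A : has_ubound (below A).
Proof.
exists C => _ [f /bdd01 f1 <-]; rewrite -[C]mulr1; apply: le_trans (lC f1).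
exact: ler_norm.
Qed.

Let l0 : l (fun=> 0) = 0.
Proof.
have : `|l (fun=> 0)| <= C * 0 by apply: lC => p _; rewrite normr0.
by rewrite mulr0 normr_le0 => /eqP.
Qed.

Let below0 A : below A 0.
Proof.
exists (fun=> 0); first by move=> p _; have /andP[] := indic01 A p; rewrite lexx.
exact: l0.
Qed.

Let le_positive_part A f : (forall p, domain T p -> 0 <= f p <= \1_A p) ->
  l f <= positive_part A.
Proof. by move=> fA; apply: ub_le_sup => //; exists f. Qed.

Lemma positive_part_ge0 A : 0 <= positive_part A.
Proof. exact: (ub_le_sup (below_ub A) (below0 A)). Qed.

Lemma negative_part_ge0 A : 0 <= negative_part A.
Proof.
rewrite subr_ge0; apply: le_positive_part => p _.
by have /andP[-> _] := indic01 A p; rewrite lexx.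
Qed.

Let indicU (A B : set X) : A `&` B = set0 -> \1_(A `|` B) = (fun p => \1_A p + \1_B p : R).
Proof.
move=> AB; apply/funext => p; rewrite !indicE in_setU.
have [pA|] := boolP (p \in A); have [pB|] := boolP (p \in B); rewrite ?addr0 ?add0r//.
by move: pA pB; rewrite !inE => pA pB; have : (A `&` B) p by []; rewrite AB.
Qed.

(** A competitor for the union splits into its restrictions to [A] and to the complement of [A];
    conversely, competitors for disjoint sets add up to one for the union. *)
Lemma positive_partU A B : A `&` B = set0 ->
  positive_part (A `|` B) = positive_part A + positive_part B.
Proof.
move=> AB; apply/eqP; rewrite eq_le; apply/andP; split.
  apply: ge_sup; first by exists 0.
  move=> _ [f fAB <-].
  pose f1 (p : X) := \1_A p * f p; pose f2 (p : X) := \1_(~` A) p * f p.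
  have h1 p : domain T p -> 0 <= f1 p <= \1_A p.
    move=> /fAB; rewrite /f1 !indicE in_setU.
    by case: (p \in A); case: (p \in B); rewrite /= ?mul0r ?mul1r; lra.
  have h2 p : domain T p -> 0 <= f2 p <= \1_B p.
    move=> /fAB; rewrite indicU// /f2 !indicE in_setC.
    by case: (p \in A); case: (p \in B); rewrite /= ?mul0r ?mul1r; lra.
  have -> : l f = l f1 + l f2.
    rewrite -lD; [|by exists 1; exact: bdd01 h1|by exists 1; exact: bdd01 h2].
    congr l; apply/funext => p; rewrite /f1 /f2 !indicE in_setC.
    by case: (p \in A); rewrite /= ?mul0r ?mul1r ?addr0 ?add0r.
  by apply: lerD; exact: le_positive_part.
rewrite -lerBrDr; apply: ge_sup; first by exists 0.
move=> _ [f fA <-]; rewrite lerBrDr addrC -lerBrDr; apply: ge_sup; first by exists 0.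
move=> _ [g gB <-]; rewrite lerBrDr addrC -lD; [|by exists 1; exact: bdd01 fA|by exists 1; exact: bdd01 gB].
apply: le_positive_part => p pT; rewrite indicU//.
by have := fA p pT; have := gB p pT; lra.
Qed.

Lemma negative_partU A B : A `&` B = set0 ->
  negative_part (A `|` B) = negative_part A + negative_part B.
Proof.
by move=> AB; rewrite /negative_part positive_partU// indicU// lD//; lra.
Qed.

Let l_sum (I : Type) (r : seq I) (c : I -> R) (A : I -> set X) :
  l (fun p => \sum_(i <- r) c i * \1_(A i) p) = \sum_(i <- r) c i * l (\1_(A i)).
Proof.
have bs r' : bounded_on_domain (fun p => \sum_(i <- r') c i * \1_(A i) p).
  exists (\sum_(i <- r') `|c i|) => p _; apply: le_trans (ler_norm_sum _ _ _) _.
  apply: ler_sum => i _; rewrite normrM ler_piMr// ler_norml.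
  by have := indic01 (A i) p; lra.
elim: r => [|i r IH].
  rewrite big_nil; under eq_fun do rewrite big_nil.
  exact: l0.
rewrite big_cons -IH -lZ// -lD//; first by congr l; apply/funext => p; rewrite big_cons.
exists `|c i| => p _; rewrite normrM ler_piMr// ler_norml.
by have := indic01 (A i) p; lra.
Qed.

Definition riesz_charge : {charge set X -> \bar R} :=
  cadd (charge_of_finite_measure (quantile_measure positive_part T0))
       (cscale (-1) (charge_of_finite_measure (quantile_measure negative_part T0))).

Lemma riesz_charge_carried : carried_by T riesz_charge.
Proof.
move=> A mA A0; rewrite /riesz_charge [LHS]caddNE /= /charge_of_finite_measure.
by rewrite !quantile_measure_carried// oppe0 adde0.
Qed.

(** Both sides are close to one Riemann sum over cylinders. On the right [f] is replaced by the
    simple function [G] of its sample values, and [l G] is the difference of the sums for the two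
    parts; on the left these sums approximate the two integrals. *)
Theorem riesz_chargeE (f : R * 'rV[R]_d -> R) : continuous_periodic T f ->
  charge_integral riesz_charge (domain T) (fun p => f (point p)) = l (fun p => f (point p)).
Proof.
move=> cf; have uf := cantor_uniform_decode T0 cf.
rewrite (charge_integralE (m1 := quantile_measure positive_part T0)
  (m2 := quantile_measure negative_part T0))//; last 3 first.
- exact: measurable_domain.
- exact: bounded_measurable_point.
- by move=> A mA; exact: caddNE.
rewrite !Rintegral_quantile_measure//.
set I1 := Rintegral _ _ _; set I2 := Rintegral _ _ _.
(* The three errors add up to [e * K]: one for each integral, and [C * e] from the bound on [l]. *)
pose K := positive_part (domain T) + negative_part (domain T) + C.
apply/eqP; rewrite -subr_eq0 -normr_le0; apply/ler_addgt0Pr => e0 e00; rewrite add0r.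
have K0 : 0 < `|K| + 1 by rewrite ltr_wpDl.
pose e := e0 / (`|K| + 1); have e_gt0 : 0 < e by rewrite divr_gt0.
have [n hn] := uf _ e_gt0.
have := Rintegral_qbits (bit T) (domain T) positive_part_ge0 positive_partU uf hn.
have := Rintegral_qbits (bit T) (domain T) negative_part_ge0 negative_partU uf hn.
rewrite -/I1 -/I2; set S1 := \sum_(_ <- _) _; set S2 := \sum_(_ <- _) _ => H2 H1.
pose G (p : X) : R := \sum_(s <- enum {: n.-tuple bool})
  (f \o decode T) (extend s) * \1_(cyl (bit T) (domain T) s) p.
have GE p : domain T p -> G p = (f \o decode T) (extend (prefix (bit T ^~ p) n)).
  move=> pT; have sz : size (prefix (bit T ^~ p) n) == n by rewrite size_prefix.
  rewrite /G (bigD1_seq (Tuple sz)) ?enum_uniq ?mem_enum//= big1.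
    by rewrite addr0 indicE mem_set ?mulr1//; apply/cylE; rewrite size_prefix.
  move=> s /eqP ns; rewrite indicE memNset ?mulr0// => /cylE[_ ps].
  by apply: ns; apply: val_inj => /=; rewrite -ps size_tuple.
have H3 : `|l (fun p => f (point p)) - (S2 - S1)| <= C * e.
  have -> : S2 - S1 = l G.
    rewrite /G l_sum -sumrB; apply: eq_bigr => s _.
    by rewrite /negative_part; ring.
  have bF : bounded_on_domain (fun p => f (point p)).
    exact: (bounded_measurable_point T0 cf).2.
  have bG : bounded_on_domain G.
    have [M hM] := cantor_uniform_bounded uf.
    by exists M => p pT; rewrite GE//; exact: hM.
  have bN : bounded_on_domain (fun p => - 1 * G p).
    by have [M hM] := bG; exists M => p pT; rewrite mulN1r normrN; exact: hM.
  rewrite -mulN1r -lZ// -lD//; apply: lC => p pT; rewrite mulN1r GE//.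
  rewrite -(decode_bit T0 pT); apply: hn; by rewrite prefix_extend_prefix.
have -> : I1 - I2 - l (fun p => f (point p)) =
  (I1 - S2) - (I2 - S1) - (l (fun p => f (point p)) - (S2 - S1)) by ring.
apply: le_trans (ler_normB _ _) _; apply: le_trans (lerD (ler_normB _ _) (lexx _)) _.
apply: le_trans (lerD (lerD H1 H2) H3) _.
rewrite (_ : _ + _ = e * K); last by rewrite /K; ring.
apply: (@le_trans _ _ (e * (`|K| + 1))).
  by rewrite ler_wpM2l ?(ltW e_gt0)//; have := ler_norm K; lra.
by rewrite /e divfK// gt_eqF.
Qed.

End riesz_representation.

(** * Density of continuous periodic functions in L^1 *)

Section continuous_periodic_theory.
Context {R : realType} {d : nat}.
Local Notation spacetime := (R * 'rV[R]_d)%type.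
Variable T : R.
Local Notation cper := (@continuous_periodic R d T).

Lemma continuous_periodic_comp (U V : topologicalType) (f : spacetime -> U) (g : U -> V) :
  continuous g -> cper f -> cper (g \o f).
Proof.
move=> cg [cf pf]; split; last by move=> t x j /=; rewrite pf.
by move=> p; exact: (@continuous_comp (subspace (slab T)) _ _ f g p (cf p) (cg (f p))).
Qed.

Lemma continuous_periodic_cst (V : topologicalType) (a : V) : cper (fun=> a).
Proof. by split => // p; exact: cvg_cst. Qed.

Lemma continuous_periodicD (V : normedModType R) (f g : spacetime -> V) :
  cper f -> cper g -> cper (fun p => f p + g p).
Proof.
move=> [cf pf] [cg pg]; split; last by move=> t x j; rewrite pf pg.
by move=> p; apply: cvgD; [exact: cf|exact: cg].
Qed.

Lemma continuous_periodicZ (V : normedModType R) c (f : spacetime -> V) :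
  cper f -> cper (fun p => c *: f p).
Proof.
move=> [cf pf]; split; last by move=> t x j; rewrite pf.
by move=> p; apply: cvgZr; exact: cf.
Qed.

Lemma continuous_periodicM (f g : spacetime -> R) :
  cper f -> cper g -> cper (fun p => f p * g p).
Proof.
move=> [cf pf] [cg pg]; split; last by move=> t x j; rewrite pf pg.
by move=> p; apply: cvgM; [exact: cf|exact: cg].
Qed.

Lemma continuous_periodicB (V : normedModType R) (f g : spacetime -> V) :
  cper f -> cper g -> cper (fun p => f p - g p).
Proof.
move=> cf cg; have := continuous_periodicD cf (continuous_periodicZ (- 1) cg).
by congr cper; apply/funext => p; rewrite scaleN1r.
Qed.

Lemma continuous_periodic_max (f g : spacetime -> R) :
  cper f -> cper g -> cper (fun p => Num.max (f p) (g p)).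
Proof.
move=> [cf pf] [cg pg]; split; last by move=> t x j; rewrite pf pg.
exact: max_fun_continuous.
Qed.

Lemma continuous_periodic_min (f g : spacetime -> R) :
  cper f -> cper g -> cper (fun p => Num.min (f p) (g p)).
Proof.
move=> [cf pf] [cg pg]; split; last by move=> t x j; rewrite pf pg.
exact: min_fun_continuous.
Qed.

Lemma continuous_periodic_sum (V : normedModType R) (I : Type) (r : seq I)
    (f : I -> spacetime -> V) :
  (forall i, cper (f i)) -> cper (fun p => \sum_(i <- r) f i p).
Proof.
move=> cf; elim: r => [|i r IH].
  by under eq_fun do rewrite big_nil; exact: continuous_periodic_cst.
by under eq_fun do rewrite big_cons; exact: continuous_periodicD.
Qed.

Lemma continuous_periodic_time : cper (fst : spacetime -> R).
Proof.
by split => //; apply: continuous_subspaceT => p; exact: cvg_fst.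
Qed.

Lemma continuous_periodic_trig (phi : R -> R) j : continuous phi ->
  (forall x, phi (x + pi *+ 2) = phi x) ->
  cper (fun p => phi (pi *+ 2 * p.2 0 j)).
Proof.
move=> cphi pphi; split.
  apply: continuous_subspaceT => p.
  apply: (@continuous_comp _ _ _ (fun p : spacetime => pi *+ 2 * p.2 0 j) phi); last exact: cphi.
  apply: cvgM; first exact: cvg_cst.
  apply: (@continuous_comp _ _ _ snd (fun x : 'rV[R]_d => x 0 j)); first exact: cvg_snd.
  exact: coord_continuous.
move=> t x i /=; rewrite !mxE mulrDr eqxx /=.
by case: eqP => _; rewrite ?mulr1 ?pphi// mulr0 addr0.
Qed.

End continuous_periodic_theory.

Section density.
Context {R : realType} {d : nat}.
Local Notation X := (Xd (R := R) (d := d)).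
Local Notation spacetime := (R * 'rV[R]_d)%type.
Variables (T : R) (T0 : 0 < T) (I : finType) (m : I -> {measure set X -> \bar R}).
Local Notation D := (domain T : set X).
Hypothesis my : forall i, (m i D < +oo)%E.
Local Notation cper := (@continuous_periodic R d T).
Let mD : measurable D := measurable_domain T.

(** One [g] serves the whole finite family [m]: later it has to approximate an indicator for [dxdt]
    and for the Jordan parts of all entries of [B] at once. *)
Definition approximable : set (set X) :=
  [set A | measurable A /\ forall e, 0 < e -> exists g : spacetime -> R,
    [/\ cper g, (forall p, 0 <= g p <= 1) &
        forall i, Rintegral (m i) D (fun p => `|g (point p) - \1_A p|) <= e]].

Let bm (g : spacetime -> R) (A : set X) : cper g -> measurable A ->
  bounded_measurable D (fun p : X => `|g (point p) - \1_A p|).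
Proof.
move=> cg mA; apply: bounded_measurable_norm; apply: bounded_measurableB.
  exact: bounded_measurable_point.
exact: bounded_measurable_indic.
Qed.

Let itg i f (bf : bounded_measurable D f) := bounded_measurable_integrable mD (my i) bf.

Let dist_le i f g h : bounded_measurable D f -> bounded_measurable D g ->
  bounded_measurable D h -> (forall p, D p -> f p <= g p + h p) ->
  Rintegral (m i) D f <= Rintegral (m i) D g + Rintegral (m i) D h.
Proof.
move=> bf bg bh fgh; rewrite -RintegralD//; [|exact: itg..].
by apply: le_Rintegral => //; [exact: itg|exact: itg (bounded_measurableD bg bh)].
Qed.

Lemma approximable_congr (A B : set X) : measurable B -> A `&` D = B `&` D ->
  approximable A -> approximable B.
Proof.
move=> mB AB [mA apA]; split => // e e0; have [g [cg g01 ge]] := apA _ e0.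
exists g; split => // i; rewrite (_ : Rintegral _ _ _ = Rintegral (m i) D (fun p => `|g (point p) - \1_A p|))//.
apply: eq_Rintegral => p; rewrite inE => pD; congr (`|_ - _|).
rewrite !indicE; suff -> : (p \in A) = (p \in B) by [].
apply/idP/idP; rewrite !inE => pA.
  by have : (A `&` D) p by []; rewrite AB => -[].
by have : (B `&` D) p by []; rewrite -AB => -[].
Qed.

Lemma approximableC A : approximable A -> approximable (~` A).
Proof.
move=> [mA apA]; split; first exact: measurableC.
move=> e e0; have [g [cg g01 ge]] := apA _ e0.
exists (fun p => 1 - g p); split.
- by apply: continuous_periodicB => //; exact: continuous_periodic_cst.
- by move=> p; have := g01 p; lra.
- move=> i; apply: le_trans (ge i); rewrite le_eqVlt; apply/orP; left; apply/eqP.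
  apply: eq_Rintegral => p _; rewrite !indicE in_setC distrC; congr `|_|.
  by case: (p \in A) => /=; ring.
Qed.

Lemma approximableU A B : approximable A -> approximable B -> approximable (A `|` B).
Proof.
move=> [mA apA] [mB apB]; split; first exact: measurableU.
move=> e e0; have e2 : 0 < e / 2 by rewrite divr_gt0.
have [f [cf f01 fe]] := apA _ e2; have [g [cg g01 ge]] := apB _ e2.
have cfg := continuous_periodic_max cf cg.
exists (fun p => Num.max (f p) (g p)); split => //.
  move=> p; have := f01 p; have := g01 p.
  by rewrite le_max ge_max; lra.
move=> i; rewrite [e]splitr; apply: le_trans (lerD (fe i) (ge i)).
apply: dist_le; [exact: (bm cfg (measurableU _ _ mA mB))|exact: bm|exact: bm|].
move=> p _; have /andP[f0 f1] := f01 (point p); have /andP[g0 g1] := g01 (point p).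
rewrite !indicE in_setU; case: (p \in A); case: (p \in B) => /=;
  case: (leP (f (point p)) (g (point p))) => h1;
  do ? case: ger0P => ?; lra.
Qed.

(** By continuity from below, finite unions exhaust the countable one up to [e / 2] in each [m i];
    as the [i] are finitely many, one index works for all. *)
Lemma approximable_bigcup (F : (set X)^nat) : (forall n, approximable (F n)) ->
  approximable (\bigcup_n F n).
Proof.
move=> apF; have mF n : measurable (F n) by have [] := apF n.
have mU : measurable (\bigcup_n F n) by exact: bigcup_measurable.
have ap0 : approximable set0.
  split; first exact: measurable0.
  move=> e e0; exists (fun=> 0); split; [exact: continuous_periodic_cst|by rewrite lexx ler01|].
  move=> i; rewrite (_ : Rintegral _ _ _ = 0) ?ltW//.
  under eq_Rintegral do rewrite indic0 subrr normr0.
  by rewrite Rintegral_cst// mul0r.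
pose G n := \big[setU/set0]_(k < n) F k.
have apG n : approximable (G n).
  rewrite /G; elim: n => [|n IH]; first by rewrite big_ord0.
  by rewrite big_ord_recr; exact: approximableU.
have mG n : measurable (G n) by have [] := apG n.
have GU n : G n `<=` \bigcup_n F n.
  by rewrite /G => p; rewrite -bigcup_mkord => -[k _ Fk]; exists k.
have GUE : \bigcup_n (G n `&` D) = (\bigcup_n F n) `&` D.
  rewrite setI_bigcupl /G; apply/seteqP; split => p [n _ [Gp Dp]].
    by move: Gp; rewrite -bigcup_mkord => -[k _ Fk]; exists k.
  by exists n.+1 => //; split => //; rewrite -bigcup_mkord; exists n => //=.
split => // e e0; have e2 : 0 < e / 2 by rewrite divr_gt0.
have near_i i : \forall n \near \oo,
    Rintegral (m i) D (fun p => `|\1_(G n) p - \1_(\bigcup_n F n) p|) <= e / 2.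
  have cv : (m i \o (fun n => G n `&` D)) n @[n --> \oo] --> m i ((\bigcup_n F n) `&` D).
    rewrite -GUE; apply: nondecreasing_cvg_mu.
    - by move=> n; exact: measurableI.
    - by rewrite GUE; exact: measurableI.
    - by move=> a b ab; apply/subsetPset; apply: setSI; exact: subset_bigsetU.
  have fin A : measurable A -> m i (A `&` D) \is a fin_num.
    move=> mA; rewrite ge0_fin_numE//; apply: le_lt_trans (my i).
    by apply: le_measure; rewrite ?inE//; exact: measurableI.
  have cvr : fine (m i (G n `&` D)) @[n --> \oo] --> fine (m i ((\bigcup_n F n) `&` D)).
    by apply: fine_cvg; rewrite fineK ?fin//; exact: cv.
  move/cvgrPdist_le : cvr => /(_ _ e2); apply: filterS => n he.
  apply: le_trans he; rewrite -!Rintegral_indic// -RintegralB//;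
    [|exact: itg (bounded_measurable_indic _ _)..].
  apply: le_trans (ler_norm _); rewrite le_eqVlt; apply/orP; left; apply/eqP.
  apply: eq_Rintegral => p _; rewrite !indicE distrC ger0_norm// subr_ge0.
  case: (boolP (p \in G n)) => [|_]; last by case: (_ \in _).
  by rewrite inE => /GU h; rewrite mem_set.
have [N _ hN] : \forall n \near \oo, forall i,
    Rintegral (m i) D (fun p => `|\1_(G n) p - \1_(\bigcup_n F n) p|) <= e / 2.
  exact: filter_forall.
have [_ /(_ _ e2)[g [cg g01 ge]]] := apG N.
exists g; split => // i; rewrite [e]splitr.
apply: le_trans (lerD (ge i) (hN N (leqnn N) i)); apply: dist_le.
- exact: bm.
- exact: bm.
- by apply: bounded_measurable_norm; apply: bounded_measurableB; exact: bounded_measurable_indic.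
- move=> p _; have := ler_normD (g (point p) - \1_(G N) p) (\1_(G N) p - \1_(\bigcup_n F n) p).
  by rewrite addrA subrK.
Qed.

Lemma approximable_gt (u : spacetime -> R) c : cper u ->
  measurable_fun setT (fun p : X => u (point p)) ->
  approximable [set p | c < u (point p)].
Proof.
move=> cu mu.
have mA : measurable [set p : X | c < u (point p)].
  rewrite (_ : [set p : X | _] = setT `&` (fun p => u (point p)) @^-1` `]c, +oo[%classic).
    by apply: mu => //; exact: measurable_itv.
  by apply/seteqP; split => p /=; rewrite in_itv/= andbT // => -[].
split => // e e0.
(* Ramps with values in [[0, 1]] that converge pointwise to the indicator of [c < u]. *)
pose g n (p : spacetime) : R := Num.min 1 (n%:R * Num.max 0 (u p - c)).
have cg n : cper (g n).
  apply: continuous_periodic_min; first exact: continuous_periodic_cst.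
  apply: continuous_periodicM; first exact: continuous_periodic_cst.
  apply: continuous_periodic_max; first exact: continuous_periodic_cst.
  by apply: continuous_periodicB => //; exact: continuous_periodic_cst.
have g01 n p : 0 <= g n p <= 1.
  by rewrite /g le_min ler01 ge_min lexx /= andbT mulr_ge0// le_max lexx.
set A := [set p | _] in mA *.
have cvgA p : g n (point p) @[n --> \oo] --> (\1_A p : R).
  rewrite indicE; have [|] := boolP (p \in A); rewrite ?inE /A /= => h.
    apply: cvg_near_cst; have uc : 0 < u (point p) - c by rewrite subr_gt0.
    have := nbhs_infty_ger (u (point p) - c)^-1.
    apply: filterS => n hn; rewrite /g max_r ?(ltW uc)// min_l//.
    by rewrite -ler_pdivrMr// mul1r.
  apply: cvg_near_cst; near=> n; rewrite /g max_l ?mulr0 ?min_r//.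
  by move: h; rewrite notin_setE /= => /negP; rewrite -leNgt subr_le0.
have near_i i : \forall n \near \oo,
    Rintegral (m i) D (fun p => `|g n (point p) - \1_A p|) <= e.
  have [_ cv _] : [/\ (m i).-integrable D (fun p : X => (\1_A p)%:E),
     [sequence (\int[m i]_(p in D) `|(g n (point p))%:E - (\1_A p)%:E|)%E]_n @ \oo --> 0%E &
     [sequence (\int[m i]_(p in D) (g n (point p))%:E)%E]_n @ \oo -->
       (\int[m i]_(p in D) (\1_A p)%:E)%E].
    apply: (@dominated_convergence _ _ _ (m i) D mD _ _ (cst 1%E)).
    - by move=> n; apply/measurable_EFinP; exact: (bounded_measurable_point T0 (cg n)).1.
    - by apply/measurable_EFinP; exact: measurable_indic.
    - by apply: aeW => p _; apply: cvg_EFin; [exact: nearW|exact: cvgA].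
    - exact: itg (bounded_measurable_cst D 1).
    - apply: aeW => p n _; rewrite /= lee_fin; have := g01 n (point p).
      by rewrite ler_norml; lra.
  move/fine_cvg : cv => /cvgrPdist_le/(_ _ e0).
  apply: filterS => n; rewrite sub0r normrN; apply: le_trans; exact: ler_norm.
have [N _ hN] : \forall n \near \oo, forall i,
    Rintegral (m i) D (fun p => `|g n (point p) - \1_A p|) <= e.
  exact: filter_forall.
by exists (g N); split => // i; exact: (hN N (leqnn N)).
Unshelve. all: by end_near.
Qed.

Lemma sigma_algebra_approximable : sigma_algebra setT approximable.
Proof.
split; last exact: approximable_bigcup.
- rewrite -(setCT); apply: approximableC; split; first exact: measurableT.
  move=> e e0; exists (fun=> 1); split; [exact: continuous_periodic_cst|by rewrite lexx ler01|].
  move=> i; rewrite (_ : Rintegral _ _ _ = 0) ?ltW//.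
  under eq_Rintegral do rewrite indicT subrr normr0.
  by rewrite Rintegral_cst// mul0r.
- by move=> A apA; rewrite setTD; exact: approximableC.
Qed.

(** The sign of the sine tells the two halves of the period apart; on each half the cosine is
    strictly monotone. *)
Let angle_sin (x : R) : 0 <= x < 1 -> (sin (pi *+ 2 * x) < 0) = (1 / 2 < x).
Proof.
move=> x01; have p0 := pi_gt0 R.
have [h|h] := ltP (1/2) x.
  have -> : pi *+ 2 * x = pi *+ 2 * x - pi + pi by rewrite subrK.
  rewrite sinDpi oppr_lt0; apply: sin_gt0_pi; apply/andP; split; nra.
apply/negbTE; rewrite -leNgt; apply: sin_ge0_pi; apply/andP; split; nra.
Qed.

Let angle_cos_lo (x c : R) : 0 <= x <= 1 / 2 -> 0 <= c <= 1 / 2 ->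
  (cos (pi *+ 2 * x) < cos (pi *+ 2 * c)) = (c < x).
Proof.
move=> hx hc; have p0 := pi_gt0 R.
rewrite ltr_cos ?in_itv/=; last 2 first.
- by apply/andP; split; nra.
- by apply/andP; split; nra.
by rewrite ltr_pM2l// pmulrn_lgt0.
Qed.

Let angle_cos_hi (x c : R) : 1 / 2 <= x <= 1 -> 1 / 2 <= c <= 1 ->
  (cos (pi *+ 2 * c) < cos (pi *+ 2 * x)) = (c < x).
Proof.
move=> hx hc.
have E (y : R) : cos (pi *+ 2 * y) = cos (pi *+ 2 * (1 - y)).
  rewrite mulrBr mulr1 addrC cosD2pi cosN//.
rewrite (E x) (E c) angle_cos_lo; [|lra|lra].
by rewrite ltrD2l ltrN2.
Qed.

Let mcoord j : measurable_fun setT (fun p : X => (point p).2 0 j).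
Proof.
rewrite (_ : (fun p => _) = (fun t => tnth t j) \o snd); last first.
  by apply/funext => p /=; rewrite mxE.
by apply: measurableT_comp; [exact: measurable_tnth|exact: measurable_snd].
Qed.

(* Inside [0, 1) the half-lines are Boolean combinations of superlevel sets of
   the sine and cosine of 2 pi x. *)
Lemma approximable_coord j c : approximable [set p : X | c < tnth p.2 j].
Proof.
have [s0 sC sU] := sigma_algebra_approximable.
have sI A B : approximable A -> approximable B -> approximable (A `&` B).
  move=> apA apB; rewrite -[A `&` B]setCK setCI.
  by apply: approximableC; apply: approximableU; exact: approximableC.
have mA : measurable [set p : X | c < tnth p.2 j].
  rewrite (_ : [set p : X | _] = setT `&` (fun p => (point p).2 0 j) @^-1` `]c, +oo[%classic).
    by apply: mcoord => //; exact: measurable_itv.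
  by apply/seteqP; split => p /=; rewrite mxE in_itv/= andbT // => -[].
have trig (phi : R -> R) a : continuous phi -> (forall x, phi (x + pi *+ 2) = phi x) ->
    approximable [set p : X | a < phi (pi *+ 2 * (point p).2 0 j)].
  move=> cphi pphi; apply: (approximable_gt (u := fun p => phi (pi *+ 2 * p.2 0 j))).
    exact: continuous_periodic_trig.
  apply: measurableT_comp; first exact: continuous_measurable_fun.
  by apply: measurable_funM; [exact: measurable_cst|exact: mcoord].
have cN (phi : R -> R) : continuous phi -> continuous (fun x => - phi x).
  by move=> cphi x; apply: cvgN; exact: cphi.
have cs := @continuous_sin R; have cc := @continuous_cos R.
have apS : approximable [set p : X | 0 < - sin (pi *+ 2 * (point p).2 0 j)].
  by apply: (trig (fun x => - sin x)); [exact: cN|move=> x; rewrite sinD2pi].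
have [c0|c0] := ltP c 0.
  apply: approximable_congr (_ : approximable setT) => //.
    apply/seteqP; split => p [_ pD]; split => //=.
    by have [_ /(_ j)/andP[h _]] := pD; exact: lt_le_trans h.
  by rewrite -setC0; exact: approximableC.
have [c1|c1] := leP 1 c.
  apply: approximable_congr s0 => //.
  apply/seteqP; split => p [] //= h [_ /(_ j)/andP[_ h2]].
  by have := lt_trans h h2; rewrite ltNge c1.
(* For [c < 1 / 2] the half-line contains the right half of the period and is a union; otherwise it
   lies in the right half and is an intersection. *)
have [c2|c2] := ltP c (1 / 2).
  apply: approximable_congr (_ : approximable
    ([set p : X | 0 < - sin (pi *+ 2 * (point p).2 0 j)] `|`
     [set p : X | - cos (pi *+ 2 * c) < - cos (pi *+ 2 * (point p).2 0 j)])) => //; last first.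
    apply: approximableU => //.
    by apply: (trig (fun x => - cos x)); [exact: cN|move=> x; rewrite cosD2pi].
  apply/seteqP; split => p [+ pD]; have [_ /(_ j) pj] := pD; rewrite /= mxE oppr_gt0 ltrN2 angle_sin//.
    move=> h; split => //=; case: h => h; first lra.
    have [x2|x2] := ltP (1/2) (tnth p.2 j : R); first lra.
    by rewrite angle_cos_lo in h => //; lra.
  move=> h; split => //; have [x2|x2] := ltP (1/2) (tnth p.2 j : R); [by left|right].
  by rewrite angle_cos_lo; lra.
apply: approximable_congr (_ : approximable
  ([set p : X | 0 < - sin (pi *+ 2 * (point p).2 0 j)] `&`
   [set p : X | cos (pi *+ 2 * c) < cos (pi *+ 2 * (point p).2 0 j)])) => //; last first.
  apply: sI => //.
  by apply: (trig cos) => // x; rewrite cosD2pi.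
apply/seteqP; split => p [+ pD]; have [_ /(_ j) pj] := pD; rewrite /= mxE oppr_gt0 angle_sin//.
  by move=> [h1 h2]; split => //=; rewrite angle_cos_hi in h2 => //; lra.
by move=> h; split => //; split; [lra|rewrite angle_cos_hi; lra].
Qed.

(** All coordinates are measurable for the sigma-algebra of approximable sets, so it contains the
    product Borel sigma-algebra: the identity from it to [X] is measurable. *)
Theorem L1_density A : measurable A -> approximable A.
Proof.
pose Y := g_sigma_algebraType approximable.
have YE := measurable_g_measurableTypeE sigma_algebra_approximable.
suff mid : measurable_fun setT (id : Y -> X).
  by move=> mA; have := mid measurableT _ mA; rewrite setTI preimage_id YE.
have Rgen (f : Y -> measurableTypeR R) : (forall c, approximable [set p : X | c < f p]) ->
    measurable_fun setT f.
  move=> fc; apply: (measurability _ (RGenOInfty.measurableE R)) => _ [_ [c ->] <-].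
  rewrite setTI YE (_ : _ @^-1` _ = [set p : X | c < f p]); first exact: fc.
  by apply/seteqP; split => p /=; rewrite in_itv/= andbT.
apply/measurable_fun_pairP; split.
  apply: Rgen => c; apply: (approximable_gt (u := fst)).
    exact: continuous_periodic_time.
  exact: measurable_fst.
apply/measurable_fun_tnthP => j; apply: Rgen => c; exact: approximable_coord.
Qed.

End density.

(** * Test fields *)

Section smooth_functions.
Context {R : realType} {V : normedModType R}.
Implicit Types f g : V -> R.

Lemma smooth_derivable f x v : smooth f -> derivable f x v.
Proof. by move=> sf; have [+ _] := sf [::] x I; exact. Qed.

Lemma smooth_continuous f : smooth f -> continuous f.
Proof. by move=> sf x; have [_ +] := sf [::] x I. Qed.

Lemma derive_lin c f g v : smooth f -> smooth g ->
  'D_v (fun x => c * f x + g x) = (fun x => c * 'D_v f x + 'D_v g x).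
Proof.
move=> sf sg; apply/funext => x.
have df := @smooth_derivable f x v sf; have dg := @smooth_derivable g x v sg.
have -> : (fun x => c * f x + g x) = (c *: f + g) by [].
have dcf : derivable (c *: f) x v by exact: derivableZ.
by have -> := deriveD dcf dg; have -> := deriveZ c df.
Qed.

Lemma smooth_derive f v : smooth f -> smooth ('D_v f).
Proof.
by move=> sf s x _; have := sf (s ++ [:: v]) x I; rewrite /iterD foldr_cat.
Qed.

Lemma smooth_iterD f s : smooth f -> smooth (iterD s f).
Proof. by move=> sf; elim: s => //= v s IH; exact: smooth_derive. Qed.

Lemma iterD_lin c f g s : smooth f -> smooth g ->
  iterD s (fun x => c * f x + g x) = (fun x => c * iterD s f x + iterD s g x).
Proof.
by move=> sf sg; elim: s => //= v s ->; rewrite derive_lin//; exact: smooth_iterD.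
Qed.

Lemma smooth_lin c f g : smooth f -> smooth g -> smooth (fun x => c * f x + g x).
Proof.
move=> sf sg s x _; rewrite iterD_lin//.
have sf' := smooth_iterD s sf; have sg' := smooth_iterD s sg.
split=> [v|].
  by apply: derivableD; [apply: derivableZ|]; exact: smooth_derivable.
apply: cvgD; last exact: smooth_continuous.
by apply: cvgM; [exact: cvg_cst|exact: smooth_continuous].
Qed.

Lemma derive_cst0 (c : R) v : 'D_v (fun=> c) = (fun=> 0) :> (V -> R).
Proof. by apply/funext => x; exact: derive_cst. Qed.

Lemma smooth_cst (c : R) : smooth ((fun=> c) : V -> R).
Proof.
have iterc s : exists a, iterD s (fun=> c) = (fun=> a) :> (V -> R).
  by elim: s => [|v s [a IH]]; [exists c|exists 0; rewrite /= IH derive_cst0].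
move=> s x _; have [a ->] := iterc s; split=> [v|]; first exact: derivable_cst.
exact: cvg_cst.
Qed.

Lemma smoothZ c f : smooth f -> smooth (fun x => c * f x).
Proof.
move=> sf; have := smooth_lin c sf (smooth_cst 0); congr smooth.
by apply/funext => x; rewrite addr0.
Qed.

Lemma smoothD f g : smooth f -> smooth g -> smooth (fun x => f x + g x).
Proof.
move=> sf sg; have := smooth_lin 1 sf sg; congr smooth.
by apply/funext => x; rewrite mul1r.
Qed.

Lemma smooth_sum (I : Type) (r : seq I) (f : I -> V -> R) :
  (forall i, smooth (f i)) -> smooth (fun x => \sum_(i <- r) f i x).
Proof.
move=> sf; elim: r => [|i r IH].
  by under eq_fun do rewrite big_nil; exact: smooth_cst.
by under eq_fun do rewrite big_cons; exact: smoothD.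
Qed.

End smooth_functions.

(** * The operator [L] on smooth periodic fields and the space of test pairs *)

Section test_fields.
Context {R : realType} {d : nat}.
Local Notation N := (dimN d).
Local Notation spacetime := (R * 'rV[R]_d)%type.
Variables (T nu : R).
Implicit Types (Psi Phi : spacetime -> 'M[R]_N) (p : spacetime).

Lemma dimN_ind (Q : 'I_N -> Prop) :
  (forall j, Q (iq j)) -> (forall j, Q (iG j)) -> Q ixi -> Q irho -> forall k, Q k.
Proof.
move=> Hq HG Hx Hr k; rewrite -[k]splitK; case: (fintype.split k) => [j|k1]; first exact: Hq.
rewrite /unsplit -[k1]splitK; case: (fintype.split k1) => [j|k2]; first exact: HG.
rewrite /unsplit -[k2]splitK; case: (fintype.split k2) => [j|j]; rewrite ord1 /unsplit.
  exact: Hx.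
exact: Hr.
Qed.

Lemma mkvec_q (q G : 'rV[R]_d) xi rho j : mkvec q G xi rho 0 (iq j) = q 0 j.
Proof. by rewrite /mkvec /iq row_mxEl. Qed.

Lemma mkvec_G (q G : 'rV[R]_d) xi rho j : mkvec q G xi rho 0 (iG j) = G 0 j.
Proof. by rewrite /mkvec /iG row_mxEr row_mxEl. Qed.

Lemma mkvec_xi (q G : 'rV[R]_d) xi rho : mkvec q G xi rho 0 ixi = xi.
Proof. by rewrite /mkvec /ixi 2!row_mxEr row_mxEl mxE eqxx. Qed.

Lemma mkvec_rho (q G : 'rV[R]_d) xi rho : mkvec q G xi rho 0 irho = rho.
Proof. by rewrite /mkvec /irho 3!row_mxEr mxE eqxx. Qed.

Lemma periodic_derive (f : spacetime -> R) v : periodic f -> periodic ('D_v f).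
Proof.
move=> pf t x j; have E : f \o shift (t, x + unit_vec j) = f \o shift (t, x).
  apply/funext => -[h1 h2].
  change (f (h1 + t, h2 + (x + unit_vec j)) = f (h1 + t, h2 + x)).
  by rewrite addrA pf.
by rewrite /derive E pf.
Qed.

Definition smooth_periodic (f : spacetime -> R) := smooth f /\ periodic f.

Lemma smooth_periodic_continuous f : smooth_periodic f -> continuous_periodic T f.
Proof.
by move=> [sf pf]; split => //; apply: continuous_subspaceT; exact: smooth_continuous.
Qed.

Lemma smooth_periodicD f g : smooth_periodic f -> smooth_periodic g ->
  smooth_periodic (fun p => f p + g p).
Proof.
by move=> [sf pf] [sg pg]; split; [exact: smoothD|move=> t x j; rewrite pf pg].
Qed.

Lemma smooth_periodicZ c f : smooth_periodic f -> smooth_periodic (fun p => c * f p).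
Proof. by move=> [sf pf]; split; [exact: smoothZ|move=> t x j; rewrite pf]. Qed.

Lemma smooth_periodicN f : smooth_periodic f -> smooth_periodic (fun p => - f p).
Proof.
move=> /(smooth_periodicZ (- 1)); congr smooth_periodic.
by apply/funext => p; rewrite mulN1r.
Qed.

Lemma smooth_periodic_sum (I : Type) (r : seq I) (f : I -> spacetime -> R) :
  (forall i, smooth_periodic (f i)) -> smooth_periodic (fun p => \sum_(i <- r) f i p).
Proof.
move=> spf; split; first by apply: smooth_sum => i; have [] := spf i.
by move=> t x j; apply: eq_bigr => i _; have [_ ->] := spf i.
Qed.

Lemma smooth_periodic_derive f v : smooth_periodic f -> smooth_periodic ('D_v f).
Proof. by move=> [sf pf]; split; [exact: smooth_derive|exact: periodic_derive]. Qed.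

Lemma Lop_q Psi p j : Lop nu Psi p 0 (iq j) =
  - divx (fun i p' => Psi p' (iq j) (iq i)) p - divx (fun i p' => Psi p' (iG j) (iG i)) p
  - (nu - 1) * dx j (fun p' => Psi p' ixi ixi) p
  + nu * dx j (divx (fun i p' => Psi p' (iG i) ixi)) p
  + (1 - nu) * dx j (fun p' => \sum_i Psi p' (iG i) (iG i)) p.
Proof. by rewrite /Lop mkvec_q !mxE. Qed.

Lemma Lop_G Psi p j : Lop nu Psi p 0 (iG j) =
  - (nu * dx j (divx (fun i p' => Psi p' (iq i) ixi)) p)
  + (nu - 1) * dx j (fun p' => \sum_i Psi p' (iq i) (iG i)) p.
Proof. by rewrite /Lop mkvec_G !mxE. Qed.

Lemma Lop_xi Psi p : Lop nu Psi p 0 ixi =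
  - (nu * divx (fun i p' => Psi p' (iq i) ixi) p)
  + (nu - 1) * \sum_i Psi p (iq i) (iG i).
Proof. by rewrite /Lop mkvec_xi. Qed.

Lemma Lop_rho Psi p : Lop nu Psi p 0 irho = - divx (fun i p' => Psi p' (iq i) irho) p.
Proof. by rewrite /Lop mkvec_rho. Qed.

Lemma smooth_periodic_divx (f : 'I_d -> spacetime -> R) :
  (forall i, smooth_periodic (f i)) -> smooth_periodic (divx f).
Proof.
by move=> spf; apply: smooth_periodic_sum => i; exact: smooth_periodic_derive.
Qed.

Definition smooth_entries (Psi : spacetime -> 'M[R]_N) :=
  forall i j, smooth_periodic (fun p => Psi p i j).

Lemma smooth_periodic_Lop Psi k : smooth_entries Psi ->
  smooth_periodic (fun p => Lop nu Psi p 0 k).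
Proof.
move=> sPsi; elim/dimN_ind: k => [j|j||].
- under eq_fun do rewrite Lop_q.
  apply: smooth_periodicD; [apply: smooth_periodicD; [apply: smooth_periodicD;
    [apply: smooth_periodicD|]|]|].
  + by apply: smooth_periodicN; exact: smooth_periodic_divx.
  + by apply: smooth_periodicN; exact: smooth_periodic_divx.
  + by apply/smooth_periodicN/smooth_periodicZ/smooth_periodic_derive.
  + by apply/smooth_periodicZ/smooth_periodic_derive/smooth_periodic_divx.
  + by apply/smooth_periodicZ/smooth_periodic_derive/smooth_periodic_sum.
- under eq_fun do rewrite Lop_G.
  apply: smooth_periodicD.
  + by apply/smooth_periodicN/smooth_periodicZ/smooth_periodic_derive/smooth_periodic_divx.
  + by apply/smooth_periodicZ/smooth_periodic_derive/smooth_periodic_sum.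
- under eq_fun do rewrite Lop_xi.
  apply: smooth_periodicD.
  + by apply/smooth_periodicN/smooth_periodicZ/smooth_periodic_divx.
  + by apply/smooth_periodicZ/smooth_periodic_sum.
- under eq_fun do rewrite Lop_rho.
  by apply/smooth_periodicN/smooth_periodic_divx.
Qed.

Lemma dx_lin c j f g p : smooth f -> smooth g ->
  dx j (fun p => c * f p + g p) p = c * dx j f p + dx j g p.
Proof. by move=> sf sg; exact: (congr1 (@^~ p) (derive_lin c (0, unit_vec j) sf sg)). Qed.

Lemma divx_lin c (f g : 'I_d -> spacetime -> R) p :
  (forall i, smooth (f i)) -> (forall i, smooth (g i)) ->
  divx (fun i p => c * f i p + g i p) p = c * divx f p + divx g p.
Proof.
move=> sf sg; rewrite /divx mulr_sumr -big_split; apply: eq_bigr => i _.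
by rewrite dx_lin.
Qed.

Let alg_q (c a a' b b' e e' f f' g g' : R) :
  - (c * a + a') - (c * b + b') - (nu - 1) * (c * e + e') + nu * (c * f + f')
    + (1 - nu) * (c * g + g') =
  c * (- a - b - (nu - 1) * e + nu * f + (1 - nu) * g)
    + (- a' - b' - (nu - 1) * e' + nu * f' + (1 - nu) * g').
Proof. ring. Qed.

Let alg_G (c a a' b b' : R) :
  - (nu * (c * a + a')) + (nu - 1) * (c * b + b') =
  c * (- (nu * a) + (nu - 1) * b) + (- (nu * a') + (nu - 1) * b').
Proof. ring. Qed.

Lemma Lop_entry_lin c Psi Phi p k : smooth_entries Psi -> smooth_entries Phi ->
  Lop nu (fun p => c *: Psi p + Phi p) p 0 k = c * Lop nu Psi p 0 k + Lop nu Phi p 0 k.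
Proof.
move=> sPsi sPhi.
have s1 i j : smooth (fun p => Psi p i j) by have [] := sPsi i j.
have s2 i j : smooth (fun p => Phi p i j) by have [] := sPhi i j.
have E i j : (fun p => (c *: Psi p + Phi p) i j) = (fun p => c * Psi p i j + Phi p i j).
  by apply/funext => q; rewrite !mxE.
have divE (f g : 'I_d -> 'I_N) q : divx (fun i q => (c *: Psi q + Phi q) (f i) (g i)) q =
    c * divx (fun i q => Psi q (f i) (g i)) q + divx (fun i q => Phi q (f i) (g i)) q.
  rewrite -divx_lin//; congr (divx _ q); apply/funext => i; exact: E.
have sumE (f g : 'I_d -> 'I_N) q : \sum_i (c *: Psi q + Phi q) (f i) (g i) =
    c * (\sum_i Psi q (f i) (g i)) + \sum_i Phi q (f i) (g i).
  by rewrite mulr_sumr -big_split; apply: eq_bigr => i _; rewrite !mxE.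
have sdiv Ps (f g : 'I_d -> 'I_N) : smooth_entries Ps -> smooth (divx (fun i q => Ps q (f i) (g i))).
  by move=> sP; have [] := smooth_periodic_divx (fun i => sP (f i) (g i)).
have ssum Ps (f g : 'I_d -> 'I_N) : smooth_entries Ps -> smooth (fun q => \sum_i Ps q (f i) (g i) : R).
  by move=> sP; have [] := smooth_periodic_sum (index_enum 'I_d) (fun i => sP (f i) (g i)).
have dxdivE j (f g : 'I_d -> 'I_N) q : dx j (divx (fun i q => (c *: Psi q + Phi q) (f i) (g i))) q =
    c * dx j (divx (fun i q => Psi q (f i) (g i))) q + dx j (divx (fun i q => Phi q (f i) (g i))) q.
  rewrite -dx_lin//; [|exact: sdiv..]; congr (dx j _ q); apply/funext => q'; exact: divE.
have dxsumE j (f g : 'I_d -> 'I_N) q : dx j (fun q => \sum_i (c *: Psi q + Phi q) (f i) (g i)) q =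
    c * dx j (fun q => \sum_i Psi q (f i) (g i)) q + dx j (fun q => \sum_i Phi q (f i) (g i)) q.
  rewrite -dx_lin//; [|exact: ssum..]; congr (dx j _ q); apply/funext => q'; exact: sumE.
elim/dimN_ind: k => [j|j||].
- apply: (etrans (Lop_q _ p j)).
  apply: (etrans _ (esym (f_equal2 (fun a b => c * a + b) (Lop_q Psi p j) (Lop_q Phi p j)))).
  rewrite (divE (fun=> iq j) (@iq d) p) (divE (fun=> iG j) (@iG d) p).
  rewrite (dxdivE j (@iG d) (fun=> ixi) p) (dxsumE j (@iG d) (@iG d) p).
  rewrite (E ixi ixi) (dx_lin c j p (s1 _ _) (s2 _ _)).
  exact: alg_q.
- apply: (etrans (Lop_G _ p j)).
  apply: (etrans _ (esym (f_equal2 (fun a b => c * a + b) (Lop_G Psi p j) (Lop_G Phi p j)))).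
  rewrite (dxdivE j (@iq d) (fun=> ixi) p) (dxsumE j (@iq d) (@iG d) p).
  exact: alg_G.
- apply: (etrans (Lop_xi _ p)).
  apply: (etrans _ (esym (f_equal2 (fun a b => c * a + b) (Lop_xi Psi p) (Lop_xi Phi p)))).
  rewrite (divE (@iq d) (fun=> ixi) p) (sumE (@iq d) (@iG d) p).
  exact: alg_G.
- apply: (etrans (Lop_rho _ p)).
  apply: (etrans _ (esym (f_equal2 (fun a b => c * a + b) (Lop_rho Psi p) (Lop_rho Phi p)))).
  rewrite (divE (@iq d) (fun=> irho) p).
  by rewrite opprD mulrN.
Qed.

Lemma Lop_lin c Psi Phi p : smooth_entries Psi -> smooth_entries Phi ->
  Lop nu (fun p => c *: Psi p + Phi p) p = c *: Lop nu Psi p + Lop nu Phi p.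
Proof.
move=> sP sQ; apply/rowP => k; rewrite [RHS]mxE [X in _ = X + _]mxE.
exact: Lop_entry_lin.
Qed.

Lemma AopE (w : spacetime -> 'rV[R]_N) p i :
  Aop w p 0 i = dx i (fun p' => w p' 0 ixi) p - w p 0 (iG i).
Proof. by rewrite mxE. Qed.

Let alg_A (c a a' b b' : R) : a - b = 0 -> a' - b' = 0 -> (c * a + a') - (c * b + b') = 0.
Proof. by move=> h1 h2; rewrite opprD addrACA -mulrBr h1 h2 mulr0 addr0. Qed.

(* (LC) says that (E, B) annihilates these pairs. *)
Definition test_pair (w : (spacetime -> 'rV[R]_N) * (spacetime -> 'M[R]_N)) :=
  exists Psi, [/\ test_field Psi,
    forall p, slab T p -> Aop (Lop nu Psi) p = 0,
    forall x, Psi (0, x) = 0 &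
    w = (Lop nu Psi, fun p => \matrix_(i, j) dt (fun p' => Psi p' i j) p)].

Let test_field_entries Psi : test_field Psi -> smooth_entries Psi.
Proof. by move=> [s p _] i j; split => // t x k; rewrite p. Qed.

Lemma test_pair_lin c w w' : test_pair w -> test_pair w' -> test_pair (c *: w + w').
Proof.
move=> [Psi [tP AP P0 ->]] [Phi [tQ AQ Q0 ->]].
have sP := test_field_entries tP; have sQ := test_field_entries tQ.
exists (fun p => c *: Psi p + Phi p); split.
- have [s1 p1 t1] := tP; have [s2 p2 t2] := tQ; split.
  + move=> i j; under eq_fun do rewrite 2!mxE; exact: smooth_lin.
  + by move=> t x j; rewrite p1 p2.
  + by move=> p; rewrite linearD linearZ /= t1 t2.
- move=> p pT; apply/rowP => i; rewrite [RHS]mxE.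
  have h1 : Aop (Lop nu Psi) p 0 i = 0 by rewrite AP// mxE.
  have h2 : Aop (Lop nu Phi) p 0 i = 0 by rewrite AQ// mxE.
  rewrite AopE in h1; rewrite AopE in h2; apply: (etrans (AopE _ p i)).
  have [s1 _] := smooth_periodic_Lop ixi sP; have [s2 _] := smooth_periodic_Lop ixi sQ.
  have -> : (fun p' => Lop nu (fun p => c *: Psi p + Phi p) p' 0 ixi) =
    (fun p' => c * Lop nu Psi p' 0 ixi + Lop nu Phi p' 0 ixi).
    by apply/funext => q; exact: Lop_entry_lin.
  apply: (etrans (f_equal2 (fun a b => a - b) (dx_lin c i p s1 s2)
    (Lop_entry_lin c p (iG i) sP sQ))).
  exact: alg_A h1 h2.
- by move=> x; rewrite P0 Q0 scaler0 addr0.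
- congr pair; apply/funext => p; first exact: esym (Lop_lin c p sP sQ).
  apply/matrixP => i j; rewrite [RHS]mxE.
  have [s1 _] := sP i j; have [s2 _] := sQ i j.
  apply: (@etrans _ _ (c * dt (fun p' => Psi p' i j) p + dt (fun p' => Phi p' i j) p)).
    change ((c *: (\matrix_(i, j) dt (fun p' => Psi p' i j) p) +
      \matrix_(i, j) dt (fun p' => Phi p' i j) p) i j =
      c * dt (fun p' => Psi p' i j) p + dt (fun p' => Phi p' i j) p).
    by rewrite !mxE.
  have -> : (fun p' => (c *: Psi p' + Phi p') i j) =
    (fun p' => c * Psi p' i j + Phi p' i j) by apply/funext => q; rewrite !mxE.
  symmetry.
  exact: (congr1 (fun f : spacetime -> R => f p) (derive_lin c ((1, 0) : spacetime) s1 s2)).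
Qed.

Lemma test_pair_continuous w : test_pair w ->
  (forall k, continuous_periodic T (fun p => w.1 p 0 k)) /\
  (forall i j, continuous_periodic T (fun p => w.2 p i j)).
Proof.
move=> [Psi [tP _ _ ->]]; have sP := test_field_entries tP; split=> [k|i j] /=.
  exact/smooth_periodic_continuous/smooth_periodic_Lop.
under eq_fun do rewrite mxE.
exact/smooth_periodic_continuous/smooth_periodic_derive.
Qed.

Lemma test_pair_sym w p : test_pair w -> (w.2 p)^T = w.2 p.
Proof.
move=> [Psi [[_ _ t] _ _ ->]]; apply/matrixP => i j; rewrite !mxE.
by congr (dt _ p); apply/funext => q; rewrite -[in LHS]t mxE.
Qed.

(** The field [c t I] has no space derivatives, and the only block entering [L] without a
    derivative, Gamma, lies off the diagonal. So [L] annihilates the field, and adding this pair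
    moves the matrix without moving the vector. *)
Lemma test_pair_time c : test_pair (0, fun=> c%:M).
Proof.
have dxt a j : dx j (fun p : spacetime => a * p.1) = (fun=> 0).
  apply/funext => p; rewrite /dx /derive (_ : (fun h => _) = fun=> 0) ?lim_cst//.
  by apply/funext => h /=; rewrite scaler0 add0r subrr scaler0.
have dquot a b p v : h^-1 *: (((fun q : spacetime => a * q.1 + b) \o shift p) (h *: v) -
    (a * p.1 + b)) @[h --> 0^'] --> a * v.1.
  apply: cvg_near_cst; near=> h.
  have h0 : h != 0 by near: h; exact: nbhs_dnbhs_neq.
  rewrite /= /GRing.scale /=; field; exact: h0.
have st a : smooth (fun p : spacetime => a * p.1).
  have iterc s : exists a' b, iterD s (fun p : spacetime => a * p.1) = (fun p => a' * p.1 + b).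
    elim: s => [|v s [a' [b IH]]] /=; first by exists a, 0; apply/funext => p; rewrite addr0.
    exists 0, (a' * v.1); rewrite IH; apply/funext => p; rewrite mul0r add0r.
    by apply: cvg_lim => //; exact: dquot.
  move=> s p _; have [a' [b ->]] := iterc s; split=> [v|].
    by apply/cvg_ex; exists (a' * v.1); exact: dquot.
  apply: cvgD; last exact: cvg_cst.
  by apply: cvgM; [exact: cvg_cst|exact: cvg_fst].
pose Psi (p : spacetime) : 'M[R]_N := (c * p.1)%:M.
have PsiE i j : (fun p => Psi p i j) = (fun p => (c *+ (i == j)) * p.1).
  by apply/funext => p; rewrite !mxE mulrnAl.
have dc0 j : dx j (fun=> 0) = (fun=> 0) :> (spacetime -> R) by exact: derive_cst0.
have LP : Lop nu Psi = 0.
  have dv (f g : 'I_d -> 'I_N) : divx (fun i p => Psi p (f i) (g i)) = fun=> 0.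
    apply/funext => p; rewrite /divx big1// => i _; by rewrite PsiE dxt.
  have sE (f g : 'I_d -> 'I_N) : (fun q => \sum_i Psi q (f i) (g i)) =
      (fun q => (\sum_i c *+ (f i == g i)) * q.1).
    apply/funext => q; rewrite mulr_suml; apply: eq_bigr => i _.
    by rewrite -[LHS]/((fun q => Psi q (f i) (g i)) q) PsiE.
  apply/funext => p; apply/rowP => k; rewrite [RHS]mxE; elim/dimN_ind: k => [j|j||].
  - rewrite Lop_q (dv (fun=> iq j) (@iq d)) (dv (fun=> iG j) (@iG d)) (dv (@iG d) (fun=> ixi)).
    by rewrite (sE (@iG d) (@iG d)) !PsiE !dxt dc0 !mulr0 oppr0 !addr0.
  - by rewrite Lop_G (dv (@iq d) (fun=> ixi)) (sE (@iq d) (@iG d)) dxt dc0 !mulr0 oppr0 addr0.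
  - rewrite Lop_xi (dv (@iq d) (fun=> ixi)) mulr0 oppr0 add0r big1 ?mulr0// => i _.
    by rewrite -[LHS]/((fun q => Psi q (iq i) (iG i)) p) PsiE /iq /iG eq_lrshift mulr0n mul0r.
  - by rewrite Lop_rho (dv (@iq d) (fun=> irho)) oppr0.
exists Psi; split.
- split.
  + by move=> i j; rewrite PsiE.
  + by [].
  + by move=> p; rewrite tr_scalar_mx.
- move=> p _; rewrite LP; apply/rowP => i; rewrite AopE [RHS]mxE.
  have -> : (fun p' => (0 : spacetime -> 'rV[R]_N) p' 0 ixi) = fun=> 0.
    by apply/funext => q; rewrite mxE.
  by rewrite dc0 mxE subr0.
- by move=> x; rewrite /Psi mulr0; apply/matrixP => i j; rewrite !mxE mul0rn.
- rewrite LP; congr pair; apply/funext => p; apply/matrixP => i j; rewrite !mxE PsiE.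
  rewrite (_ : (fun q : spacetime => (c *+ (i == j)) * q.1) =
    fun q => (c *+ (i == j)) * q.1 + 0); last by apply/funext => q; rewrite addr0.
  rewrite /dt /derive; apply/esym/cvg_lim => //; rewrite -[X in _ --> X]mulr1.
  exact: (@dquot _ 0 p (1, 0)).
Unshelve. all: by end_near.
Qed.

End test_fields.

(** * The epigraph of F *)

Section quadratic_forms.
Context {R : realType} {n : nat}.
Implicit Types (A B : 'M[R]_n) (z : 'cV[R]_n).

Definition qform A z : R := (z^T *m A *m z) 0 0.

Lemma qformE A z : qform A z = \sum_i \sum_j z i 0 * A i j * z j 0.
Proof.
rewrite /qform mxE exchange_big; apply: eq_bigr => j _.
by rewrite mxE mulr_suml; apply: eq_bigr => i _; rewrite !mxE.
Qed.

Lemma qformD A B z : qform (A + B) z = qform A z + qform B z.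
Proof. by rewrite /qform mulmxDr mulmxDl mxE. Qed.

Lemma qformZ c A z : qform (c *: A) z = c * qform A z.
Proof. by rewrite /qform -scalemxAr -scalemxAl mxE. Qed.

Lemma qformB A B z : qform (A - B) z = qform A z - qform B z.
Proof. by rewrite qformD -scaleN1r qformZ mulN1r. Qed.

Lemma qform_sum (I : Type) (r : seq I) (A : I -> 'M[R]_n) z :
  qform (\sum_(i <- r) A i) z = \sum_(i <- r) qform (A i) z.
Proof.
elim: r => [|i r IH]; last by rewrite !big_cons qformD IH.
by rewrite !big_nil -(scale0r (0 : 'M[R]_n)) qformZ mul0r.
Qed.

Lemma qform_delta i z : qform (delta_mx i i) z = z i 0 ^+ 2.
Proof.
rewrite qformE (bigD1 i)//= (bigD1 i)//= big1 => [|j ji]; last first.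
  by rewrite mxE eqxx (negbTE ji) mulr0 mul0r.
rewrite big1 => [|k ki]; last first.
  by apply: big1 => j _; rewrite mxE (negbTE ki) mulr0 mul0r.
by rewrite mxE !eqxx mulr1 !addr0 expr2.
Qed.

Lemma qform_scalar c z : qform c%:M z = c * \sum_i z i 0 ^+ 2.
Proof.
rewrite qformE mulr_sumr; apply: eq_bigr => i _.
rewrite (bigD1 i)//= big1 => [|j ji]; last by rewrite mxE eq_sym (negbTE ji) mulr0 mul0r.
by rewrite mxE eqxx addr0 mulr1n expr2; ring.
Qed.

Lemma qform_outer (v : 'rV[R]_n) z : qform (v^T *m v) z = ((v *m z) 0 0) ^+ 2.
Proof.
rewrite /qform mulmxA -trmx_mul -mulmxA mxE big_ord_recl big_ord0 addr0.
by rewrite mxE expr2.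
Qed.

Lemma qform_basis A i : qform A (delta_mx i 0) = A i i.
Proof.
rewrite qformE (bigD1 i)//= (bigD1 i)//= big1 => [|j ji]; last first.
  by rewrite [delta_mx _ _ j _]mxE (negbTE ji) mulr0.
rewrite big1 => [|k ki]; last first.
  by apply: big1 => j _; rewrite [delta_mx _ _ k _]mxE (negbTE ki) !mul0r.
by rewrite !mxE !eqxx mulr1 mul1r !addr0.
Qed.

Lemma sqr_le_sum z i : z i 0 ^+ 2 <= \sum_k z k 0 ^+ 2.
Proof.
rewrite (bigD1 i)//= lerDl; apply: sumr_ge0 => k _; exact: sqr_ge0.
Qed.

Lemma norm_mul_le_sum z i j : `|z i 0| * `|z j 0| <= \sum_k z k 0 ^+ 2.
Proof.
have hi := sqr_le_sum z i; have hj := sqr_le_sum z j.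
rewrite -(real_normK (num_real (z i 0))) in hi.
rewrite -(real_normK (num_real (z j 0))) in hj.
have := sqr_ge0 (`|z i 0| - `|z j 0|).
move: hi hj; set a := `|z i 0|; set b := `|z j 0|; set s := \sum_k _; nra.
Qed.

Lemma qform_norm_le A z c : (forall i j, `|A i j| <= c) ->
  `|qform A z| <= c * n%:R ^+ 2 * \sum_k z k 0 ^+ 2.
Proof.
move=> Ac; rewrite qformE; set s := \sum_k z k 0 ^+ 2.
apply: (@le_trans _ _ (\sum_(i < n) \sum_(j < n) c * s)); last first.
  rewrite !sumr_const !card_ord -mulrnA -[leLHS]mulr_natl natrM expr2.
  by rewrite le_eqVlt; apply/orP; left; apply/eqP; ring.
apply: le_trans (ler_norm_sum _ _ _) _; apply: ler_sum => i _.
apply: le_trans (ler_norm_sum _ _ _) _; apply: ler_sum => j _.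
rewrite !normrM mulrAC mulrC; apply: ler_pM; rewrite ?mulr_ge0 ?normr_ge0//.
exact: norm_mul_le_sum.
Qed.

End quadratic_forms.

Section convexity_of_F.
Context {R : realType} {d : nat}.
Local Notation N := (dimN d).
Local Notation vec := 'rV[R]_N.
Local Notation mat := 'M[R]_N.
Variables (P U : R -> R).
Hypothesis PU : pressure_law d P U.

Let S y := 2 * U y - d%:R * P y - y.

Lemma convex_function_le (f : R -> R) a b x y :
  convex_function (`[0, +oo[%classic : set R^o) f ->
  0 <= a -> 0 <= b -> a + b = 1 -> 0 <= x -> 0 <= y ->
  f (a * x + b * y) <= a * f x + b * f y.
Proof.
move=> cf a0 b0 ab x0 y0.
have a1 : a <= 1 by lra.
have x0' : x \in (`[0, +oo[%classic : set R^o) by rewrite inE /= in_itv/= x0.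
have y0' : y \in (`[0, +oo[%classic : set R^o) by rewrite inE /= in_itv/= y0.
have := cf (Itv01 a0 a1) x y x0' y0'.
have -> : b = 1 - a by lra.
exact.
Qed.

Let P0 : P 0 = 0. Proof. by have [[]] := PU. Qed.

Let convP a b x y : 0 <= a -> 0 <= b -> a + b = 1 -> 0 <= x -> 0 <= y ->
  P (a * x + b * y) <= a * P x + b * P y.
Proof. by have [[_ cP _] _ _ _ _] := PU; exact: convex_function_le. Qed.

Let convS a b x y : 0 <= a -> 0 <= b -> a + b = 1 -> 0 <= x -> 0 <= y ->
  S (a * x + b * y) <= a * S x + b * S y.
Proof.
move=> a0 b0 ab x0 y0; have [_ _ _ cS _] := PU.
by have := convex_function_le cS a0 b0 ab x0 y0; rewrite /S; lra.
Qed.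

Let S_ge0 y : 0 <= y -> 0 <= S y. Proof. by have [_ _ _ _] := PU; exact. Qed.

(* The tangent of the convex function U at y lies below U at 0. *)
Let P_ge0 y : 0 <= y -> 0 <= P y.
Proof.
rewrite le_eqVlt => /orP[/eqP<-|y0]; first by rewrite P0.
have [_ [_ cU sU _] PE _ _] := PU; rewrite PE//.
have yin : (`]0, +oo[%classic : set R^o) y by rewrite /= in_itv/= y0.
have [dU _] := sU [::] y yin.
have cl : h^-1 *: (U (h *: (1 : R^o) + y) - U y) @[h --> 0^'] --> (derive1 U y : R^o).
  by rewrite derive1E; exact: (dU 1).
suff : (U y - U 0) / y <= derive1 U y by rewrite ler_pdivrMr//; lra.
rewrite leNgt; apply/negP => lt_slope.
have : \forall h \near (0 : R)^', h^-1 *: (U (h *: (1 : R^o) + y) - U y) < (U y - U 0) / y.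
  by apply: (cvgr_lt _ cl).
rewrite near_withinE => /nbhs_ballP[e /= e0 he].
(* [(1 - t) * y] lies within [e] of [y], where the difference quotient is supposed to be below the
   slope of the chord from 0 to [y]; convexity of [U] on this chord says the opposite. *)
pose t := Num.min (e / (2 * y)) (1 / 2).
have t0 : 0 < t by rewrite lt_min !divr_gt0// mulr_gt0.
have t1 : t <= 1 / 2 by rewrite ge_min lexx orbT.
have ty : t * y < e.
  apply: (@le_lt_trans _ _ (e / 2)); last by rewrite ltr_pdivrMr// ltr_pMr// ltr1n.
  rewrite -ler_pdivlMr//; apply: le_trans (_ : e / (2 * y) <= _); first by rewrite ge_min lexx.
  by rewrite invfM mulrA.
have ty0 : 0 < t * y by rewrite mulr_gt0.
have := he (- (t * y)); rewrite /ball/= sub0r opprK gtr0_norm// => /(_ ty).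
rewrite oppr_eq0 gt_eqF// => /(_ isT).
have t1' : 0 <= 1 - t by lra.
have tt : t + (1 - t) = 1 by ring.
have := convex_function_le cU (ltW t0) t1' tt (lexx 0) (ltW y0).
have -> : (- (t * y)) *: (1 : R^o) + y = t * 0 + (1 - t) * y by rewrite /GRing.scale/=; ring.
set u := U _ => h1; rewrite /GRing.scale/= invrN mulNr -mulrN opprB mulrC ltr_pdivrMr//.
have -> : (U y - U 0) / y * (t * y) = (U y - U 0) * t by field; rewrite gt_eqF.
lra.
Qed.

(** Joint convexity of [x ^+ 2 / r], including [r = 0], where [0^-1 = 0] is the right value because
    the numerator vanishes too. For positive [r] and [s] the defect is
    [a * b * (x * s - y * r) ^+ 2 / (r * s)], divided by [a * r + b * s]. *)
Let frac_conv (a b x y r s : R) : 0 <= a -> 0 <= b -> 0 <= r -> 0 <= s ->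
  (r = 0 -> x = 0) -> (s = 0 -> y = 0) ->
  (a * x + b * y) ^+ 2 * (a * r + b * s)^-1 <= a * (x ^+ 2 * r^-1) + b * (y ^+ 2 * s^-1).
Proof.
move=> a0 b0 r0 s0 rx sy.
have [r_eq|r_neq] := eqVneq r 0.
  rewrite (rx r_eq) r_eq !mulr0 !add0r expr0n/= mul0r mulr0 add0r.
  have [->|b_neq] := eqVneq b 0; first by rewrite !mul0r expr0n mul0r.
  have [s_eq|s_neq] := eqVneq s 0; first by rewrite (sy s_eq) !mulr0 expr0n/= !mul0r mulr0.
  by rewrite le_eqVlt; apply/orP; left; apply/eqP; field; rewrite s_neq b_neq.
have rp : 0 < r by rewrite lt_neqAle eq_sym r_neq.
have [s_eq|s_neq] := eqVneq s 0.
  rewrite (sy s_eq) s_eq !mulr0 !addr0 expr0n/= mul0r mulr0 addr0.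
  have [->|a_neq] := eqVneq a 0; first by rewrite !mul0r expr0n mul0r.
  by rewrite le_eqVlt; apply/orP; left; apply/eqP; field; rewrite r_neq a_neq.
have sp : 0 < s by rewrite lt_neqAle eq_sym s_neq.
have [ab0|ab_neq] := eqVneq (a * r + b * s) 0.
  by rewrite ab0 invr0 mulr0; apply: addr_ge0; apply: mulr_ge0 => //;
    apply: mulr_ge0; rewrite ?sqr_ge0 ?invr_ge0.
have abp : 0 < a * r + b * s.
  by rewrite lt_neqAle eq_sym ab_neq addr_ge0// mulr_ge0// ltW.
rewrite ler_pdivrMr// -subr_ge0.
rewrite (_ : _ - _ = a * b * (x * s - y * r) ^+ 2 / (r * s)); last first.
  by field; rewrite r_neq s_neq.
apply: mulr_ge0; first by apply: mulr_ge0; [exact: mulr_ge0|exact: sqr_ge0].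
by rewrite invr_ge0; exact: mulr_ge0.
Qed.

Lemma domF_ge0 (v : vec) : domF v -> 0 <= v 0 irho.
Proof. by move=> [/ltW//|->]; rewrite mxE. Qed.

Lemma domF_eq0 (v : vec) : domF v -> v 0 irho = 0 -> v = 0.
Proof. by move=> [+ h|//]; rewrite h ltxx. Qed.

(** One formula for both branches of [F]: at [v = 0] the quotient vanishes, [P 0 = 0], and
    [S 0 = 2 * U 0]. *)
Lemma qformF (v : vec) z : domF v -> qform (F P U v) z =
  ((v *m z) 0 0) ^+ 2 * (v 0 irho)^-1 + P (v 0 irho) * (\sum_(i < d) z (iq i) 0 ^+ 2)
  + S (v 0 irho) * z irho 0 ^+ 2.
Proof.
move=> dv; rewrite /F; case: ifPn => [r0|].
  rewrite !qformD !qformZ qform_outer qform_sum !qform_delta mulr_sumr mulrC.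
  by congr (_ + _ + _); apply: eq_bigr => i _; rewrite qformZ qform_delta.
rewrite -leNgt => r0; have r_eq : v 0 irho = 0.
  by apply/eqP; rewrite eq_le r0 domF_ge0.
rewrite qformZ qform_delta r_eq P0 mul0r addr0 (domF_eq0 dv r_eq) mul0mx mxE.
by rewrite expr0n/= mul0r add0r /S P0; ring.
Qed.

Lemma F_sym (v : vec) : (F P U v)^T = F P U v.
Proof.
rewrite /F; case: ifP => _; last by rewrite linearZ/= trmx_delta.
rewrite !linearD !linearZ/= trmx_mul trmxK trmx_delta linear_sum/=.
by congr (_ + _ + _); apply: eq_bigr => i _; rewrite linearZ/= trmx_delta.
Qed.

Lemma F_diag_ge0 (v : vec) i : domF v -> 0 <= F P U v i i.
Proof.
move=> dv; rewrite -qform_basis qformF//; have r0 := domF_ge0 dv.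
apply: addr_ge0; first apply: addr_ge0.
- by rewrite mulr_ge0 ?sqr_ge0 ?invr_ge0.
- by rewrite mulr_ge0 ?P_ge0//; apply: sumr_ge0 => *; exact: sqr_ge0.
- by rewrite mulr_ge0 ?S_ge0 ?sqr_ge0.
Qed.

Definition epigraph (v : vec) (M : mat) := domF v /\ loewner (F P U v) M.

Lemma epigraphP v M : epigraph v M <->
  [/\ domF v, M^T = M & forall z, qform (F P U v) z <= qform M z].
Proof.
split=> [[dv [t q]]|[dv t q]]; split => //.
- by move: t; rewrite linearB/= F_sym => /(congr1 (+%R^~ (F P U v))); rewrite !subrK.
- by move=> z; have := q z; rewrite -/(qform _ z) qformB subr_ge0.
- split; first by rewrite linearB/= F_sym t.
  by move=> z; rewrite -/(qform _ z) qformB subr_ge0.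
Qed.

Lemma epigraph_trace_ge0 v M : epigraph v M -> 0 <= \tr M.
Proof.
move=> /epigraphP[dv _ q]; rewrite /mxtrace; apply: sumr_ge0 => i _.
by rewrite -qform_basis; apply: le_trans (q _); rewrite qform_basis F_diag_ge0.
Qed.

(** The Löwner order is tested on quadratic forms, and for each [z] the form of [F] is convex in the
    vector: the kinetic term by [frac_conv], the others by convexity of [P] and [S]. *)
Lemma epigraph_convex a b v w M L : 0 <= a -> 0 <= b -> a + b = 1 ->
  epigraph v M -> epigraph w L -> epigraph (a *: v + b *: w) (a *: M + b *: L).
Proof.
move=> a0 b0 ab /epigraphP[dv tM qM] /epigraphP[dw tL qL].
have v0 := domF_ge0 dv; have w0 := domF_ge0 dw.
have rE : (a *: v + b *: w) 0 irho = a * v 0 irho + b * w 0 irho by rewrite !mxE.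
have dvw : domF (a *: v + b *: w).
  have [h|h] := ltP 0 (a * v 0 irho + b * w 0 irho); [by left; rewrite rE|right].
  (* If the combined density vanishes, then in each term the weight or the density is 0, and the
     weighted vector is 0. *)
  have av : a * v 0 irho = 0 by have := mulr_ge0 a0 v0; have := mulr_ge0 b0 w0; lra.
  have bw : b * w 0 irho = 0 by have := mulr_ge0 a0 v0; have := mulr_ge0 b0 w0; lra.
  have -> : a *: v = 0.
    by move/eqP: av; rewrite mulf_eq0 => /orP[/eqP->|/eqP/(domF_eq0 dv)->]; rewrite ?scale0r ?scaler0.
  rewrite add0r.
  by move/eqP: bw; rewrite mulf_eq0 => /orP[/eqP->|/eqP/(domF_eq0 dw)->]; rewrite ?scale0r ?scaler0.
apply/epigraphP; split => //; first by rewrite linearD !linearZ/= tM tL.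
move=> z; rewrite qformD !qformZ.
apply: le_trans (lerD (ler_wpM2l a0 (qM z)) (ler_wpM2l b0 (qL z))).
rewrite !qformF// rE mulmxDl -!scalemxAl.
have -> : (a *: (v *m z) + b *: (w *m z)) 0 0 = a * (v *m z) 0 0 + b * (w *m z) 0 0.
  by rewrite !mxE.
have zero u : domF u -> u 0 irho = 0 -> (u *m z) 0 0 = 0.
  by move=> du /(domF_eq0 du) ->; rewrite mul0mx mxE.
have h1 := frac_conv a0 b0 v0 w0 (zero v dv) (zero w dw).
have hz : 0 <= \sum_(i < d) z (iq i) 0 ^+ 2 by apply: sumr_ge0 => *; exact: sqr_ge0.
have h2 := ler_wpM2r hz (convP a0 b0 ab v0 w0).
have h3 := ler_wpM2r (sqr_ge0 (z irho 0)) (convS a0 b0 ab v0 w0).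
lra.
Qed.

Lemma epigraph_addr v M A : epigraph v M -> psd A -> epigraph v (M + A).
Proof.
move=> /epigraphP[dv tM qM] [tA qA]; apply/epigraphP; split => //.
  by rewrite linearD/= tM tA.
by move=> z; rewrite qformD; have := qM z; have := qA z; rewrite -/(qform A z); lra.
Qed.

Lemma epigraph_interior rmin b : 0 < rmin -> exists e C, 0 < e /\
  forall (u v : vec) (M : mat), rmin <= u 0 irho -> (forall k, `|u 0 k| <= b) ->
    (forall k, `|v 0 k - u 0 k| <= e) -> M^T = M ->
    (forall i j, `|M i j - (C%:M : mat) i j| <= e) -> epigraph v M.
Proof.
move=> r0; pose e := Num.min (rmin / 2) 1; have e0 : 0 < e by rewrite lt_min divr_gt0//=.
have e1 : e <= 1 by rewrite ge_min lexx orbT.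
have e2 : e <= rmin / 2 by rewrite ge_min lexx.
pose b1 := `|b| + 1.
(* The summands pay, in order, for the deviation of [M] from [C I], for the kinetic term with
   density at least [rmin / 2] and entries at most [b1], and for [P] and [S] on [[0, b1]], where
   convexity bounds them through their values at 0 and [b1]. *)
pose C := e * N%:R ^+ 2 + 2 / rmin * (b1 ^+ 2 * N%:R ^+ 2) + P b1 * d%:R + (S 0 + S b1).
have b10 : 0 < b1 by rewrite ltr_wpDl.
exists e, C; split => // u v M ur ub uv tM MC.
have vb k : `|v 0 k| <= b1.
  have -> : v 0 k = u 0 k + (v 0 k - u 0 k) by ring.
  apply: le_trans (ler_normD _ _) _; have := ub k; have := uv k; have := ler_norm b.
  rewrite /b1; lra.
have vr : rmin / 2 <= v 0 irho by have := uv irho; rewrite ler_norml; lra.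
have vp : 0 < v 0 irho by apply: lt_le_trans vr; rewrite divr_gt0.
have vb' : v 0 irho <= b1 by apply: le_trans (ler_norm _) (vb _).
have dv : domF v by left.
apply/epigraphP; split => // z; rewrite qformF//; set s := \sum_k z k 0 ^+ 2.
have s0 : 0 <= s by apply: sumr_ge0 => *; exact: sqr_ge0.
pose t := v 0 irho / b1.
have t01 : 0 <= t <= 1 by rewrite divr_ge0 ?ler_pdivrMr ?mul1r ?vb' ?(ltW vp) ?(ltW b10).
have vt : v 0 irho = (1 - t) * 0 + t * b1 by rewrite mulr0 add0r divfK// gt_eqF.
have /andP[t0 t1] := t01.
have PP : P (v 0 irho) <= P b1.
  have := @convP (1 - t) t 0 b1; rewrite -vt P0 mulr0 add0r => h.
  apply: le_trans (h _ _ _ _ _) _; [lra|lra|lra|lra|lra|].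
  by rewrite ler_piMl// P_ge0// ltW.
have SS : S (v 0 irho) <= S 0 + S b1.
  have := @convS (1 - t) t 0 b1; rewrite -vt => h.
  apply: le_trans (h _ _ _ _ _) _; [lra|lra|lra|lra|lra|].
  by apply: lerD; rewrite ler_piMl ?S_ge0 ?(ltW b10)//; lra.
have h1 : ((v *m z) 0 0) ^+ 2 * (v 0 irho)^-1 <= 2 / rmin * (b1 ^+ 2 * N%:R ^+ 2) * s.
  have a1 : ((v *m z) 0 0) ^+ 2 <= b1 ^+ 2 * N%:R ^+ 2 * s.
    rewrite -qform_outer; apply: le_trans (ler_norm _) _; apply: qform_norm_le => i j.
    rewrite mxE big_ord_recl big_ord0 addr0 mxE normrM expr2.
    by apply: ler_pM.
  have a2 : (v 0 irho)^-1 <= 2 / rmin.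
    by rewrite -[2 / rmin]invrK lef_pV2 ?posrE ?invr_gt0 ?divr_gt0// invfM invrK mulrC.
  rewrite -mulrA mulrC; apply: ler_pM => //; first by rewrite invr_ge0 ltW.
  exact: sqr_ge0.
have h2 : P (v 0 irho) * (\sum_(i < d) z (iq i) 0 ^+ 2) <= P b1 * d%:R * s.
  rewrite -mulrA; apply: ler_pM => //.
  - by apply: P_ge0; exact: ltW.
  - by apply: sumr_ge0 => *; exact: sqr_ge0.
  - apply: (@le_trans _ _ (\sum_(i < d) s)).
      by apply: ler_sum => i _; exact: sqr_le_sum.
    by rewrite sumr_const card_ord mulr_natl.
have h3 : S (v 0 irho) * z irho 0 ^+ 2 <= (S 0 + S b1) * s.
  apply: ler_pM => //; [by apply: S_ge0; exact: ltW|exact: sqr_ge0|exact: sqr_le_sum].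
have h4 : C * s - e * N%:R ^+ 2 * s <= qform M z.
  have -> : M = C%:M + (M - C%:M) by rewrite addrC subrK.
  rewrite qformD qform_scalar -/s.
  have : `|qform (M - C%:M) z| <= e * N%:R ^+ 2 * s.
    apply: qform_norm_le => i j; have := MC i j.
    by rewrite [(M - C%:M) i j]mxE [(- C%:M) i j]mxE.
  rewrite ler_norml; lra.
apply: le_trans h4; apply: le_trans (lerD (lerD h1 h2) h3) _.
by rewrite /C le_eqVlt; apply/orP; left; apply/eqP; ring.
Qed.

End convexity_of_F.

(** * Pairings with charges *)

Section pairings.
Context {R : realType} {d : nat}.
Local Notation N := (dimN d).
Local Notation X := (Xd (R := R) (d := d)).
Local Notation spacetime := (R * 'rV[R]_d)%type.
Variables (T : R) (T0 : 0 < T).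
Local Notation D := (domain T : set X).
Local Notation cper := (continuous_periodic T).

Let mD : measurable D := measurable_domain T.

(** Indexed by [bool], so that both Jordan parts can join the finite family of [L1_density]. *)
Lemma charge_decomp (nu : {charge set X -> \bar R}) :
  exists m : bool -> {finite_measure set X -> \bar R},
    forall A, measurable A -> (nu A = m true A - m false A)%E.
Proof.
have [Q [Q' PN]] := Hahn_decomposition nu.
exists (fun b => if b then (jordan_pos PN : {finite_measure set X -> \bar R})
  else jordan_neg PN) => A mA.
by rewrite (jordan_decomp PN mA) caddNE.
Qed.

Let fin_D (m : {finite_measure set X -> \bar R}) : (m D < +oo)%E.
Proof. by rewrite ltey_eq fin_num_measure. Qed.

Lemma charge_integral_eq (nu : {charge set X -> \bar R}) f g :
  (forall p, D p -> f p = g p) -> charge_integral nu D f = charge_integral nu D g.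
Proof.
move=> fg; rewrite /charge_integral.
by congr (_ - _); apply: eq_Rintegral => p; rewrite inE => /fg.
Qed.

Lemma charge_integral_lin (nu : {charge set X -> \bar R}) c f g :
  bounded_measurable D f -> bounded_measurable D g ->
  charge_integral nu D (fun p => c * f p + g p) =
  c * charge_integral nu D f + charge_integral nu D g.
Proof.
move=> bf bg; have [m mE] := charge_decomp nu.
have bcf := bounded_measurableZ c bf.
rewrite !(charge_integralE (m1 := m true) (m2 := m false))//; last exact: bounded_measurableD.
have itg b f' (bf' : bounded_measurable D f') := bounded_measurable_integrable mD (fin_D (m b)) bf'.
rewrite !RintegralD//; [|exact: itg..].
by rewrite !RintegralZl//; [ring|exact: itg..].
Qed.

Lemma charge_integral_czero f : bounded_measurable D f ->
  charge_integral (czero : {charge set X -> \bar R}) D f = 0.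
Proof.
move=> bf; have [m _] := charge_decomp czero.
rewrite (charge_integralE (m1 := m true) (m2 := m true)) ?subrr// => A mA.
by rewrite subee// fin_num_measure.
Qed.

Lemma continuous_periodic_entry m n (M : spacetime -> 'M[R]_(m, n)) i j :
  cper M -> cper (fun p => M p i j).
Proof.
move=> cM; apply: (@continuous_periodic_comp _ _ _ _ _ M (fun A : 'M[R]_(m, n) => A i j)) => //.
exact: coord_continuous.
Qed.

Lemma continuous_periodic_mx m n (M : spacetime -> 'M[R]_(m, n)) :
  (forall i j, cper (fun p => M p i j)) -> cper M.
Proof.
move=> cM; rewrite (_ : M = fun p => \sum_i \sum_j M p i j *: delta_mx i j); last first.
  by apply/funext => p; exact: matrix_sum_delta.
apply: continuous_periodic_sum => i; apply: continuous_periodic_sum => j.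
have [c pM] := cM i j; split; last by move=> t x k /=; rewrite pM.
by move=> p; apply: cvgZl; exact: c.
Qed.

Lemma vpairing_eq (v w : spacetime -> 'rV[R]_N) (E : vmeasure) :
  (forall p, slab T p -> v p = w p) -> vpairing T v E = vpairing T w E.
Proof.
move=> vw; apply: eq_bigr => i _; apply: charge_integral_eq => p [pT _].
by rewrite vw.
Qed.

Lemma mpairing_eq (M L : spacetime -> 'M[R]_N) (B : mmeasure) :
  (forall p, slab T p -> M p = L p) -> mpairing T M B = mpairing T L B.
Proof.
move=> ML; apply: eq_bigr => i _; apply: eq_bigr => j _.
by apply: charge_integral_eq => p [pT _]; rewrite ML.
Qed.

Lemma vpairingB (v w : spacetime -> 'rV[R]_N) (E : vmeasure) : cper v -> cper w ->
  vpairing T (fun p => v p - w p) E = vpairing T v E - vpairing T w E.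
Proof.
move=> cv cw; rewrite /vpairing -sumrB; apply: eq_bigr => i _.
have bv := bounded_measurable_point T0 (continuous_periodic_entry 0 i cv).
have bw := bounded_measurable_point T0 (continuous_periodic_entry 0 i cw).
rewrite addrC -mulN1r -charge_integral_lin//.
by apply: charge_integral_eq => p _; rewrite !mxE; ring.
Qed.

Lemma dxdt_fin : ((dxdt (R := R) (d := d)) D < +oo)%E.
Proof.
have mI : measurable (`[0, T]%classic : set (measurableTypeR R)) by exact: measurable_itv.
apply: (@le_lt_trans _ _ ((dxdt (R := R) (d := d)) (`[0, T]%classic `*` setT))).
  apply: le_measure; rewrite ?inE//; first exact: measurableX.
  by move=> p [pT _]; split => //=; rewrite in_itv.
have finI : lebesgue_measure (`[0, T]%classic : set R) \is a fin_num.
  by rewrite lebesgue_measure_itv/=; case: ifP.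
rewrite /dxdt product_measure1E//; apply: lte_mul_pinfty; [exact: measure_ge0|exact: finI|].
by rewrite ltey_eq fin_num_measure.
Qed.

Let dist_sub (a b c e r : R) : `|a - c| <= r -> `|b - e| <= r ->
  `|a - b - (c - e)| <= 2 * r.
Proof. by rewrite !ler_norml; lra. Qed.

Lemma weighted_psd_continuous (h : R -> R) (B : mmeasure) : continuous h ->
  is_sym_mmeasure T B ->
  (forall (g : spacetime -> R) (z : 'cV[R]_N), cper g -> (forall p, 0 <= g p) ->
    0 <= Rintegral dxdt D (fun p => h p.1 * g (point p)) * (\sum_i z i 0 ^+ 2)
      + 2 * \sum_i \sum_j z i 0 * charge_integral (B i j) D (fun p => g (point p)) * z j 0) ->
  weighted_psd T h B.
Proof.
move=> ch [carB symB] pos A mA AD.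
pose H := Rintegral dxdt A (fun p => h p.1).
split.
  rewrite linearD linearZ/= tr_scalar_mx; congr (_ + _ *: _).
  by apply/matrixP => i j; rewrite !mxE symB.
move=> z; rewrite -/(qform _ z) qformD qformZ qform_scalar -/H.
have ex ij : exists m : bool -> {finite_measure set X -> \bar R},
    forall A, measurable A -> (B ij.1 ij.2 A = m true A - m false A)%E.
  exact: charge_decomp.
have [m mE] := choice ex.
(* [None] stands for [dxdt], the other indices for the two Jordan parts of each entry of [B]. *)
pose fam (i : option (('I_N * 'I_N) * bool)) : {measure set X -> \bar R} :=
  if i is Some (ij, b) then (m ij b : {measure set X -> \bar R}) else dxdt.
have famy i : (fam i D < +oo)%E.
  by case: i => [[ij b]|]; [exact: fin_D|exact: dxdt_fin].
have chp : cper (fun p : spacetime => h p.1).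
  exact: (continuous_periodic_comp ch (continuous_periodic_time T)).
have [Hb hHb] := continuous_periodic_bounded T0 chp.
have bh : bounded_measurable D (fun p : X => h p.1).
  exact: (bounded_measurable_point T0 chp).
have bA : bounded_measurable D (\1_A : X -> R) by exact: bounded_measurable_indic.
have AD' : A `&` D = A by apply/setIidPl.
set s := \sum_i z i 0 ^+ 2.
have s0 : 0 <= s by apply: sumr_ge0 => *; exact: sqr_ge0.
pose S2 := \sum_i \sum_j `|z i 0| * 2 * `|z j 0|.
(* [Kc * e] bounds the total error: the first term comes from the weight, the second from [B], whose
   entries contribute [2 * e] each, one [e] per Jordan part. *)
pose Kc := `|Hb| * s + 2 * S2.
apply/ler_addgt0Pr => e0 e00.
have Kc0 : 0 <= Kc.
  rewrite /Kc /S2 addr_ge0 ?mulr_ge0//; apply: sumr_ge0 => i _; apply: sumr_ge0 => j _.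
  by rewrite !mulr_ge0.
pose e := e0 / (Kc + 1); have e_gt0 : 0 < e by rewrite divr_gt0// ltr_wpDl.
have [_ /(_ _ e_gt0)[g [cg g01 ge]]] := L1_density T0 famy mA.
have bg := bounded_measurable_point T0 cg.
have := pos g z cg (fun p => proj1 (andP (g01 p))); rewrite -/s.
set G := Rintegral _ _ _; set GB := \sum_i _ => posg.
have bgA : bounded_measurable D (fun p : X => `|g (point p) - \1_A p|).
  by apply: bounded_measurable_norm; exact: bounded_measurableB.
have dxit f (bf : bounded_measurable D f) := bounded_measurable_integrable mD dxdt_fin bf.
have dH : `|G - H| <= `|Hb| * e.
  have bhg : bounded_measurable D (fun p : X => h p.1 * g (point p)).
    exact: (bounded_measurable_point T0 (continuous_periodicM chp cg)).
  have bhA : bounded_measurable D (fun p : X => h p.1 * \1_A p).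
    split; first by apply: measurable_funM; [exact: bh.1|exact: bA.1].
    have [_ [C1 hC1]] := bh; have [_ [C2 hC2]] := bA; exists (C1 * C2) => p pD.
    by rewrite normrM; apply: ler_pM => //; [exact: hC1|exact: hC2].
  have -> : H = Rintegral dxdt D (fun p => h p.1 * \1_A p).
    rewrite /H -[in LHS]AD' setIC Rintegral_mkcondr; apply: eq_Rintegral => p _.
    by rewrite patchE indicE; case: (p \in A); rewrite ?mulr1 ?mulr0.
  apply: le_trans (Rintegral_dist_le mD dxdt_fin bhg bhA) _.
  apply: le_trans (ler_wpM2l (normr_ge0 Hb) (ge None)).
  rewrite /= -RintegralZl//; last exact: dxit.
  apply: le_Rintegral => //.
  - by apply/dxit/bounded_measurable_norm/bounded_measurableB.
  - by apply/dxit/bounded_measurableZ.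
  - move=> p [pT _]; rewrite -mulrBr normrM ler_wpM2r//.
    exact: le_trans (hHb (point p) pT) (ler_norm _).
have dci i j : `|charge_integral (B i j) D (fun p => g (point p)) - fine (B i j A)| <= 2 * e.
  rewrite (charge_integralE (m1 := m (i, j) true) (m2 := m (i, j) false))//; last first.
    exact: (mE (i, j)).
  have -> : fine (B i j A) = Rintegral (m (i, j) true) D \1_A - Rintegral (m (i, j) false) D \1_A.
    rewrite !Rintegral_indic// AD' (mE (i, j) A mA) -fineB//; exact: fin_num_measure.
  have dm b : `|Rintegral (m (i, j) b) D (fun p => g (point p)) - Rintegral (m (i, j) b) D \1_A| <= e.
    exact: le_trans (Rintegral_dist_le mD (fin_D _) bg bA) (ge (Some ((i, j), b))).
  exact: dist_sub (dm true) (dm false).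
have dB : `|GB - qform (\matrix_(i, j) fine (B i j A)) z| <=
    S2 * e.
  rewrite qformE /GB /S2 -sumrB mulr_suml; apply: le_trans (ler_norm_sum _ _ _) _.
  apply: ler_sum => i _; rewrite -sumrB mulr_suml; apply: le_trans (ler_norm_sum _ _ _) _.
  apply: ler_sum => j _; rewrite mxE -mulrBl -mulrBr !normrM.
  rewrite (_ : _ * 2 * _ * e = `|z i 0| * (2 * e) * `|z j 0|); last by ring.
  by rewrite ler_wpM2r// ler_wpM2l.
have HsG : G * s <= H * s + `|Hb| * e * s.
  by rewrite -mulrDl ler_wpM2r//; move: dH; rewrite ler_norml; lra.
have eK : Kc * e <= e0.
  rewrite /e mulrCA ler_piMr ?(ltW e00)// ler_pdivrMr ?ltr_wpDl// mul1r; lra.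
move: dB eK; rewrite ler_norml /Kc => /andP[_ dB] eK.
move: posg HsG dB eK; lra.
Qed.

End pairings.

(** * Exact penalization and separation *)

Lemma ereal_inf_shift (R : realType) (S : set R) (a : R) :
  ereal_inf [set (a + x)%:E | x in S] = (a%:E + ereal_inf [set x%:E | x in S])%E.
Proof.
have key (b : R) (S' : set R) :
    (b%:E + ereal_inf [set x%:E | x in S'] <= ereal_inf [set (b + x)%:E | x in S'])%E.
  apply: le_ereal_inf_tmp => _ [x Sx <-]; rewrite EFinD leeD2l//.
  by apply: ereal_inf_lbound; exists x.
apply/eqP; rewrite eq_le key andbT.
(* The reverse inequality is [key] for the opposite shift. *)
have := key (- a) [set a + x | x in S].
rewrite (_ : [set (- a + x)%:E | x in [set a + x | x in S]] = [set x%:E | x in S]); last first.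
  apply/seteqP; split => [_ [_ [x Sx <-] <-]|_ [x Sx <-]]; first by exists x; rewrite // addKr.
  by exists (a + x); [exists x|rewrite addKr].
rewrite (_ : [set x%:E | x in [set a + x | x in S]] = [set (a + x)%:E | x in S]); last first.
  apply/seteqP; split => [_ [_ [x Sx <-] <-]|_ [x Sx <-]]; first by exists x.
  by exists (a + x) => //; exists x.
by rewrite EFinN addeC leeBlDr// addeC.
Qed.

Section duality.
Context {R : realType} {d : nat}.
Local Notation N := (dimN d).
Local Notation X := (Xd (R := R) (d := d)).
Local Notation spacetime := (R * 'rV[R]_d)%type.
Local Notation vec := 'rV[R]_N.
Local Notation mat := 'M[R]_N.
Variables (T nu : R) (P U h : R -> R) (v0 : 'rV[R]_d -> vec).
Hypotheses (T0 : 0 < T) (PU : pressure_law d P U) (hw : weight T h) (v0i : initial_datum nu v0).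
Local Notation D := (domain T : set X).
Local Notation cper := (continuous_periodic T).
Let Y : lmodType R := ((spacetime -> vec) * (spacetime -> mat))%type.
Implicit Types (y k w : Y) (r c eta : R).

(** Values off the slab are ignored, so [slab_norm] is only a seminorm. No continuity is asked: the
    Riesz representation evaluates the functional on discontinuous pairs. *)
Definition norm_le (y : (spacetime -> vec) * (spacetime -> mat)) (eta : R) :=
  forall p, slab T p -> (forall i, `|y.1 p 0 i| <= eta) /\ (forall i j, `|y.2 p i j| <= eta).

Definition slab_bounded (y : (spacetime -> vec) * (spacetime -> mat)) :=
  exists eta, norm_le y eta.

Definition slab_norm (y : (spacetime -> vec) * (spacetime -> mat)) : R :=
  inf [set eta | 0 <= eta /\ norm_le y eta].

Lemma norm_leW y eta eta' : eta <= eta' -> norm_le y eta -> norm_le y eta'.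
Proof.
by move=> le ne p pT; have [h1 h2] := ne p pT; split=> *; apply: le_trans le.
Qed.

Lemma norm_leD y y' eta eta' : norm_le y eta -> norm_le y' eta' -> norm_le (y + y') (eta + eta').
Proof.
move=> ne ne' p pT; have [h1 h2] := ne p pT; have [h1' h2'] := ne' p pT.
by split=> *; rewrite mxE; apply: le_trans (ler_normD _ _) _; apply: lerD.
Qed.

Lemma norm_leZ c y eta : norm_le y eta -> norm_le (c *: y) (`|c| * eta).
Proof.
move=> ne p pT; have [h1 h2] := ne p pT.
by split=> *; rewrite mxE normrM ler_wpM2l.
Qed.

Lemma norm_le0 : norm_le 0 0.
Proof. by move=> p _; split=> *; rewrite mxE normr0. Qed.

Lemma norm_leP y : slab_bounded y -> norm_le y (slab_norm y).
Proof.
move=> [C hC].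
have E0 : [set eta | 0 <= eta /\ norm_le y eta] !=set0.
  by exists `|C|; split => //; apply: norm_leW hC; exact: ler_norm.
by move=> p pT; split=> *; apply: lb_le_inf => // e [_ /(_ p pT)[h1 h2]].
Qed.

Let norm_lbound y : has_lbound [set eta | 0 <= eta /\ norm_le y eta].
Proof. by exists 0 => e []. Qed.

Lemma slab_norm_le y eta : 0 <= eta -> norm_le y eta -> slab_norm y <= eta.
Proof. by move=> e0 ne; apply: ge_inf. Qed.

Lemma slab_norm_ge0 y : slab_bounded y -> 0 <= slab_norm y.
Proof.
move=> [C hC]; apply: lb_le_inf; last by move=> e [].
by exists `|C|; split => //; apply: norm_leW hC; exact: ler_norm.
Qed.

Lemma slab_boundedD y y' : slab_bounded y -> slab_bounded y' -> slab_bounded (y + y').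
Proof. by move=> [e ne] [e' ne']; exists (e + e'); exact: norm_leD. Qed.

Lemma slab_boundedZ c y : slab_bounded y -> slab_bounded (c *: y).
Proof. by move=> [e ne]; exists (`|c| * e); exact: norm_leZ. Qed.

Lemma slab_bounded0 : slab_bounded 0.
Proof. by exists 0; exact: norm_le0. Qed.

Lemma slab_normD y y' : slab_bounded y -> slab_bounded y' ->
  slab_norm (y + y') <= slab_norm y + slab_norm y'.
Proof.
move=> by_ by'; apply: slab_norm_le; first by rewrite addr_ge0// slab_norm_ge0.
by apply: norm_leD; exact: norm_leP.
Qed.

Lemma slab_normZ c y : slab_bounded y -> slab_norm (c *: y) <= `|c| * slab_norm y.
Proof.
move=> by_; apply: slab_norm_le; first by rewrite mulr_ge0// slab_norm_ge0.
by apply: norm_leZ; exact: norm_leP.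
Qed.

Definition feasible (k : (spacetime -> vec) * (spacetime -> mat)) := primal_pair T P U k.1 k.2.

Lemma feasibleP k : feasible k <->
  [/\ cper k.1, cper k.2 & forall p, slab T p -> epigraph P U (k.1 p) (k.2 p)].
Proof.
split; first by move=> [c1 c2 t ep].
move=> [c1 c2 ep]; split => // p pT; first by have /epigraphP[] := ep p pT.
Qed.

Lemma cper_slab_bounded y : cper y.1 -> cper y.2 -> slab_bounded y.
Proof.
move=> c1 c2.
have [b1 hb1] : exists b, forall p, slab T p -> forall i, `|y.1 p 0 i| <= b.
  have ex i := continuous_periodic_bounded T0 (continuous_periodic_entry 0 i c1).
  have [b hb] := choice ex; exists (\sum_i `|b i|) => p pT i.
  rewrite (bigD1 i)//=; apply: le_trans (hb i p pT) _; apply: le_trans (ler_norm _) _.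
  by rewrite lerDl sumr_ge0.
have [b2 hb2] : exists b, forall p, slab T p -> forall i, `|y.2 p i.1 i.2| <= b.
  have ex (i : 'I_N * 'I_N) :=
    continuous_periodic_bounded T0 (continuous_periodic_entry i.1 i.2 c2).
  have [b hb] := choice ex; exists (\sum_i `|b i|) => p pT i.
  rewrite (bigD1 i)//=; apply: le_trans (hb i p pT) _; apply: le_trans (ler_norm _) _.
  by rewrite lerDl sumr_ge0.
exists (`|b1| + `|b2|) => p pT; split=> [i|i j].
  by apply: le_trans (hb1 p pT i) _; apply: ler_wpDr => //; exact: ler_norm.
by apply: le_trans (hb2 p pT (i, j)) _; apply: ler_wpDl => //; exact: ler_norm.
Qed.

Let vb : Y := (fun p => v0 p.2, 0).

Let cper_vb : cper vb.1 /\ cper vb.2.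
Proof.
have [[cv pv] _ _ _] := v0i; split; last exact: continuous_periodic_cst.
split; last by move=> t x j /=; rewrite pv.
apply: continuous_subspaceT => p; apply: continuous_comp; first exact: cvg_snd.
exact: cv.
Qed.

Let cper_h : cper (fun p : spacetime => h p.1).
Proof.
have [sh _] := hw.
exact: (continuous_periodic_comp (smooth_continuous sh) (continuous_periodic_time T)).
Qed.

Definition cost (k : (spacetime -> vec) * (spacetime -> mat)) : R :=
  2^-1 * Rintegral dxdt D (fun p => h p.1 * \tr (k.2 (point p))).

Let cper_trace (M : spacetime -> mat) : cper M -> cper (fun p => h p.1 * \tr (M p)).
Proof.
move=> cM; apply: continuous_periodicM; first exact: cper_h.
by apply: continuous_periodic_sum => i; exact: continuous_periodic_entry.
Qed.

Let itg f (bf : bounded_measurable D f) :=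
  bounded_measurable_integrable (measurable_domain T) (dxdt_fin (d := d) T) bf.

Lemma cost_lin a b k k' : cper k.2 -> cper k'.2 ->
  cost (a *: k + b *: k') = a * cost k + b * cost k'.
Proof.
move=> c c'; have bm1 := bounded_measurable_point T0 (cper_trace c).
have bm2 := bounded_measurable_point T0 (cper_trace c').
rewrite /cost mulrCA [b * _]mulrCA -mulrDr; congr (_ * _).
have mD := measurable_domain (R := R) (d := d) T.
rewrite -!RintegralZl//; [|exact: itg..]; rewrite -RintegralD//; last 2 first.
- by apply/itg/bounded_measurableZ.
- by apply/itg/bounded_measurableZ.
apply: eq_Rintegral => p _.
have -> : (a *: k + b *: k').2 (point p) = a *: k.2 (point p) + b *: k'.2 (point p) by [].
by rewrite linearD !linearZ/=; ring.
Qed.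

Let h_ge0 t : 0 <= t <= T -> 0 <= h t.
Proof. by move=> tT; have [_ [m [M [m0 /(_ t tT)/andP[mh _]]]]] := hw; apply: le_trans mh; exact: ltW. Qed.

Lemma cost_ge0 k : feasible k -> 0 <= cost k.
Proof.
move=> /feasibleP[_ _ ep]; rewrite /cost mulr_ge0// ?invr_ge0//.
apply: Rintegral_ge0 => p [pT _]; rewrite mulr_ge0 ?h_ge0//.
exact: (epigraph_trace_ge0 PU (ep (point p) pT)).
Qed.

Lemma cost_le b : exists c, forall k, cper k.2 -> (forall p, slab T p -> forall i, `|k.2 p i i| <= b) ->
  cost k <= c.
Proof.
pose L (p : spacetime) := h p.1 * (b * N%:R).
have cL : cper L.
  by apply: continuous_periodicM; [exact: cper_h|exact: continuous_periodic_cst].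
have bL := bounded_measurable_point T0 cL.
exists (2^-1 * Rintegral dxdt D (fun p => L (point p))) => k ck kb.
rewrite /cost ler_wpM2l ?invr_ge0//; apply: le_Rintegral => //.
- exact: measurable_domain.
- exact: itg (bounded_measurable_point T0 (cper_trace ck)).
- exact: itg bL.
- move=> p [pT _]; rewrite /L ler_wpM2l ?h_ge0//.
  apply: le_trans (ler_norm _) _; apply: le_trans (ler_norm_sum _ _ _) _.
  apply: (@le_trans _ _ (\sum_(i < N) b)); last by rewrite sumr_const card_ord mulr_natr.
  by apply: ler_sum => i _; exact: (kb (point p)).
Qed.

Lemma feasible_convex a b k k' : 0 <= a -> 0 <= b -> a + b = 1 ->
  feasible k -> feasible k' -> feasible (a *: k + b *: k').
Proof.
move=> a0 b0 ab /feasibleP[c1 c2 ep] /feasibleP[c1' c2' ep']; apply/feasibleP; split.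
- by apply: continuous_periodicD; exact: continuous_periodicZ.
- by apply: continuous_periodicD; exact: continuous_periodicZ.
- by move=> p pT; apply: (epigraph_convex PU) => //; [exact: ep|exact: ep'].
Qed.

Lemma slater : exists e C, 0 < e /\ forall y,
  cper y.1 -> cper y.2 -> (forall p, slab T p -> (y.2 p)^T = y.2 p) ->
  norm_le (y - ((fun p => v0 p.2), (fun=> C%:M))) e -> feasible y.
Proof.
have [c1 _] := cper_vb; have [_ v0p _ _] := v0i.
have cr := continuous_periodic_entry 0 irho c1.
(* An upper bound of the continuous periodic function [1 / rho_0] is a positive lower bound of
   [rho_0]. *)
have cir : cper (fun p : spacetime => (v0 p.2 0 irho)^-1).
  split; last by move=> t x j /=; have [[_ ->]] := v0i.
  move=> p; apply: cvgV; first by rewrite gt_eqF.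
  exact: cr.1.
have [m hm] := continuous_periodic_bounded T0 cir.
have [b hb] := cper_slab_bounded c1 (@continuous_periodic_cst _ _ T _ (0 : mat)).
have rmin : 0 < (`|m| + 1)^-1 by rewrite invr_gt0 ltr_wpDl.
have [e [C [e0 epi]]] := epigraph_interior PU b rmin.
exists e, C; split => // y cy1 cy2 ty ny; apply/feasibleP; split => // p pT.
have [n1 n2] := ny p pT; apply: (epi (v0 p.2)).
- rewrite -[leRHS]invrK lef_pV2 ?posrE ?invr_gt0 ?ltr_wpDl//.
  by have := le_trans (ler_norm _) (hm p pT); have := ler_norm m; lra.
- by move=> i; have [] := hb p pT.
- by move=> i; have := n1 i; rewrite !mxE.
- exact: ty.
- by move=> i j; have := n2 i j; rewrite !mxE.
Qed.

Let cper_test w : test_pair T nu w -> cper w.1 /\ cper w.2.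
Proof.
move=> tw; have [c1 c2] := test_pair_continuous tw; split; last exact: continuous_periodic_mx.
by apply: continuous_periodic_mx => i j; rewrite ord1.
Qed.

Let test0 : test_pair T nu (0 : Y).
Proof.
have t0 := test_pair_time (d := d) T nu 0; have := test_pair_lin (- 1) t0 t0.
by rewrite scaleN1r addNr.
Qed.

Let testZ c w : test_pair T nu w -> test_pair T nu (c *: w).
Proof. by move=> tw; have := test_pair_lin c tw test0; rewrite addr0. Qed.

Let testD w w' : test_pair T nu w -> test_pair T nu w' -> test_pair T nu (w + w').
Proof. by move=> tw tw'; have := test_pair_lin 1 tw tw'; rewrite scale1r. Qed.

(** [norm_le _ 0] is equality on the slab; the fields are free elsewhere. *)
Definition attained : set R :=
  [set r | exists k w, [/\ feasible k, test_pair T nu w,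
    norm_le (k - ((fun p => v0 p.2), 0) - w) 0 & r = cost k]].

Let attained_lb : lbound attained 0.
Proof. by move=> _ [k [w [fk _ _ ->]]]; exact: cost_ge0. Qed.

Lemma slater_point : exists e C, [/\ 0 < e,
    feasible (((fun p => v0 p.2), (fun=> C%:M)) : Y) /\
    attained (cost ((fun p => v0 p.2), (fun=> C%:M))) &
  forall y, cper y.1 -> cper y.2 -> (forall p, slab T p -> (y.2 p)^T = y.2 p) ->
    norm_le (y - ((fun p => v0 p.2), (fun=> C%:M))) e -> feasible y].
Proof.
have [e [C [e0 sl]]] := slater; exists e, C; split => //.
set k0 : Y := ((fun p => v0 p.2), (fun=> C%:M)).
have fk0 : feasible k0.
  apply: sl.
  - exact: cper_vb.1.
  - exact: continuous_periodic_cst.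
  - by move=> p _; rewrite /k0/= tr_scalar_mx.
  - by rewrite subrr; apply: norm_leW norm_le0; exact: ltW.
split => //; exists k0, (0, fun=> C%:M); split => //; first exact: test_pair_time.
move=> p _; split=> [i|i j].
  have -> : (k0 - vb - (0, fun=> C%:M)).1 p 0 i = v0 p.2 0 i - v0 p.2 0 i - 0 by rewrite !mxE.
  by rewrite subrr subrr normr0.
have -> : (k0 - vb - (0, fun=> C%:M)).2 p i j = (C%:M : mat) i j - 0 - (C%:M : mat) i j by rewrite !mxE.
by rewrite subr0 subrr normr0.
Qed.

Let I0 := inf attained.

Let attained_neq0 : attained !=set0.
Proof. by have [e [C [_ [_ a] _]]] := slater_point; eexists; exact: a. Qed.

Let I0_le r : attained r -> I0 <= r.
Proof. by move=> ar; apply: ge_inf => //; exists 0. Qed.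

Let I0_ge0 : 0 <= I0.
Proof. by apply: lb_le_inf. Qed.

Let cper_diff k w : feasible k -> test_pair T nu w ->
  cper (k - vb - w).1 /\ cper (k - vb - w).2.
Proof.
move=> /feasibleP[c1 c2 _] /cper_test[d1 d2]; have [e1 e2] := cper_vb.
by split; apply: continuous_periodicB => //; exact: continuous_periodicB.
Qed.

Let subr_add3 (V : zmodType) (a b c e f g : V) :
  a + b - (c + e) - (f + g) = (a - c - f) + (b - e - g).
Proof.
by rewrite [- (c + e)]opprD [a + b + _]addrACA [- (f + g)]opprD [LHS]addrACA.
Qed.

Let scale_ineq (c r x a b C : R) : 0 <= C -> a <= c * b ->
  c * r * x + C * a <= c * (r * x + C * b).
Proof. by move=> C0 ab; have := ler_wpM2l C0 ab; lra. Qed.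

(* Exact penalization: moving from k towards the Slater point by the amount of
   the constraint violation restores the constraint, at a proportional cost. *)
Lemma penalty : exists2 Cp, 0 <= Cp & forall k w, feasible k -> test_pair T nu w ->
  0 <= cost k - I0 + Cp * slab_norm (k - vb - w).
Proof.
have [e [C [e0 [fk0 _] sl]]] := slater_point.
set k0 : Y := ((fun p => v0 p.2), (fun=> C%:M)) in fk0 sl.
have [c1 hc1] := cost_le (`|C| + e).
(* The comparison below gives [(e + eta) * I0 <= e * cost k + eta * |c1|]; since [0 <= I0], a unit
   of violation costs at most [|c1| / e]. *)
exists (`|c1| / e); first by rewrite divr_ge0// ltW.
move=> k w fk tw; set E := k - vb - w.
have [cE1 cE2] := cper_diff fk tw; rewrite -/E in cE1 cE2.
have bE := cper_slab_bounded cE1 cE2; set eta := slab_norm E.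
have eta0 : 0 <= eta by exact: slab_norm_ge0.
have [eta_eq|eta_neq] := eqVneq eta 0.
  rewrite eta_eq mulr0 addr0 subr_ge0; apply: I0_le; exists k, w; split => //.
  by rewrite -eta_eq; exact: norm_leP.
have etap : 0 < eta by rewrite lt_neqAle eq_sym eta_neq.
(* The Slater point displaced against the violation [E], as far as its radius [e] of feasibility
   allows. *)
pose kk : Y := k0 - (e / eta) *: E.
have ck0 : cper k0.1 /\ cper k0.2.
  by split; [exact: cper_vb.1|exact: continuous_periodic_cst].
have ckk1 : cper kk.1 by apply: continuous_periodicB; [exact: ck0.1|exact: continuous_periodicZ].
have ckk2 : cper kk.2 by apply: continuous_periodicB; [exact: ck0.2|exact: continuous_periodicZ].
have nkk : norm_le (kk - k0) e.
  have -> : kk - k0 = (- (e / eta)) *: E by rewrite /kk addrAC subrr add0r scaleNr.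
  have := @norm_leZ (- (e / eta)) E _ (norm_leP bE).
  by rewrite normrN ger0_norm ?divr_ge0 ?(ltW e0)// -/eta divfK.
have fkk : feasible kk.
  apply: sl => // p pT.
  have -> : kk.2 p = C%:M - (e / eta) *: (k.2 p - 0 - w.2 p) by [].
  have /feasibleP[_ _ ep] := fk; have /epigraphP[_ kT _] := ep p pT.
  by rewrite subr0 !linearB/= !linearZ/= tr_scalar_mx kT (test_pair_sym p tw).
have kkc : cost kk <= `|c1|.
  apply: le_trans (ler_norm c1); apply: hc1 => // p pT i.
  have [_ /(_ i i)] := nkk p pT.
  have -> : (kk - k0).2 p i i = kk.2 p i i - C by rewrite !mxE eqxx.
  move=> hh; rewrite -[kk.2 p i i](subrK C) addrC.
  by apply: le_trans (ler_normD _ _) _; rewrite lerD2l.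
have ee : 0 < e + eta by rewrite addr_gt0.
(* The weight at which the violations of [k] and [kk] cancel: [th = (1 - th) * (e / eta)]. *)
pose th := e / (e + eta).
have th0 : 0 <= th by rewrite divr_ge0// ltW.
have thE : 1 - th = eta / (e + eta) by rewrite /th; field; rewrite gt_eqF.
have th1 : 0 <= 1 - th by rewrite thE divr_ge0// ltW.
have fk' : feasible (th *: k + (1 - th) *: kk).
  by apply: feasible_convex => //; rewrite addrC subrK.
pose w' : Y := th *: w + (1 - th) *: (0, fun=> C%:M).
have tw' : test_pair T nu w' by apply: testD; apply: testZ => //; exact: test_pair_time.
have : I0 <= cost (th *: k + (1 - th) *: kk).
  apply: I0_le; exists (th *: k + (1 - th) *: kk), w'; split => //.
  have alg (a b c x C' : R) : x = a - b - c ->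
      th * a + (1 - th) * (C' - e / eta * x) - b - (th * c + (1 - th) * (C' - b)) = 0.
    by move=> ->; rewrite /th; field; rewrite eta_neq gt_eqF.
  move=> p pT; split=> [i|i j].
    rewrite (_ : _ 0 i = th * k.1 p 0 i + (1 - th) * (v0 p.2 0 i - e / eta * E.1 p 0 i)
       - v0 p.2 0 i - (th * w.1 p 0 i + (1 - th) * (v0 p.2 0 i - v0 p.2 0 i))).
      by rewrite alg ?normr0// !mxE.
    by rewrite subrr !mxE.
  rewrite (_ : _ i j = th * k.2 p i j + (1 - th) * ((C%:M : mat) i j - e / eta * E.2 p i j)
       - 0 - (th * w.2 p i j + (1 - th) * ((C%:M : mat) i j - 0))); last by rewrite !mxE !subr0.
  by rewrite alg ?normr0// !mxE.
have /feasibleP[_ ck2 _] := fk.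
rewrite cost_lin// => h1.
have h2 : (e + eta) * I0 <= e * cost k + eta * cost kk.
  have := ler_wpM2l (ltW ee) h1.
  rewrite thE (_ : (e + eta) * (th * cost k + eta / (e + eta) * cost kk) = e * cost k + eta * cost kk)//.
  by rewrite /th; field; rewrite gt_eqF.
rewrite -(pmulr_rge0 _ e0) mulrDr [e * (_ / _ * _)]mulrA [e * (_ / _)]mulrC divfK ?gt_eqF//.
have := ler_wpM2l eta0 kkc; have := mulr_ge0 eta0 I0_ge0; lra.
Qed.

(** Convexity makes the cone over the feasible set closed under addition, and the linear cost
    follows along; this is the addition condition of [sublinear_inf]. *)
Let cone_sum r1 r2 k1 k2 : 0 <= r1 -> 0 <= r2 -> feasible k1 -> feasible k2 ->
  exists k, [/\ feasible k,
    (r1 + r2) * (cost k - I0) = r1 * (cost k1 - I0) + r2 * (cost k2 - I0) &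
    (r1 + r2) *: (k - vb) = r1 *: (k1 - vb) + r2 *: (k2 - vb) :> Y].
Proof.
move=> r10 r20 f1 f2; have [r_eq|r_neq] := eqVneq (r1 + r2) 0.
  have -> : r1 = 0 by lra.
  have -> : r2 = 0 by lra.
  by exists k1; split; rewrite ?addr0 ?mul0r ?scale0r ?addr0.
have a1 : r1 / (r1 + r2) + r2 / (r1 + r2) = 1 by rewrite -mulrDl divff.
have r0 : 0 <= r1 + r2 by exact: addr_ge0.
exists (r1 / (r1 + r2) *: k1 + r2 / (r1 + r2) *: k2); split.
- by apply: feasible_convex => //; exact: divr_ge0.
- have /feasibleP[_ c1 _] := f1; have /feasibleP[_ c2 _] := f2.
  by rewrite cost_lin//; field.
- rewrite !scalerBr scalerDr !scalerA ![(r1 + r2) * _]mulrC !divfK//.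
  by rewrite scalerDl opprD addrACA.
Qed.

(* l is dominated by the sublinear functional
   y |-> inf_(r, k, w) r (cost k - I0) + Cp |y - r (k - v0) - w|, which penalty
   keeps finite; r = 0 and w = 0 give the bound, y = w the vanishing on w. *)
Lemma separation : exists2 Cp, 0 <= Cp & exists l : Y -> R,
  [/\ forall y y', slab_bounded y -> slab_bounded y' -> l (y + y') = l y + l y',
      forall c y, slab_bounded y -> l (c *: y) = c * l y,
      forall y, slab_bounded y -> `|l y| <= Cp * slab_norm y,
      forall k, feasible k -> I0 <= cost k - l (k - vb)
    & forall w, test_pair T nu w -> l w = 0].
Proof.
have [Cp Cp0 pen] := penalty; exists Cp => //.
pose G r k w : Y -> R := fun y => r * (cost k - I0) + Cp * slab_norm (y - r *: (k - vb) - w).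
pose Q : set (Y -> R) := [set f | exists r k w,
  [/\ 0 <= r, feasible k, test_pair T nu w & f = G r k w]].
have bw w : test_pair T nu w -> slab_bounded w.
  by move=> /cper_test[c1 c2]; exact: cper_slab_bounded.
have bvb : slab_bounded vb by apply: cper_slab_bounded; [exact: cper_vb.1|exact: cper_vb.2].
have bN y : slab_bounded y -> slab_bounded (- y).
  by rewrite -scaleN1r; exact: slab_boundedZ.
have bk k : feasible k -> slab_bounded (k - vb).
  by move=> /feasibleP[c1 c2 _]; apply: slab_boundedD; [exact: cper_slab_bounded|exact: bN].
have barg r k w y : feasible k -> test_pair T nu w -> slab_bounded y ->
    slab_bounded (y - r *: (k - vb) - w).
  move=> fk tw sy; apply: slab_boundedD; last exact/bN/bw.
  by apply: slab_boundedD => //; apply/bN/slab_boundedZ/bk.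
have [e [C [_ [fk0 _] _]]] := slater_point; set k0 : Y := (_, _) in fk0.
have [||||q [sq qle _]] := @sublinear_inf R Y slab_bounded slab_boundedD slab_boundedZ Q
    (fun y => - (Cp * slab_norm y)).
- by exists (G 0 k0 0), 0, k0, 0.
- move=> _ y [r [k [w [r0 fk tw ->]]]] sy; rewrite /G.
  set A := r *: (k - vb); have sarg := barg r k w y fk tw sy; rewrite -/A in sarg.
  have h1 : slab_norm (A + w) <= slab_norm (y - A - w) + slab_norm y.
    have -> : A + w = (-1) *: (y - A - w) + y.
      by rewrite scaleN1r -addrA -opprD opprB subrK.
    apply: le_trans (slab_normD (slab_boundedZ (- 1) sarg) sy) _.
    by rewrite lerD2r; have := slab_normZ (- 1) sarg; rewrite normrN1 mul1r.
  (* This is [pen] for the test pair [- r^-1 *: w], multiplied by [r]. *)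
  have h2 : 0 <= r * (cost k - I0) + Cp * slab_norm (A + w).
    have sAw : slab_bounded (A + w) by apply: slab_boundedD; [exact/slab_boundedZ/bk|exact: bw].
    move: r0; rewrite le_eqVlt => /orP[/eqP<-|r0].
      by rewrite mul0r add0r mulr_ge0// slab_norm_ge0.
    have := pen k (- r^-1 *: w) fk (testZ _ tw).
    have -> : k - vb - - r^-1 *: w = r^-1 *: (A + w).
      by rewrite scaleNr opprK scalerDr /A scalerA mulVf ?scale1r// gt_eqF.
    have := slab_normZ r^-1 sAw; rewrite ger0_norm ?invr_ge0 ?(ltW r0)// => h3 h4.
    have := ler_wpM2l (ltW r0) (le_trans h4 (lerD (lexx _) (ler_wpM2l Cp0 h3))).
    by rewrite mulr0 mulrDr [r * (Cp * _)]mulrCA mulVKf ?gt_eqF.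
  have := ler_wpM2l Cp0 h1; lra.
- move=> _ _ y y' [r [k [w [r0 fk tw ->]]]] [r' [k' [w' [r'0 fk' tw' ->]]]] sy sy'.
  have [k2 [fk2 ce ve]] := cone_sum r0 r'0 fk fk'.
  exists (G (r + r') k2 (w + w')).
    by exists (r + r'), k2, (w + w'); split => //; [exact: addr_ge0|exact: testD].
  rewrite /G ce ve.
  have -> : y + y' - (r *: (k - vb) + r' *: (k' - vb)) - (w + w') =
    (y - r *: (k - vb) - w) + (y' - r' *: (k' - vb) - w').
    exact: subr_add3.
  rewrite [leRHS]addrACA lerD2l -mulrDr ler_wpM2l//.
  by apply: slab_normD; exact: barg.
- move=> _ c y [r [k [w [r0 fk tw ->]]]] c0 sy; exists (G (c * r) k (c *: w)).
    by exists (c * r), k, (c *: w); split => //; [exact: mulr_ge0|exact: testZ].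
  have E : c *: y - (c * r) *: (k - vb) - c *: w = c *: (y - r *: (k - vb) - w) :> Y.
    by rewrite -scalerA -!scalerBr.
  have h1 : slab_norm (c *: y - (c * r) *: (k - vb) - c *: w) <=
      c * slab_norm (y - r *: (k - vb) - w).
    by have := slab_normZ c (barg r k w y fk tw sy); rewrite ger0_norm// -E.
  exact: scale_ineq Cp0 h1.
have [l [lD lZ lq]] := @hahn_banach R Y slab_bounded slab_bounded0 slab_boundedD slab_boundedZ q sq.
have lG r k w y : 0 <= r -> feasible k -> test_pair T nu w -> slab_bounded y -> l y <= G r k w y.
  move=> r0 fk tw sy; apply: le_trans (lq _ sy) _; apply: qle => //.
  by exists r, k, w.
have lN y : slab_bounded y -> l (- y) = - l y.
  by move=> sy; rewrite -scaleN1r lZ// mulN1r.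
have lle y : slab_bounded y -> l y <= Cp * slab_norm y.
  move=> sy; have := lG 0 k0 0 y (lexx 0) fk0 test0 sy.
  by rewrite /G mul0r add0r scale0r !subr0.
exists l; split => //.
- move=> y sy; rewrite ler_norml lle// andbT.
  have := lle _ (bN _ sy); rewrite lN// => h1.
  have := slab_normZ (- 1) sy; rewrite scaleN1r normrN1 mul1r => h2.
  by have := ler_wpM2l Cp0 h2; lra.
- move=> k fk; have := lG 1 k 0 _ ler01 fk test0 (bk _ fk).
  rewrite /G mul1r scale1r subrr subr0.
  have := slab_norm_le (lexx 0) norm_le0 => h1.
  by have := ler_wpM2l Cp0 h1; lra.
- move=> w tw; have lw w' : test_pair T nu w' -> l w' <= 0.
    move=> tw'; have := lG 0 k0 w' _ (lexx 0) fk0 tw' (bw _ tw').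
    rewrite /G mul0r add0r scale0r subr0 subrr.
    have := slab_norm_le (lexx 0) norm_le0 => h1.
    by have := ler_wpM2l Cp0 h1; lra.
  apply/eqP; rewrite eq_le lw//=; have := lw _ (testZ (- 1) tw).
  by rewrite lZ ?mulN1r ?oppr_le0//; exact: bw.
Qed.

End duality.

(** * Strong duality *)

Section maximizer.
Context {R : realType} {d : nat}.
Local Notation N := (dimN d).
Local Notation X := (Xd (R := R) (d := d)).
Local Notation spacetime := (R * 'rV[R]_d)%type.
Local Notation vec := 'rV[R]_N.
Local Notation mat := 'M[R]_N.
Let Y : lmodType R := ((spacetime -> vec) * (spacetime -> mat))%type.
Variables (T : R) (T0 : 0 < T) (l : Y -> R) (C : R).
Local Notation D := (domain T : set X).
Local Notation cper := (continuous_periodic T).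
Hypothesis C0 : 0 <= C.
Hypothesis lD : forall y y', slab_bounded T y -> slab_bounded T y' -> l (y + y') = l y + l y'.
Hypothesis lZ : forall c y, slab_bounded T y -> l (c *: y) = c * l y.
Hypothesis lC : forall y, slab_bounded T y -> `|l y| <= C * slab_norm T y.

Let lM y M : 0 <= M -> norm_le T y M -> `|l y| <= C * M.
Proof.
move=> M0 yM; have sy : slab_bounded T y by exists M.
by apply: le_trans (lC sy) _; rewrite ler_wpM2l//; exact: slab_norm_le.
Qed.

(** [fundamental] extends [g] periodically, in general with jumps at the faces of the box. *)
Definition on_entry i (g : X -> R) : (spacetime -> vec) * (spacetime -> mat) :=
  (fun p => g (fundamental p) *: delta_mx 0 i, 0).

Definition on_entries i j (g : X -> R) : (spacetime -> vec) * (spacetime -> mat) :=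
  (0, fun p => g (fundamental p) *: (delta_mx i j + delta_mx j i)).

Let on_entry_norm i g M : 0 <= M -> (forall p, D p -> `|g p| <= M) -> norm_le T (on_entry i g) M.
Proof.
move=> M0 gM p pT; have gp := gM _ (fundamental_domain pT); split=> [k|a b] /=; rewrite !mxE.
  rewrite normrM; apply: le_trans gp; rewrite ler_piMr// eqxx /=.
  by case: (_ == _); rewrite ?normr1 ?normr0.
by rewrite normr0.
Qed.

Let on_entries_norm i j g M : 0 <= M -> (forall p, D p -> `|g p| <= M) ->
  norm_le T (on_entries i j g) (2 * M).
Proof.
move=> M0 gM p pT; have gp := gM _ (fundamental_domain pT); split=> [k|a b] /=; rewrite !mxE.
  by rewrite normr0 mulr_ge0.
rewrite normrM mulrC; apply: ler_pM => //; apply: le_trans (ler_normD _ _) _.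
by do 2! case: (_ && _); rewrite ?normr1 ?normr0; lra.
Qed.

Let on_entryD i (f g : X -> R) : on_entry i (fun p => f p + g p) = on_entry i f + on_entry i g :> Y.
Proof.
apply: (f_equal2 (@pair (spacetime -> vec) (spacetime -> mat))); last by rewrite addr0.
by apply/funext => p; rewrite scalerDl.
Qed.

Let on_entryZ i c (f : X -> R) : on_entry i (fun p => c * f p) = c *: (on_entry i f : Y).
Proof.
apply: (f_equal2 (@pair (spacetime -> vec) (spacetime -> mat))); last by rewrite scaler0.
by apply/funext => p; rewrite -scalerA.
Qed.

Let on_entriesD i j (f g : X -> R) :
  on_entries i j (fun p => f p + g p) = on_entries i j f + on_entries i j g :> Y.
Proof.
apply: (f_equal2 (@pair (spacetime -> vec) (spacetime -> mat))); first by rewrite addr0.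
by apply/funext => p; rewrite scalerDl.
Qed.

Let on_entriesZ i j c (f : X -> R) : on_entries i j (fun p => c * f p) = c *: (on_entries i j f : Y).
Proof.
apply: (f_equal2 (@pair (spacetime -> vec) (spacetime -> mat))); first by rewrite scaler0.
by apply/funext => p; rewrite -scalerA.
Qed.

Let bounded_ge0 g : bounded_on_domain T g -> exists2 M, 0 <= M & forall p : X, D p -> `|g p| <= M.
Proof.
move=> [M hM]; exists `|M| => // p pD; apply: le_trans (hM p pD) _; exact: ler_norm.
Qed.

Let sb_entry i g : bounded_on_domain T g -> slab_bounded T (on_entry i g).
Proof. by move=> /bounded_ge0[M M0 hM]; exists M; exact: on_entry_norm. Qed.

Let sb_entries i j g : bounded_on_domain T g -> slab_bounded T (on_entries i j g).
Proof. by move=> /bounded_ge0[M M0 hM]; exists (2 * M); exact: on_entries_norm. Qed.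

Definition Efun i (g : X -> R) : R := - l (on_entry i g).

(* on_entries i j is symmetric, so that the pairing with a symmetric matrix
   counts every entry twice. *)
Definition Bfun i j (g : X -> R) : R := - (2^-1 * l (on_entries i j g)).

Definition Emax : vmeasure (R := R) (d := d) := fun i => riesz_charge T0 (Efun i).

Definition Bmax : mmeasure (R := R) (d := d) := fun i j => riesz_charge T0 (Bfun i j).

(** A witness that the domain is nonempty, so that any bound [M] of a modulus on it is
    nonnegative. *)
Let domain_pt : D (0, [tuple 0 | j < d]).
Proof. by split=> [|j]; rewrite /= ?lexx ?(ltW T0)// tnth_mktuple lexx ltr01. Qed.

Lemma EmaxE i (f : spacetime -> R) : cper f ->
  charge_integral (Emax i) D (fun p => f (point p)) = Efun i (fun p => f (point p)).
Proof.
move=> cf; rewrite /Emax; apply: (@riesz_chargeE _ _ T T0 _ C) => //.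
- by move=> g g' bg bg'; rewrite /Efun on_entryD lD ?opprD//; exact: sb_entry.
- by move=> c g bg; rewrite /Efun on_entryZ lZ ?mulrN//; exact: sb_entry.
- move=> g M gM; have M0 : 0 <= M := le_trans (normr_ge0 _) (gM _ domain_pt).
  by rewrite /Efun normrN; apply: lM => //; exact: on_entry_norm.
Qed.

Lemma BmaxE i j (f : spacetime -> R) : cper f ->
  charge_integral (Bmax i j) D (fun p => f (point p)) = Bfun i j (fun p => f (point p)).
Proof.
move=> cf; rewrite /Bmax; apply: (@riesz_chargeE _ _ T T0 _ C) => //.
- by move=> g g' bg bg'; rewrite /Bfun on_entriesD lD ?mulrDr ?opprD//; exact: sb_entries.
- by move=> c g bg; rewrite /Bfun on_entriesZ lZ ?mulrN 1?mulrCA//; exact: sb_entries.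
- move=> g M gM; have M0 : 0 <= M := le_trans (normr_ge0 _) (gM _ domain_pt).
  rewrite /Bfun normrN normrM ger0_norm ?invr_ge0//.
  (* The factor 2 in the norm of [on_entries] cancels the [2^-1] of [Bfun], so [C] remains the
     bound. *)
  have := lM (mulr_ge0 (ler0n R 2) M0) (on_entries_norm i j M0 gM); lra.
Qed.

Lemma is_vmeasure_Emax : is_vmeasure T Emax.
Proof. by move=> i; exact: riesz_charge_carried. Qed.

Lemma is_sym_mmeasure_Bmax : is_sym_mmeasure T Bmax.
Proof.
split; first by move=> i j; exact: riesz_charge_carried.
move=> i j A _; rewrite /Bmax (_ : Bfun i j = Bfun j i)//.
by apply/funext => g; rewrite /Bfun /on_entries addrC.
Qed.

Let norm_le_entries (v : spacetime -> vec) (M : spacetime -> mat) :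
  cper v -> cper M -> slab_bounded T (v, M).
Proof. by move=> cv cM; exact: (cper_slab_bounded T0). Qed.

Let cper0 (V : normedModType R) : cper (0 : spacetime -> V).
Proof. exact: continuous_periodic_cst. Qed.

Let cper_scaled m n (f : spacetime -> R) (A : 'M[R]_(m, n)) : cper f -> cper (fun p => f p *: A).
Proof.
move=> cf; apply: continuous_periodic_mx => i j.
by under eq_fun do rewrite mxE; apply: continuous_periodicM => //; exact: continuous_periodic_cst.
Qed.

Let l_vsum (I : Type) (r : seq I) (F : I -> spacetime -> vec) : (forall i, cper (F i)) ->
  l (fun p => \sum_(i <- r) F i p, 0) = \sum_(i <- r) l (F i, 0).
Proof.
move=> cF; elim: r => [|i r IH].
  rewrite big_nil (_ : (_, _) = 0 *: (0 : Y)); last first.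
    rewrite scaler0; apply: (f_equal2 (@pair (spacetime -> vec) (spacetime -> mat))) => //.
    by apply/funext => p; rewrite big_nil.
  by rewrite lZ ?mul0r//; exact: slab_bounded0.
rewrite big_cons -IH -lD; last 2 first.
- exact: (norm_le_entries (cF i) (cper0 _)).
- exact: (norm_le_entries (continuous_periodic_sum r cF) (cper0 _)).
congr l; apply: (f_equal2 (@pair (spacetime -> vec) (spacetime -> mat))); last by rewrite addr0.
by apply/funext => p; rewrite big_cons.
Qed.

Let l_msum (I : Type) (r : seq I) (F : I -> spacetime -> mat) : (forall i, cper (F i)) ->
  l (0, fun p => \sum_(i <- r) F i p) = \sum_(i <- r) l (0, F i).
Proof.
move=> cF; elim: r => [|i r IH].
  rewrite big_nil (_ : (_, _) = 0 *: (0 : Y)); last first.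
    rewrite scaler0; apply: (f_equal2 (@pair (spacetime -> vec) (spacetime -> mat))) => //.
    by apply/funext => p; rewrite big_nil.
  by rewrite lZ ?mul0r//; exact: slab_bounded0.
rewrite big_cons -IH -lD; last 2 first.
- exact: (norm_le_entries (cper0 _) (cF i)).
- exact: (norm_le_entries (cper0 _) (continuous_periodic_sum r cF)).
congr l; apply: (f_equal2 (@pair (spacetime -> vec) (spacetime -> mat))); first by rewrite addr0.
by apply/funext => p; rewrite big_cons.
Qed.

(** The seminorm bound makes [l] blind to values off the slab; the matrix field in [mpairing_Bmax]
    is symmetric on the slab only. *)
Let l_eq y y' : slab_bounded T y' -> norm_le T (y - y') 0 -> l y = l y'.
Proof.
move=> sy' yy'; have sd : slab_bounded T (y - y') by exists 0.
rewrite -[y](subrK y') lD//; have := lM (lexx 0) yy'.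
by rewrite mulr0 normr_le0 => /eqP ->; rewrite add0r.
Qed.

Lemma vpairing_Emax (v : spacetime -> vec) : cper v -> vpairing T v Emax = - l (v, 0).
Proof.
move=> cv; rewrite /vpairing.
under eq_bigr => i _ do rewrite (EmaxE i (continuous_periodic_entry 0 i cv)) /Efun.
rewrite sumrN; congr (- _).
have cF i : cper (fun p => v p 0 i *: delta_mx 0 i : vec).
  by apply: cper_scaled; exact: continuous_periodic_entry.
rewrite (_ : (v, 0) = (fun p => \sum_i v p 0 i *: delta_mx 0 i, 0)); last first.
  congr pair; apply/funext => p; exact: row_sum_delta.
rewrite l_vsum//; apply: eq_bigr => i _; congr l; rewrite /on_entry; congr pair.
apply/funext => p; congr (_ *: _).
exact: (periodic_fundamental p (continuous_periodic_entry 0 i cv).2).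
Qed.

Lemma mpairing_Bmax (M : spacetime -> mat) : cper M ->
  (forall p, slab T p -> (M p)^T = M p) -> mpairing T M Bmax = - l (0, M).
Proof.
move=> cM sM; rewrite /mpairing pair_big /=.
under eq_bigr => ij _ do rewrite (BmaxE ij.1 ij.2 (continuous_periodic_entry ij.1 ij.2 cM)) /Bfun.
rewrite sumrN -mulr_sumr; congr (- _).
pose F (ij : 'I_N * 'I_N) p : mat := M p ij.1 ij.2 *: (delta_mx ij.1 ij.2 + delta_mx ij.2 ij.1).
have cF ij : cper (F ij).
  by apply: cper_scaled; exact: continuous_periodic_entry.
have -> : \sum_ij l (on_entries ij.1 ij.2 (fun p => M (point p) ij.1 ij.2)) = \sum_ij l (0, F ij).
  apply: eq_bigr => ij _; congr l; rewrite /on_entries; congr pair.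
  apply/funext => p; congr (_ *: _).
  exact: (periodic_fundamental p (continuous_periodic_entry ij.1 ij.2 cM).2).
rewrite -l_msum// -lZ; last first.
  exact: (norm_le_entries (cper0 _) (continuous_periodic_sum _ cF)).
apply: l_eq; first exact: (norm_le_entries (cper0 _) cM).
move=> p pT; split=> [k|a b].
  change (`|(2^-1 *: (0 : vec) - 0) 0 k| <= 0).
  by rewrite scaler0 subr0 mxE normr0.
have SE : \sum_ij F ij p = M p + (M p)^T.
  rewrite -(pair_big xpredT xpredT (fun i j => F (i, j) p)) /F /=.
  under eq_bigr do under eq_bigr do rewrite scalerDr.
  under eq_bigr do rewrite big_split /=.
  rewrite big_split /= -matrix_sum_delta; congr (_ + _).
  rewrite exchange_big [RHS]matrix_sum_delta; apply: eq_bigr => i _; apply: eq_bigr => j _.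
  by rewrite mxE.
rewrite (_ : _ a b = 2^-1 * (\sum_ij F ij p) a b - M p a b); last by rewrite !mxE.
rewrite SE sM// mxE (_ : _ - _ = 0) ?normr0//; lra.
Qed.

End maximizer.

(** * Optimality of the constructed pair and absence of a gap *)

Section conclusion.
Context {R : realType} {d : nat}.
Local Notation N := (dimN d).
Local Notation X := (Xd (R := R) (d := d)).
Local Notation spacetime := (R * 'rV[R]_d)%type.
Local Notation vec := 'rV[R]_N.
Local Notation mat := 'M[R]_N.
Let Y : lmodType R := ((spacetime -> vec) * (spacetime -> mat))%type.
Variables (T nu : R) (P U h : R -> R) (v0 : 'rV[R]_d -> vec).
Hypotheses (T0 : 0 < T) (PU : pressure_law d P U) (hw : weight T h) (v0i : initial_datum nu v0).
Local Notation D := (domain T : set X).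
Local Notation cper := (continuous_periodic T).

Let cper_v0 : cper (fun p : spacetime => v0 p.2).
Proof.
have [[cv pv] _ _ _] := v0i; split; last by move=> t x j /=; rewrite pv.
apply: continuous_subspaceT => p; apply: continuous_comp; first exact: cvg_snd.
exact: cv.
Qed.

Let I0 := inf (attained T nu P U h v0).

Let lagrangian_inf (E : vmeasure (R := R) (d := d)) B := ereal_inf [set r | exists v M,
  primal_pair T P U v M /\ r = (lagrangian T h v0 v M E B)%:E].

Let dual_valueE (E : vmeasure (R := R) (d := d)) B :
  dual_value T h P U v0 E B = lagrangian_inf E B.
Proof.
pose S : set R := [set r | exists v M, primal_pair T P U v M /\
  r = vpairing T v E + 2^-1 * weighted_pairing T h M B].
rewrite /dual_value /K /lagrangian_inf -EFinN.
have -> : [set r | exists z M, primal_pair T P U z M /\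
    r = (vpairing T z E + 2^-1 * weighted_pairing T h M B)%:E] = [set x%:E | x in S].
  apply/seteqP; split => [_ [v [M [vM ->]]]|_ [_ [v [M [vM ->]]] <-]].
    by eexists; first by exists v, M.
  by exists v, M.
rewrite -ereal_inf_shift; congr ereal_inf.
have lE v M : primal_pair T P U v M -> lagrangian T h v0 v M E B =
    - vpairing T (fun p => v0 p.2) E + (vpairing T v E + 2^-1 * weighted_pairing T h M B).
  by move=> [cv _ _ _]; rewrite /lagrangian vpairingB//; ring.
apply/seteqP; split => [_ [_ [v [M [vM ->]]] <-]|_ [v [M [vM ->]]]].
  by exists v, M; rewrite lE.
by eexists; [by exists v, M|rewrite lE].
Qed.

Let maximizer_exists : exists E B, dual_feasible T nu h E B /\ (I0%:E <= lagrangian_inf E B)%E.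
Proof.
have [Cp Cp0 [l [lD lZ lC lk lw]]] := separation T0 PU hw v0i.
pose E := Emax T0 l; pose B := Bmax T0 l.
have vE v := vpairing_Emax T0 Cp0 lD lZ lC (v := v).
have mE M := mpairing_Bmax T0 Cp0 lD lZ lC (M := M).
have carE : is_vmeasure T E by exact: is_vmeasure_Emax.
have symB : is_sym_mmeasure T B by exact: is_sym_mmeasure_Bmax.
have sb (v : spacetime -> vec) (M : spacetime -> mat) : cper v -> cper M -> slab_bounded T (v, M).
  by move=> cv cM; exact: (cper_slab_bounded T0).
have cper0 (V : normedModType R) : cper (0 : spacetime -> V) by exact: continuous_periodic_cst.
have lpair (v : spacetime -> vec) (M : spacetime -> mat) : cper v -> cper M ->
    l (v, M) = l (v, 0) + l (0, M).
  move=> cv cM; rewrite -lD; [|exact: (sb _ _ cv (cper0 _))|exact: (sb _ _ (cper0 _) cM)]; congr l.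
  by apply: (f_equal2 (@pair (spacetime -> vec) (spacetime -> mat))); rewrite ?addr0 ?add0r.
exists E, B; split; last first.
  apply: le_ereal_inf_tmp => _ [v [M [vM ->]]]; rewrite lee_fin.
  have := lk (v, M) vM; have [cv cM sM _] := vM.
  have cvv : cper (fun p => v p - v0 p.2) by exact: continuous_periodicB.
  rewrite /lagrangian /weighted_pairing vE// mE// /cost /=.
  have -> : ((v, M) - ((fun p => v0 p.2), 0) : Y) = ((fun p => v p - v0 p.2), M).
    by apply: (f_equal2 (@pair (spacetime -> vec) (spacetime -> mat))); rewrite ?subr0.
  rewrite (lpair _ _ cvv cM) -/I0; lra.
have LCEB : LC T nu E B.
  move=> Psi tPsi AP P0.
  have tw : test_pair T nu (Lop nu Psi, fun p => \matrix_(i, j) dt (fun p' => Psi p' i j) p).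
    by exists Psi.
  have [c1 c2] := test_pair_continuous tw.
  have c1' : cper (Lop nu Psi) by apply: continuous_periodic_mx => i j; rewrite ord1; exact: c1.
  have c2' := continuous_periodic_mx c2.
  rewrite vE// mE//; last by move=> p _; exact: (test_pair_sym p tw).
  by have := lw _ tw; rewrite lpair//; lra.
split=> //; have [sh _] := hw.
apply: (weighted_psd_continuous T0) => //; first exact: smooth_continuous.
move=> g z cg g0.
have [e [C [e0 [fk0 _] sl]]] := slater_point h T0 PU v0i.
pose Z : mat := z *m z^T.
have ZE i j : Z i j = z i 0 * z j 0 by rewrite mxE big_ord_recl big_ord0 addr0 mxE.
pose M (t : R) (p : spacetime) : mat := C%:M + (t * g p) *: Z.
have cgZ : cper (fun p => g p *: Z).
  apply: continuous_periodic_mx => i j.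
  by under eq_fun do rewrite mxE; apply: continuous_periodicM => //; exact: continuous_periodic_cst.
have ZT : Z^T = Z by rewrite trmx_mul trmxK.
pose G : Y := (0, fun p => g p *: Z).
pose k0 : Y := (fun p => v0 p.2, fun=> C%:M).
have feas t : 0 <= t -> feasible T P U (k0 + t *: G).
  move=> t0; have /feasibleP[c1 c2 ep] := fk0; apply/feasibleP; split.
  - by apply: continuous_periodicD => //; apply: continuous_periodicZ; exact: cper0.
  - by apply: continuous_periodicD => //; apply: continuous_periodicZ.
  - move=> p pT; have -> : (k0 + t *: G).1 p = v0 p.2 by apply/rowP => i; rewrite !mxE mulr0 addr0.
    apply: epigraph_addr; first exact: (ep p pT).
    split; first by rewrite !linearZ/= ZT.
    move=> y; rewrite -/(qform _ y) !qformZ mulr_ge0// mulr_ge0//.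
    rewrite (_ : Z = (z^T)^T *m z^T); last by rewrite trmxK.
    by rewrite qform_outer sqr_ge0.
have bg := bounded_measurable_point T0 cg.
have cG : cost T h G = 2^-1 * (Rintegral dxdt D (fun p => h p.1 * g (point p)) * \sum_i z i 0 ^+ 2).
  have chg : cper (fun p => h p.1 * g p).
    apply: continuous_periodicM => //.
    exact: (continuous_periodic_comp (smooth_continuous sh) (continuous_periodic_time T)).
  rewrite /cost; congr (_ * _); rewrite -RintegralZr//; last 2 first.
  - exact: measurable_domain.
  - apply: bounded_measurable_integrable; [exact: measurable_domain|exact: dxdt_fin|].
    exact: (bounded_measurable_point T0 chg).
  apply: eq_Rintegral => p _; rewrite -mulrA /G/= mxtraceZ; congr (_ * (_ * _)).
  by apply: eq_bigr => i _; rewrite ZE expr2.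
have ciZ (nu' : {charge set X -> \bar R}) c : charge_integral nu' D (fun p => c * g (point p)) =
    c * charge_integral nu' D (fun p => g (point p)).
  rewrite (_ : c * _ = (c - 1) * charge_integral nu' D (fun p => g (point p)) +
    charge_integral nu' D (fun p => g (point p))); last by ring.
  by rewrite -(charge_integral_lin nu' (c - 1) bg bg); congr charge_integral; apply/funext => p; ring.
have lG : - l G = \sum_i \sum_j z i 0 * charge_integral (B i j) D (fun p => g (point p)) * z j 0.
  rewrite /G -(mE _ cgZ); last by move=> p _; rewrite linearZ/= ZT.
  apply: eq_bigr => i _; apply: eq_bigr => j _.
  rewrite mulrAC -ciZ; congr charge_integral; apply/funext => p.
  by rewrite mxE ZE mulrC.
have sG : slab_bounded T G by exact: (sb _ _ (cper0 _) cgZ).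
have [ck1 ck2 _] := (feasibleP _ _ _ _).1 fk0.
(* Along the ray [k0 + t *: G] the excess over [I0] is affine in [t] and never negative, so its
   slope [cost T h G - l G] is nonnegative; twice this slope is the expression to be bounded. *)
have pos t : 0 <= t ->
    0 <= cost T h k0 - l (k0 - (fun p => v0 p.2, 0)) - I0 + t * (cost T h G - l G).
  move=> t0; have := lk _ (feas t t0).
  have -> : cost T h (k0 + t *: G) = cost T h k0 + t * cost T h G.
    by have := cost_lin T0 hw 1 t (k := k0) (k' := G) ck2 cgZ; rewrite scale1r mul1r.
  have -> : k0 + t *: G - (fun p => v0 p.2, 0) = (k0 - (fun p => v0 p.2, 0)) + t *: G :> Y.
    by rewrite addrAC.
  rewrite lD; [rewrite lZ//|..|exact: slab_boundedZ]; last first.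
    apply: (cper_slab_bounded T0); first exact: continuous_periodicB.
    by apply: continuous_periodicB => //; exact: cper0.
  rewrite -/I0; lra.
have : 0 <= cost T h G - l G.
  rewrite leNgt; apply/negP; set b := cost T h G - l G in pos * => b0.
  (* With a negative slope [b], the excess at this [t] would be [a - |a| - 1 < 0]. *)
  set a := _ - _ - I0 in pos; have t0 : 0 <= (`|a| + 1) / - b.
    by rewrite divr_ge0 ?oppr_ge0 ?(ltW b0)// addr_ge0.
  have := pos _ t0; rewrite invrN mulrN mulNr divfK ?lt_eqF//; have := ler_norm a; lra.
rewrite cG; move: lG; lra.
Qed.

(** At such a pair (LC) cancels all terms containing [E] and [B]: the Lagrangian is the cost for
    every constrained pair, and so is its supremum. *)
Let I_le_cost k : attained T nu P U h v0 k -> (I_tilde T nu h P U v0 <= k%:E)%E.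
Proof.
move=> [[v M] [w [vM [Psi [tPsi AP P0 ->]] nkw ->]]].
apply: ge_ereal_inf; exists (ereal_sup [set r | exists E B, constrained_pair T nu E B /\
          r = (lagrangian T h v0 v M E B)%:E]); first by exists v, M.
apply: ge_ereal_sup => _ [E [B [[_ _ lc] ->]]]; rewrite lee_fin.
have := lc _ tPsi AP P0; set L := Lop nu Psi; set dP := fun p => _.
have vL p : slab T p -> v p - v0 p.2 = L p.
  move=> pT; apply/rowP => i; have [/(_ i) + _] := nkw p pT.
  rewrite (_ : _ 0 i = (v p - v0 p.2) 0 i - L p 0 i); last by rewrite [RHS]addrC mxE addrC mxE.
  by rewrite normr_le0 subr_eq0 => /eqP.
have mL p : slab T p -> M p = dP p.
  move=> pT; apply/matrixP => i j; have [_ /(_ i j)] := nkw p pT.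
  rewrite (_ : _ i j = M p i j - 0 - dP p i j); last by rewrite !mxE.
  by rewrite subr0 normr_le0 subr_eq0 => /eqP.
rewrite /lagrangian /weighted_pairing (vpairing_eq _ vL) (mpairing_eq _ mL) /cost /=; lra.
Qed.

(** The zero measures satisfy (LC), and for them the Lagrangian is the nonnegative cost. *)
Let I_ge0 : (0 <= I_tilde T nu h P U v0)%E.
Proof.
apply: le_ereal_inf_tmp => _ [v [M [vM ->]]].
pose E0 : vmeasure (R := R) (d := d) := fun=> czero.
pose B0 : mmeasure (R := R) (d := d) := fun _ _ => czero.
have [cv cM sM ep] := vM.
have ci0 (f : spacetime -> R) : cper f ->
    charge_integral (czero : {charge set X -> \bar R}) D (fun p => f (point p)) = 0.
  by move=> cf; apply: charge_integral_czero; exact: bounded_measurable_point.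
have vp0 (w : spacetime -> vec) : cper w -> vpairing T w E0 = 0.
  by move=> cw; rewrite /vpairing big1// => i _; exact: (ci0 _ (continuous_periodic_entry 0 i cw)).
have mp0 (L : spacetime -> mat) : cper L -> mpairing T L B0 = 0.
  move=> cL; rewrite /mpairing big1// => i _; rewrite big1// => j _.
  exact: (ci0 _ (continuous_periodic_entry i j cL)).
apply: (@le_trans _ _ (lagrangian T h v0 v M E0 B0)%:E); last first.
  apply: ereal_sup_ubound; exists E0, B0; split => //; split.
  - by move=> i A _ _.
  - by split => // i j A _ _.
  - move=> Psi tPsi AP P0.
    have tw : test_pair T nu (Lop nu Psi, fun p => \matrix_(i, j) dt (fun p' => Psi p' i j) p).
      by exists Psi.
    have [c1 c2] := test_pair_continuous tw.
    rewrite mp0 ?vp0 ?addr0//; last exact: continuous_periodic_mx.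
    by apply: continuous_periodic_mx => i j; rewrite ord1; exact: c1.
rewrite lee_fin /lagrangian vp0 ?add0r; last exact: continuous_periodicB.
rewrite /weighted_pairing mp0// mulr0 addr0.
exact: (cost_ge0 PU hw (k := (v, M)) vM).
Qed.

Let I_le : (I_tilde T nu h P U v0 <= I0%:E)%E.
Proof.
have [e [C [_ [_ a0] _]]] := slater_point h T0 PU v0i.
have Ifin : I_tilde T nu h P U v0 \is a fin_num.
  by rewrite ge0_fin_numE//; apply: le_lt_trans (I_le_cost a0) (ltry _).
rewrite -(fineK Ifin) lee_fin; apply: lb_le_inf; first by eexists; exact: a0.
by move=> r ar; rewrite -lee_fin fineK//; exact: I_le_cost.
Qed.

Theorem strong_duality :
  (exists E B, dual_feasible T nu h E B /\
     dual_value T h P U v0 E B = J_dual T nu h P U v0) /\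
  J_tilde T nu h P U v0 = J_dual T nu h P U v0 /\
  (0 <= I_tilde T nu h P U v0)%E /\
  I_tilde T nu h P U v0 = J_tilde T nu h P U v0 /\
  (J_tilde T nu h P U v0 < +oo)%E.
Proof.
have [E [B [fEB IEB]]] := maximizer_exists.
have valE : (dual_value T h P U v0 E B <= J_dual T nu h P U v0)%E.
  by apply: ereal_sup_ubound; exists E, B.
have dualJ : (J_dual T nu h P U v0 <= J_tilde T nu h P U v0)%E.
  apply: ge_ereal_sup => _ [E' [B' [[cEB _] ->]]]; rewrite dual_valueE.
  by apply: ereal_sup_ubound; exists E', B'.
have JI : (J_tilde T nu h P U v0 <= I_tilde T nu h P U v0)%E.
  apply: ge_ereal_sup => _ [E' [B' [cEB ->]]].
  apply: le_ereal_inf_tmp => _ [v [M [vM ->]]].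
  apply: (@le_trans _ _ (lagrangian T h v0 v M E' B')%:E).
    by apply: ereal_inf_lbound; exists v, M.
  by apply: ereal_sup_ubound; exists E', B'.
(* Together with [I_le] the chain closes: [I0], the value at [(E, B)], [J_dual], [J_tilde],
   [I_tilde], and [I0] again are in increasing order. *)
rewrite -dual_valueE in IEB.
have eJI : I_tilde T nu h P U v0 = J_tilde T nu h P U v0.
  apply/eqP; rewrite eq_le JI andbT.
  exact: le_trans I_le (le_trans IEB (le_trans valE dualJ)).
have eJd : J_tilde T nu h P U v0 = J_dual T nu h P U v0.
  apply/eqP; rewrite eq_le dualJ andbT.
  exact: le_trans JI (le_trans I_le (le_trans IEB valE)).
split; last split=> //.
  exists E, B; split => //; apply/eqP; rewrite eq_le valE/=.
  exact: le_trans dualJ (le_trans JI (le_trans I_le IEB)).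
by split; [exact: I_ge0|split=> //; exact: le_lt_trans (le_trans JI I_le) (ltry _)].
Qed.

End conclusion.

Theorem corollary5p9 (R : realType) (d : nat) (T s : R) (P U h : R -> R)
    (v0 : 'rV[R]_d -> 'rV[R]_(dimN d)) :
  (0 < d)%N -> 0 < T -> -1 < s ->
  pressure_law d P U -> weight T h ->
  let nu := (s + 3) / 2 in
  initial_datum nu v0 ->
  (exists E B, dual_feasible T nu h E B /\
     dual_value T h P U v0 E B = J_dual T nu h P U v0) /\
  J_tilde T nu h P U v0 = J_dual T nu h P U v0 /\
  (0 <= I_tilde T nu h P U v0)%E /\
  I_tilde T nu h P U v0 = J_tilde T nu h P U v0 /\
  (J_tilde T nu h P U v0 < +oo)%E.
Proof. by move=> _ T0 _ PU hw nu v0i; exact: strong_duality. Qed.
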